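(* Fix $\beta_*>1$, $L_*>0$, $\rho>0$ and $T\in(0,1/4)$, and let $\Theta\subset(-T,T]$. For each $\varepsilon\in(0,1)$ let $N_\varepsilon=5\vee\lfloor(\varepsilon^2\log\varepsilon^{-5})^{-1/(2\beta_*+1)}\rfloor$ and let $1=\kappa_1<\kappa_2<\dots<\kappa_{J+1}=N_\varepsilon+1$ define blocks $B_j=\{\kappa_j,\dots,\kappa_{j+1}-1\}$ (the blocks may depend on $\varepsilon$) such that $\log\varepsilon^{-1}=o(T_\varepsilon)$ as $\varepsilon\to0$, where $T_\varepsilon=\min_j T_j$. Take the penalties $\varphi_j=\sqrt{24\,T_j^{-1}\log\varepsilon^{-5}}$ in the penalized Stein filter $\hat h^{JS}$, and let $\hat\vartheta^{JS}_\varepsilon$ be the estimator defined in the context. Then there is a sequence $\alpha_\varepsilon\to0$ as $\varepsilon\to0$, depending only on $\varepsilon$ (and on $\beta_*,L_*,\rho,T$ and the block scheme), such that for all $\vartheta\in\Theta$ and all $f\in\mathcal F(\beta_*,L_*,\rho)$, $$\varepsilon^{-2}\|f'\|^2\,{\bf E}_{\vartheta,f}\big[(\hat\vartheta^{JS}_\varepsilon-\vartheta)^2\big]\le 1+(1+\alpha_\varepsilon)\frac{R^\varepsilon[f,h^*]}{\|f'\|^2}.$$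
   Context: Model: fix $\varepsilon\in(0,1)$, $\vartheta\in\mathbb R$ and $f:\mathbb R\to\mathbb R$ locally square integrable, even and $1$-periodic. Set $f_k=\sqrt2\int_{-1/2}^{1/2}\cos(2\pi kt)f(t)\,dt$ ($k\ge1$), $\|f^{(\beta)}\|^2=\sum_{k\ge1}(2\pi k)^{2\beta}f_k^2$ for $\beta>0$, $\|f'\|^2=\|f^{(1)}\|^2$. Observations: $x_k=f_k\cos(2\pi k\vartheta)+\varepsilon\xi_k$, $x_k^*=f_k\sin(2\pi k\vartheta)+\varepsilon\xi_k^*$, $k\ge1$, with $\xi_k,\xi_k^*$ i.i.d. $\mathcal N(0,1)$; ${\bf P}_{\vartheta,f},{\bf E}_{\vartheta,f}$ denote the corresponding probability and expectation. A filter is a (possibly random) $h=(h_k)_{k\ge1}\in[0,1]^{\mathbb N}$ with finitely many nonzero terms; $h\in[0,1]^N$ is identified with the filter having $h_k=0$ for $k>N$. $\Phi_\varepsilon(\tau,h)=\frac12\sum_{k}h_k\big(x_k\cos(2\pi k\tau)+x_k^*\sin(2\pi k\tau)\big)^2$, and $R^\varepsilon[f,h]=\sum_{k\ge1}(2\pi k)^2[(1-h_k)^2f_k^2+\varepsilon^2h_k^2]$. Classes: $\mathcal F_0(\rho)$ is the set of locally square integrable, even, $1$-periodic $f$ with $|\int_{-1/2}^{1/2}f(t)\cos(2\pi t)\,dt|\ge\rho$; $\mathcal F(\beta_*,L_*,\rho)=\{f\in\mathcal F_0(\rho):\|f^{(\beta_* )}\|\le L_*\}$. Blocks: $T_j=\kappa_{j+1}-\kappa_j$,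 $\sigma_j^2=\sum_{k\in B_j}(2\pi k)^2$, $\|f'\|^2_{(j)}=\sum_{k\in B_j}(2\pi k)^2f_k^2$. Oracle filter $h^*$: $h^*_k=\|f'\|^2_{(j)}/(\|f'\|^2_{(j)}+\varepsilon^2\sigma_j^2)$ for $k\in B_j$, $h^*_k=0$ for $k>N_\varepsilon$. Penalized Stein filter: with $\|y'\|^2_{(j)}=\sum_{k\in B_j}(2\pi k)^2(x_k^2+{x_k^*}^2)$, $\hat h^{JS}_k=\Big(1-\frac{\varepsilon^2\sigma_j^2(1+\varphi_j)}{(\|y'\|^2_{(j)}-2\varepsilon^2\sigma_j^2)_++\varepsilon^2\sigma_j^2}\Big)_+$ for $k\in B_j$, and $0$ for $k>N_\varepsilon$. Estimator: preliminary $\bar\vartheta_\varepsilon=\frac1{2\pi}\arctan(x_1^*/x_1)$ if $x_1\ne0$, $\bar\vartheta_\varepsilon=1/4$ if $x_1=0$; $\delta_\varepsilon=\varepsilon\log(\varepsilon^{-2})$; $\hat\vartheta^{JS}_\varepsilon$ is a maximizer of $\tau\mapsto\Phi_\varepsilon(\tau,\hat h^{JS})$ over $[\bar\vartheta_\varepsilon-\delta_\varepsilon,\bar\vartheta_\varepsilon+\delta_\varepsilon]$. *)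

(* Defs.v *)
From HB Require Import structures.
From mathcomp Require Import all_boot all_order all_algebra.
From mathcomp Require Import all_classical all_reals all_analysis.
Set Implicit Arguments.
Unset Strict Implicit.
Unset Printing Implicit Defensive.
Import Order.TTheory GRing.Theory Num.Theory.
Import numFieldNormedType.Exports.
Local Open Scope classical_set_scope.
Local Open Scope ring_scope.

Section defs.
Context {R : realType}.
Notation mu := (@lebesgue_measure R).

Definition fcoef (f : R -> R) (k : nat) : R :=
  Num.sqrt 2 * Rintegral mu `[(- (1/2)), (1/2)]
                 (fun t => cos (2 * pi * k%:R * t) * f t).

Definition sob_sq (f : R -> R) (beta : R) : \bar R :=
  (\sum_(1 <= k <oo) (((2 * pi * k%:R) `^ (2 * beta) * fcoef f k ^+ 2)%:E))%E.

(* ||f'||^2 = sum_{k>=1} (2 pi k)^2 f_k^2 (finite on the class considered) *)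
Definition nfp_sq (f : R -> R) : R :=
  fine (\sum_(1 <= k <oo) (((2 * pi * k%:R) ^+ 2 * fcoef f k ^+ 2)%:E))%E.

Definition loc_sq_integrable (f : R -> R) : Prop :=
  measurable_fun setT f /\
  forall a b : R, mu.-integrable `[a, b] (fun t => (f t ^+ 2)%:E).

Definition even_fun (f : R -> R) : Prop := forall t, f (- t) = f t.
Definition periodic1 (f : R -> R) : Prop := forall t, f (t + 1) = f t.

Definition F0class (rho : R) (f : R -> R) : Prop :=
  [/\ loc_sq_integrable f, even_fun f, periodic1 f &
      rho <= `| Rintegral mu `[(- (1/2)), (1/2)] (fun t => f t * cos (2 * pi * t)) | ].

Definition Fclass (beta L rho : R) (f : R -> R) : Prop :=
  F0class rho f /\ (sob_sq f beta <= (L ^+ 2)%:E)%E.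

Definition Neps (beta e : R) : nat :=
  maxn 5 (Num.truncn ((e ^+ 2 * ln (e ^- 5)) `^ (- (1 / (2 * beta + 1))))).

(* Block scheme, 0-indexed: kap e 0 = 1 < kap e 1 < ... < kap e (J e) = N_e + 1;
   block j (j < J e) is B_j = {kap e j, ..., kap e j.+1 - 1}. *)
Definition valid_blocks (beta : R) (kap : R -> nat -> nat) (J : R -> nat) : Prop :=
  forall e : R, 0 < e < 1 ->
    [/\ (0 < J e)%N, kap e 0%N = 1%N,
        (forall j, (j < J e)%N -> (kap e j < kap e j.+1)%N) &
        kap e (J e) = (Neps beta e).+1].

Definition Tj (kap : R -> nat -> nat) (e : R) (j : nat) : nat :=
  (kap e j.+1 - kap e j)%N.

Definition Tmin (kap : R -> nat -> nat) (J : R -> nat) (e : R) : nat :=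
  \big[minn/Tj kap e 0]_(j < J e) Tj kap e j.

Definition log_little_o (kap : R -> nat -> nat) (J : R -> nat) : Prop :=
  (fun e : R => ln (e^-1) / (Tmin kap J e)%:R) @ 0^'+ --> 0.

Definition in_block (kap : R -> nat -> nat) (e : R) (j k : nat) : bool :=
  (kap e j <= k < kap e j.+1)%N.

Definition sigma2 (kap : R -> nat -> nat) (e : R) (j : nat) : R :=
  \sum_(kap e j <= k < kap e j.+1) (2 * pi * k%:R) ^+ 2.

Definition hstar (kap : R -> nat -> nat) (J : R -> nat) (e : R) (f : R -> R)
    (k : nat) : R :=
  \sum_(j < J e)
    if in_block kap e j k then
      let fj := \sum_(kap e j <= i < kap e j.+1) (2 * pi * i%:R) ^+ 2 * fcoef f i ^+ 2 in
      fj / (fj + e ^+ 2 * sigma2 kap e j)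
    else 0.

Definition risk (e : R) (f : R -> R) (h : nat -> R) : R :=
  fine (\sum_(1 <= k <oo)
    (((2 * pi * k%:R) ^+ 2 *
      ((1 - h k) ^+ 2 * fcoef f k ^+ 2 + e ^+ 2 * h k ^+ 2))%:E))%E.

Definition hJS (kap : R -> nat -> nat) (J : R -> nat) (e : R)
    (x xs : nat -> R) (k : nat) : R :=
  \sum_(j < J e)
    if in_block kap e j k then
      let s := e ^+ 2 * sigma2 kap e j in
      let y := \sum_(kap e j <= i < kap e j.+1)
                  (2 * pi * i%:R) ^+ 2 * (x i ^+ 2 + xs i ^+ 2) in
      let ph := Num.sqrt (24 / (Tj kap e j)%:R * ln (e ^- 5)) in
      Num.max 0 (1 - s * (1 + ph) / (Num.max 0 (y - 2 * s) + s))
    else 0.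

(* Phi_eps(tau, h); h vanishes beyond N *)
Definition Phi (N : nat) (x xs : nat -> R) (h : nat -> R) (tau : R) : R :=
  1 / 2 * \sum_(1 <= k < N.+1)
    h k * (x k * cos (2 * pi * k%:R * tau) + xs k * sin (2 * pi * k%:R * tau)) ^+ 2.

Definition theta_bar (x xs : nat -> R) : R :=
  if x 1%N != 0 then atan (xs 1%N / x 1%N) / (2 * pi) else 1 / 4.

Definition delta_eps (e : R) : R := e * ln (e ^- 2).

Definition is_JS_estimate (beta : R) (kap : R -> nat -> nat) (J : R -> nat)
    (e : R) (x xs : nat -> R) (t : R) : Prop :=
  let c := theta_bar x xs in
  let d := delta_eps e in
  let Ph := Phi (Neps beta e) x xs (hJS kap J e x xs) in
  c - d <= t <= c + d /\
  forall tau, c - d <= tau <= c + d -> Ph tau <= Ph t.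

Definition obs_x (e theta : R) (f : R -> R) (xi : nat -> R) (k : nat) : R :=
  fcoef f k * cos (2 * pi * k%:R * theta) + e * xi k.
Definition obs_xs (e theta : R) (f : R -> R) (xis : nat -> R) (k : nat) : R :=
  fcoef f k * sin (2 * pi * k%:R * theta) + e * xis k.

End defs.

(* (Z (k, false))_{k>=1} = (xi_k), (Z (k, true))_{k>=1} = (xi_k^* ): a family of
   mutually independent standard Gaussian random variables on (Omega, P). *)
Definition std_gauss_iid {R : realType} {d : measure_display} {Omega : measurableType d}
    (P : probability Omega R) (Z : nat * bool -> Omega -> R) : Prop :=
  [/\ (forall i, (0 < i.1)%N -> measurable_fun setT (Z i)),
      (forall i (B : set R), (0 < i.1)%N -> measurable B ->
          P (Z i @^-1` B) = normal_prob 0 1 B) &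
      (forall (s : seq (nat * bool)) (B : nat * bool -> set R),
          uniq s -> all (fun i => 0 < i.1)%N s -> (forall i, measurable (B i)) ->
          P [set w | forall i, i \in s -> B i (Z i w)] =
          (\prod_(i <- s) P (Z i @^-1` B i))%E)].

(* Main.v *)
(* Rotating the k-th noise pair by the angle 2 pi k theta leaves its law invariant and turns the
   contrast at theta + u into (1/2) sum_k h_k (a_k cos(w_k u) + b_k sin(w_k u))^2, with
   w_k = 2 pi k, a_k = f_k + e zeta_k, b_k = e eta_k.  On an event of overwhelming probability every
   block statistic is within a factor phi_j of its mean, which places the Stein weights within
   4 phi_j (1 - h_j) of the oracle weights h_j, and the preliminary estimate puts u = 0 strictly inside
   the search interval.  The first-order condition at the maximizer then gives
     |u| I <= |M| + u^2 Q,   M = sum_k h_k w_k a_k b_k,   I = sum_k h_k w_k^2 (a_k^2 - b_k^2),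
   where I = F - r + Wa + O(phi r), F = ||f'||^2, r = the oracle risk, and Wa is linear in the noise; hence
     u^2 <= M^2 / F^2 (1 + 2 r / F - 2 Wa / F + O((phi + r) r)) + O(phi r M^4 / e^2).
   The weights and Wa depend on eta only through eta_k^2, so changing the signs of the eta_k one at
   a time replaces M^2 by the sum of the squares of its terms; changing the signs of all zeta_k
   removes the term linear in Wa.  What remains is
     E M^2 (1 + 2 r / F) <= e^2 (F - r + O(phi r)) (1 + 2 r / F) <= e^2 (F + r + O(phi r)),
   which is the announced bound once divided by F^2. *)
Require Import Defs.
From HB Require Import structures.
From mathcomp Require Import all_boot all_order all_algebra.
From mathcomp Require Import all_classical all_reals all_analysis.
From mathcomp Require Import measurable_realfun lra ring.
Set Implicit Arguments.
Unset Strict Implicit.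
Unset Printing Implicit Defensive.
Import Order.TTheory GRing.Theory Num.Theory.
Import numFieldNormedType.Exports.
Local Open Scope classical_set_scope.
Local Open Scope ring_scope.

(** Since the coefficient of the risk must be [1 + o(1)], every error has to be [o(r)] and not
    merely [o(1)]. This decides what may be bounded and what must be kept. [Wa] is only of order
    [phi * sqrt (F r)], which can far exceed [r], so its first power must survive until a symmetry
    removes it, while its square, at most [phi^2 F r], is harmless. For the same reason closeness of
    the Stein weights to [h_j] is supplemented by the bound [2 h_j]: together they give errors
    proportional to [h_j s_j], the contribution of a block with noise [s_j] to [r]. Rare events are
    charged to [r] through [r >= c e^2], which comes from [|f_1| >= rho]; the constant 24 of the
    penalty gives them probability about [e^3] per block. All expectations are integrals of
    nonnegative functions: integrability is never an issue, and cancellations are obtained by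
    averaging an integrand with its reflection instead of splitting it into signed parts. Where the
    noise is not small the limit puts no constraint on [alpha], and a crude bound suffices. *)

Ltac nneg := repeat match goal with
  | H : is_true (0 <= ?x) |- is_true (0 <= ?x) => exact: H
  | H : is_true (0 < ?x) |- is_true (0 <= ?x) => exact: (ltW H)
  | |- is_true (0 <= _ %:R) => exact: ler0n
  | |- is_true (0 <= 1) => exact: ler01
  | |- is_true (0 <= 0) => exact: lexx
  | |- is_true (0 <= expR _) => exact: expR_ge0
  | |- is_true (0 <= `|_|) => exact: normr_ge0
  | |- is_true (0 <= _ ^+ 2) => exact: sqr_ge0
  | |- is_true (0 <= _ * _) => apply: mulr_ge0
  | |- is_true (0 <= _ + _) => apply: addr_ge0
  | |- is_true (0 <= _ ^+ _) => apply: exprn_ge0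
  | |- is_true (0 <= _^-1) => rewrite invr_ge0
  end.

(** * Gaussian pairs *)

Section gaussian_integrals.
Context {R : realType}.
Local Open Scope ereal_scope.
Notation mu := (@lebesgue_measure R).
Notation gam := (@normal_prob R 0%R 1%R).
Notation pdf := (@normal_pdf R 0%R 1%R).

Import HBNNSimple.

Let integral_gam_nnsfun (f : {nnsfun (measurableTypeR R) >-> R}) :
  \int[gam]_x (f x)%:E = \int[mu]_x ((f x)%:E * (pdf x)%:E).
Proof.
under [LHS]eq_integral do rewrite fimfunE -fsumEFin//.
rewrite [LHS]ge0_integral_fsum//; last 2 first.
  - by move=> r; exact/measurable_EFinP/measurableT_comp.
  - by move=> n x _; rewrite EFinM nnfun_muleindic_ge0.
under [RHS]eq_integral.
  move=> x xD; rewrite fimfunE -fsumEFin// ge0_mule_fsuml; last first.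
    by move=> r; rewrite EFinM nnfun_muleindic_ge0.
  over.
rewrite [RHS]ge0_integral_fsum//; last 2 first.
  - move=> r; apply: emeasurable_funM; last first.
      by apply/measurable_EFinP; exact: measurable_normal_pdf.
    by apply/measurable_EFinP; do 2 apply/measurableT_comp => //.
  - move=> n x _; rewrite EFinM mule_ge0//; last by rewrite lee_fin normal_pdf_ge0.
    by rewrite nnfun_muleindic_ge0.
apply: eq_fsbigr => r _.
rewrite integralZl_indic_nnsfun//= integral_indic//= setIT.
have [r0|r0] := leP 0%R r; last first.
  rewrite (preimage_nnfun0 _ r0) measure0 mule0 integral0_eq// => x _.
  by rewrite indicE in_set0 mulr0 mul0e.
under [RHS]eq_integral do rewrite EFinM -muleA.
rewrite ge0_integralZl//; last 2 first.
- apply: emeasurable_funM; apply/measurable_EFinP.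
    exact: measurable_indic.
  exact: measurable_normal_pdf.
- by move=> x _; rewrite mule_ge0// lee_fin// normal_pdf_ge0.
congr (_ * _); rewrite /normal_prob [LHS]integral_mkcond/=.
apply: eq_integral => x _; rewrite /patch indicE.
by case: ifPn => // _; rewrite ?mul1e ?mul0e.
Qed.

(** The normal law is given by its values on sets, as integrals of the density; monotone convergence
    along simple functions carries this to every nonnegative integrand. *)
Lemma integral_gam (f : R -> \bar R) :
  measurable_fun setT f -> (forall x, 0 <= f x) ->
  \int[gam]_x f x = \int[mu]_x (f x * (pdf x)%:E).
Proof.
move=> mf f0.
have mf' : measurable_fun [set: measurableTypeR R] (f : measurableTypeR R -> \bar R) := mf.
pose f_ := nnsfun_approx measurableT mf'.
transitivity (lim (\int[gam]_x (f_ n x)%:E @[n --> \oo])).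
  rewrite -monotone_convergence//=.
  - apply: eq_integral => ? /[!inE] xD; apply/esym/cvg_lim => //=.
    exact: cvg_nnsfun_approx.
  - by move=> n; apply/measurable_EFinP; exact: (measurable_funP (f_ n)).
  - by move=> n ? _; rewrite lee_fin.
  - by move=> ? _ ? ? mn; rewrite lee_fin; exact/lefP/nd_nnsfun_approx.
rewrite [RHS](_ : _ = lim (\int[mu]_x ((f_ n x)%:E * (pdf x)%:E) @[n --> \oo])).
  by apply: congr_lim; apply/funext => n /=; exact: integral_gam_nnsfun.
rewrite -monotone_convergence//=.
- apply: eq_integral => x _; apply/esym/cvg_lim => //.
  apply: cvgeZr => //; exact: cvg_nnsfun_approx.
- move=> n; apply: emeasurable_funM; first by apply/measurable_EFinP; exact: (measurable_funP (f_ n)).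
  by apply/measurable_EFinP; exact: measurable_normal_pdf.
- by move=> n x _; rewrite mule_ge0// lee_fin// normal_pdf_ge0.
- move=> x _ m n mn; apply: lee_wpmul2r; first by rewrite lee_fin normal_pdf_ge0.
  by rewrite lee_fin; exact/lefP/nd_nnsfun_approx.
Qed.

Lemma normal_pdf01E x : pdf x = ((Num.sqrt (pi *+ 2))^-1 * expR (- x ^+ 2 / 2))%R.
Proof.
by rewrite normal_pdfE ?oner_neq0// /normal_peak /normal_fun subr0 expr1n mul1r.
Qed.

(** The image of Lebesgue measure under a translation gives each half-open interval its length, so
    uniqueness of Lebesgue measure applies. *)
Lemma integral_shift (f : R -> \bar R) (a : R) :
  measurable_fun setT f -> (forall x, 0 <= f x) ->
  \int[mu]_x f (x + a)%R = \int[mu]_x f x.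
Proof.
move=> mf f0.
have ms : measurable_fun [set: measurableTypeR R] (fun x : R => (x + a)%R : measurableTypeR R).
  exact: measurable_funD.
rewrite -[LHS]/(\int[mu]_(x in (fun x : R => (x + a)%R) @^-1` setT) (f \o (fun x => x + a)%R) x).
rewrite -(ge0_integral_pushforward ms)//.
apply: eq_measure_integral => //= A mA _; apply/esym/lebesgue_measure_unique => //= _ [[u v]] _ <-.
rewrite /pushforward.
rewrite (_ : _ @^-1` _ = `](u - a)%R, (v - a)%R]%classic).
  rewrite !lebesgue_measure_itv/= !lte_fin ltrD2r.
  by rewrite !EFinB; case: ifP => // _; rewrite -!EFinD; congr EFin; ring.
by apply/seteqP; split => x /=; rewrite !in_itv/= ltrBlDr lerBrDr.
Qed.

Lemma gam_opp (f : R -> \bar R) : measurable_fun setT f -> (forall x, 0 <= f x) ->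
  \int[gam]_x f (- x)%R = \int[gam]_x f x.
Proof.
move=> mf f0.
have mN : measurable_fun [set: R] (fun x : R => - x)%R by exact: measurable_funN.
have mfN : measurable_fun setT (fun x : R => f (- x)%R) by exact: measurableT_comp mf mN.
rewrite !integral_gam//.
pose g x := f x * (pdf x)%:E.
transitivity (\int[mu]_x g (- x)%R).
  by apply: eq_integral => x _; rewrite /g !normal_pdf01E sqrrN.
have mg : measurable_fun setT g.
  by apply: emeasurable_funM => //; apply/measurable_EFinP; exact: measurable_normal_pdf.
rewrite -[LHS]/(\int[mu]_(x in (-%R : _ -> measurableTypeR R) @^-1` setT) (g \o -%R) x).
rewrite -ge0_integral_pushforward//.
  by apply: eq_measure_integral => //= A mA _; exact: lebesgue_measureN.
by move=> x _; rewrite /g mule_ge0// lee_fin normal_pdf_ge0.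
Qed.

(** Completing the square turns the tilted density into [exp (l^2 / 2)] times the normal density
    with mean [l]. *)
Lemma gam_expR_lin (l : R) : \int[gam]_x (expR (l * x))%:E = (expR (l ^+ 2 / 2))%:E.
Proof.
have ml : measurable_fun [set: R] (fun x : R => (expR (l * x))%:E).
  by apply/measurable_EFinP; apply: measurableT_comp => //; exact: measurable_funM.
rewrite (integral_gam ml); last by move=> x; rewrite lee_fin expR_ge0.
transitivity (\int[mu]_x ((expR (l ^+ 2 / 2))%:E * (normal_pdf l 1 x)%:E)).
  apply: eq_integral; move=> x _; rewrite -!EFinM; congr EFin.
  rewrite !normal_pdfE ?oner_neq0// /normal_fun.
  rewrite mulrCA -expRD [RHS]mulrCA -expRD; congr (_ * expR _)%R.
  by rewrite subr0 expr1n; field.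
rewrite ge0_integralZl//; last 2 first.
- by apply/measurable_EFinP; exact: measurable_normal_pdf.
- by move=> x _; rewrite lee_fin normal_pdf_ge0.
by rewrite integral_normal_pdf mule1.
Qed.

(** The tilted density is [s] times the centred normal density with standard deviation
    [s = (1 - 2 l)^(-1/2)]. *)
Lemma gam_expR_sq (l : R) : (l < 1 / 2)%R ->
  \int[gam]_x (expR (l * x ^+ 2))%:E = ((Num.sqrt (1 - l *+ 2))^-1)%:E.
Proof.
move=> l2.
have ml : measurable_fun [set: R] (fun x : R => (expR (l * x ^+ 2))%:E).
  by apply/measurable_EFinP; apply: measurableT_comp => //; apply: measurable_funM => //; exact: measurable_funX.
rewrite (integral_gam ml); last by move=> x; rewrite lee_fin expR_ge0.
have c0 : (0 < 1 - l *+ 2 :> R)%R by rewrite -mulr_natr; lra.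
set s : R := ((Num.sqrt (1 - l *+ 2))^-1)%R.
have s0 : (0 < s)%R by rewrite invr_gt0 sqrtr_gt0.
have s2 : (s ^+ 2 = (1 - l *+ 2)^-1)%R by rewrite exprVn sqr_sqrtr// ltW.
transitivity (\int[mu]_x (s%:E * (normal_pdf 0 s x)%:E)).
  apply: eq_integral; move=> x _; rewrite -!EFinM; congr EFin.
  rewrite !normal_pdfE ?oner_neq0 ?gt_eqF// /normal_fun /normal_peak.
  rewrite [LHS]mulrCA -expRD [RHS]mulrA; congr (_ * expR _)%R.
    rewrite expr1n mul1r s2 -mulrnAr sqrtrM ?invr_ge0 ?(ltW c0)//.
    by rewrite sqrtrV ?(ltW c0)// -/s invfM mulrA divff ?gt_eqF// mul1r.
  have -> : ((s ^+ 2 *+ 2)^-1 = (1 - l *+ 2) / 2 :> R)%R.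
    by rewrite s2 -(mulr_natr _ 2) invfM invrK.
  by rewrite subr0 expr1n; field.
rewrite ge0_integralZl//; last 3 first.
- by apply/measurable_EFinP; exact: measurable_normal_pdf.
- by move=> x _; rewrite lee_fin normal_pdf_ge0.
- by rewrite lee_fin ltW.
by rewrite integral_normal_pdf mule1.
Qed.

End gaussian_integrals.

Lemma integral_prodM {R : realType} d1 d2 (T1 : measurableType d1) (T2 : measurableType d2)
    (m1 : {sigma_finite_measure set T1 -> \bar R}) (m2 : {sigma_finite_measure set T2 -> \bar R})
    (u : T1 -> \bar R) (v : T2 -> \bar R) :
  measurable_fun setT u -> measurable_fun setT v ->
  (forall x, 0 <= u x)%E -> (forall x, 0 <= v x)%E ->
  (\int[m1 \x m2]_z (u z.1 * v z.2) = (\int[m1]_x u x) * (\int[m2]_x v x))%E.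
Proof.
move=> mu_ mv u0 v0.
have m : measurable_fun [set: T1 * T2] (fun z : T1 * T2 => u z.1 * v z.2)%E.
  by apply: emeasurable_funM; [exact: (measurableT_comp mu_ measurable_fst)|
    exact: (measurableT_comp mv measurable_snd)].
rewrite (fubini_tonelli1 (fun z : T1 * T2 => u z.1 * v z.2)%E)//; last by move=> z; exact: mule_ge0.
rewrite /fubini_F/= -ge0_integralZr//; last exact: integral_ge0.
by apply: eq_integral => x _; rewrite ge0_integralZl.
Qed.

(** * Rotation invariance of the standard Gaussian law on the plane *)

Section gaussian_plane.
Context {R : realType}.
Local Open Scope ereal_scope.
Notation mu := (@lebesgue_measure R).
Notation gam := (@normal_prob R 0%R 1%R).
Notation pdf := (@normal_pdf R 0%R 1%R).
Notation g2 := (gam \x gam).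
Notation T := (measurableTypeR R).
Implicit Types f g : T * T -> \bar R.

Let mpdf : measurable_fun [set: T] (fun x => (pdf x)%:E).
Proof. by apply/measurable_EFinP; exact: measurable_normal_pdf. Qed.

Let mpp : measurable_fun [set: T * T] (fun z : T * T => (pdf z.1)%:E * (pdf z.2)%:E).
Proof.
apply: emeasurable_funM.
- exact: (measurableT_comp mpdf measurable_fst).
- exact: (measurableT_comp mpdf measurable_snd).
Qed.

Lemma integral_g2 f : measurable_fun setT f -> (forall z, 0 <= f z) ->
  \int[g2]_z f z = \int[mu \x mu]_z (f z * ((pdf z.1)%:E * (pdf z.2)%:E)).
Proof.
move=> mf f0.
have mh : measurable_fun setT (fun z : T * T => f z * ((pdf z.1)%:E * (pdf z.2)%:E)).
  exact: emeasurable_funM.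
have h0 z : 0 <= f z * ((pdf z.1)%:E * (pdf z.2)%:E).
  by rewrite !mule_ge0// lee_fin normal_pdf_ge0.
rewrite (fubini_tonelli1 f)// (fubini_tonelli1 (fun z : T * T => f z * ((pdf z.1)%:E * (pdf z.2)%:E)))//.
have mF : measurable_fun [set: T] (fubini_F gam f).
  exact: measurable_fun_fubini_tonelli_F.
rewrite integral_gam//; last by move=> x; apply: integral_ge0.
apply: eq_integral => x _; rewrite /fubini_F/=.
have mfx : measurable_fun [set: T] (fun y => f (x, y)).
  exact: (measurableT_comp mf (pair1_measurable x)).
rewrite integral_gam//.
rewrite -ge0_integralZr//; last 3 first.
- exact: emeasurable_funM.
- by move=> y _; rewrite mule_ge0// lee_fin normal_pdf_ge0.
- by rewrite lee_fin normal_pdf_ge0.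
by apply: eq_integral => y _; rewrite -muleA (muleC (pdf y)%:E).
Qed.

(** By Tonelli, a shear is a translation on each horizontal line. *)
Lemma integral_shear1 f (t : R) : measurable_fun setT f -> (forall z, 0 <= f z) ->
  \int[mu \x mu]_z f (z.1 + t * z.2, z.2)%R = \int[mu \x mu]_z f z.
Proof.
move=> mf f0.
have ms : measurable_fun [set: T * T] (fun z : T * T => (z.1 + t * z.2, z.2)%R : T * T).
  apply/measurable_fun_pairP; split; last exact: measurable_snd.
  apply: measurable_funD; first exact: measurable_fst.
  by apply: measurable_funM => //; exact: measurable_snd.
have mg := measurableT_comp mf ms.
rewrite (fubini_tonelli2 (fun z : T * T => f (z.1 + t * z.2, z.2)%R))//.
rewrite (fubini_tonelli2 f mf f0).
apply: eq_integral => y _; rewrite /fubini_G/=.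
apply: (@integral_shift _ (fun x => f (x, y)) (t * y)%R) => //.
exact: (measurableT_comp mf (pair2_measurable y)).
Qed.

Lemma integral_shear2 f (t : R) : measurable_fun setT f -> (forall z, 0 <= f z) ->
  \int[mu \x mu]_z f (z.1, z.2 + t * z.1)%R = \int[mu \x mu]_z f z.
Proof.
move=> mf f0.
have ms : measurable_fun [set: T * T] (fun z : T * T => (z.1, z.2 + t * z.1)%R : T * T).
  apply/measurable_fun_pairP; split; first exact: measurable_fst.
  apply: measurable_funD; first exact: measurable_snd.
  by apply: measurable_funM => //; exact: measurable_fst.
have mg := measurableT_comp mf ms.
rewrite (fubini_tonelli1 (fun z : T * T => f (z.1, z.2 + t * z.1)%R))//.
rewrite (fubini_tonelli1 f mf f0).
apply: eq_integral => x _; rewrite /fubini_F/=.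
apply: (@integral_shift _ (fun y => f (x, y)) (t * x)%R) => //.
exact: (measurableT_comp mf (pair1_measurable x)).
Qed.

Definition plane_rot (c s : R) (z : R * R) : R * R :=
  ((c * z.1 - s * z.2)%R, (s * z.1 + c * z.2)%R).

Lemma measurable_plane_rot c s : measurable_fun [set: T * T] (plane_rot c s : T * T -> T * T).
Proof.
apply/measurable_fun_pairP; split.
- by apply: measurable_funB; apply: measurable_funM.
- by apply: measurable_funD; apply: measurable_funM.
Qed.

(* A rotation of angle different from pi is a product of three shears. *)
Let integral_rot_aux f (c s : R) : (c ^+ 2 + s ^+ 2 = 1)%R -> c != (-1)%R ->
  measurable_fun setT f -> (forall z, 0 <= f z) ->
  \int[mu \x mu]_z f (plane_rot c s z) = \int[mu \x mu]_z f z.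
Proof.
move=> cs c1 mf f0.
have c10 : (1 + c != 0)%R by rewrite addrC -subr_eq0 opprK in c1 *.
(* For a rotation of angle [a] this is [tan (a / 2)]; the three shears have parameters [- t], [s],
   [- t]. *)
pose t := (s / (1 + c))%R.
have ms1 : measurable_fun [set: T * T] (fun z : T * T => (z.1 + - t * z.2, z.2)%R : T * T).
  apply/measurable_fun_pairP; split; last exact: measurable_snd.
  apply: measurable_funD; first exact: measurable_fst.
  by apply: measurable_funM => //; exact: measurable_snd.
have ms2 : measurable_fun [set: T * T] (fun z : T * T => (z.1, z.2 + s * z.1)%R : T * T).
  apply/measurable_fun_pairP; split; first exact: measurable_fst.
  apply: measurable_funD; first exact: measurable_snd.
  by apply: measurable_funM => //; exact: measurable_fst.
have m1 := measurableT_comp mf ms1.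
have m2 := measurableT_comp m1 ms2.
apply: (eq_trans _ (integral_shear1 (- t) mf f0)).
apply: (eq_trans _ (integral_shear2 s m1 (fun z => f0 _))).
apply: (eq_trans _ (integral_shear1 (- t) m2 (fun z => f0 _))).
apply: eq_integral => -[x y] _ /=; congr f.
have s2 : (s * s = (1 - c) * (1 + c))%R by move: cs; clear; move=> cs; lra.
have ts : (s * t = 1 - c)%R by rewrite /t mulrA s2 mulfK.
have t1c : (t * (1 + c) = s)%R by rewrite /t divfK.
rewrite /plane_rot/=; congr pair.
- transitivity ((1 - s * t) * x - t * (1 + (1 - s * t)) * y)%R; last by ring.
  by rewrite ts subKr t1c.
- transitivity (s * x + (1 - s * t) * y)%R; last by ring.
  by rewrite ts subKr.
Qed.

(** The half-turn, excluded by the decomposition into shears, is a quarter-turn applied twice. *)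
Lemma integral_rot f (c s : R) : (c ^+ 2 + s ^+ 2 = 1)%R ->
  measurable_fun setT f -> (forall z, 0 <= f z) ->
  \int[mu \x mu]_z f (plane_rot c s z) = \int[mu \x mu]_z f z.
Proof.
move=> cs mf f0; have [c1|c1] := eqVneq c (-1)%R; last exact: integral_rot_aux.
have s0 : s = 0%R.
  by move: cs; rewrite c1 sqrrN expr1n => /eqP; rewrite -subr_eq0 addrAC subrr add0r sqrf_eq0 => /eqP.
have e01 : (0 ^+ 2 + 1 ^+ 2 = 1 :> R)%R by rewrite expr0n expr1n add0r.
have n01 : (0 != -1 :> R)%R by rewrite eq_sym oppr_eq0 oner_eq0.
have m1 := measurableT_comp mf (measurable_plane_rot 0 1).
apply: (eq_trans _ (integral_rot_aux e01 n01 mf f0)).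
apply: (eq_trans _ (integral_rot_aux e01 n01 m1 (fun z => f0 _))).
by apply: eq_integral => -[x y] _ /=; rewrite /plane_rot c1 s0 /=; congr (f (_, _)); ring.
Qed.

(** The planar density depends on the radius only, so invariance of Lebesgue measure suffices. *)
Lemma g2_rot f (c s : R) : (c ^+ 2 + s ^+ 2 = 1)%R ->
  measurable_fun setT f -> (forall z, 0 <= f z) ->
  \int[g2]_z f (plane_rot c s z) = \int[g2]_z f z.
Proof.
move=> cs mf f0.
have mfr := measurableT_comp mf (measurable_plane_rot c s).
rewrite (integral_g2 mf)//.
apply: (eq_trans (integral_g2 mfr (fun z => f0 _))).
pose g (z : T * T) := f z * ((pdf z.1)%:E * (pdf z.2)%:E).
have mg : measurable_fun setT g by exact: emeasurable_funM.
have g0 z : 0 <= g z by rewrite !mule_ge0// lee_fin normal_pdf_ge0.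
apply: (eq_trans _ (integral_rot cs mg g0)).
apply: eq_integral => -[x y] _; rewrite /g; congr (_ * _).
rewrite -!EFinM; congr EFin; rewrite !normal_pdf01E /plane_rot/=.
rewrite mulrACA -expRD [RHS]mulrACA -expRD; congr (_ * expR _)%R.
have -> : (x ^+ 2 = (c ^+ 2 + s ^+ 2) * x ^+ 2)%R by rewrite cs mul1r.
have -> : (y ^+ 2 = (c ^+ 2 + s ^+ 2) * y ^+ 2)%R by rewrite cs mul1r.
by field.
Qed.

Lemma g2_oppr f : measurable_fun setT f -> (forall z, 0 <= f z) ->
  \int[g2]_z f (z.1, - z.2)%R = \int[g2]_z f z.
Proof.
move=> mf f0.
have ms : measurable_fun [set: T * T] (fun z : T * T => (z.1, - z.2)%R : T * T).
  apply/measurable_fun_pairP; split; first exact: measurable_fst.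
  exact: (measurableT_comp (measurable_funN (@measurable_id _ _ _)) measurable_snd).
have mg := measurableT_comp mf ms.
rewrite (fubini_tonelli1 (fun z : T * T => f (z.1, - z.2)%R) mg (fun z => f0 _)) (fubini_tonelli1 f mf f0).
apply: eq_integral => x _; rewrite /fubini_F/=.
apply: (@gam_opp _ (fun y => f (x, y))) => //.
exact: (measurableT_comp mf (pair1_measurable x)).
Qed.

Lemma g2_oppl f : measurable_fun setT f -> (forall z, 0 <= f z) ->
  \int[g2]_z f (- z.1, z.2)%R = \int[g2]_z f z.
Proof.
move=> mf f0.
have ms : measurable_fun [set: T * T] (fun z : T * T => (- z.1, z.2)%R : T * T).
  apply/measurable_fun_pairP; split; last exact: measurable_snd.
  exact: (measurableT_comp (measurable_funN (@measurable_id _ _ _)) measurable_fst).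
have mg := measurableT_comp mf ms.
rewrite (fubini_tonelli2 (fun z : T * T => f (- z.1, z.2)%R) mg (fun z => f0 _)) (fubini_tonelli2 f mf f0).
apply: eq_integral => y _; rewrite /fubini_G/=.
apply: (@gam_opp _ (fun x => f (x, y))) => //.
exact: (measurableT_comp mf (pair2_measurable y)).
Qed.

End gaussian_plane.

(** * Integrals of nonnegative real functions, possibly infinite *)

Section nonneg_real_integrals.
Context {R : realType} {d : measure_display} {T : measurableType d}.
Variable m : {measure set T -> \bar R}.
Implicit Types g h : T -> R.

Lemma nnint_ge0 g : (forall w, 0 <= g w) -> (0 <= \int[m]_w (g w)%:E)%E.
Proof. by move=> g0; apply: integral_ge0 => w _; rewrite lee_fin. Qed.

Lemma nnint_le g h : measurable_fun setT g -> measurable_fun setT h ->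
  (forall w, 0 <= g w) -> (forall w, g w <= h w) ->
  (\int[m]_w (g w)%:E <= \int[m]_w (h w)%:E)%E.
Proof.
move=> mg mh g0 gh; apply: ge0_le_integral => //.
- by move=> w _; rewrite lee_fin.
- exact/measurable_EFinP.
- exact/measurable_EFinP.
- by move=> w _; rewrite lee_fin.
Qed.

Lemma nnintZ c g : measurable_fun setT g -> 0 <= c -> (forall w, 0 <= g w) ->
  (\int[m]_w (c * g w)%:E = c%:E * \int[m]_w (g w)%:E)%E.
Proof.
move=> mg c0 g0; under eq_integral do rewrite EFinM.
have ? : measurable_fun setT (EFin \o g) by exact/measurable_EFinP.
by rewrite ge0_integralZl// => w _; rewrite lee_fin.
Qed.

Lemma nnintD g h : measurable_fun setT g -> measurable_fun setT h ->
  (forall w, 0 <= g w) -> (forall w, 0 <= h w) ->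
  (\int[m]_w (g w + h w)%:E = \int[m]_w (g w)%:E + \int[m]_w (h w)%:E)%E.
Proof.
move=> mg mh g0 h0; under eq_integral do rewrite EFinD.
have ? : measurable_fun setT (EFin \o g) by exact/measurable_EFinP.
have ? : measurable_fun setT (EFin \o h) by exact/measurable_EFinP.
by rewrite ge0_integralD// => w _; rewrite lee_fin.
Qed.

Lemma measurable_bigsum (I : Type) (s : seq I) (p : pred I) (g : I -> T -> R) :
  (forall i, p i -> measurable_fun setT (g i)) ->
  measurable_fun setT (fun w => \sum_(i <- s | p i) g i w).
Proof.
move=> mg; elim: s => [|i s ih].
  by under eq_fun do rewrite big_nil; exact: measurable_cst.
under eq_fun do rewrite big_cons.
by case: (boolP (p i)) => // pi; apply: measurable_funD => //; exact: mg.
Qed.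

End nonneg_real_integrals.

(** * Moments and exponential moments of one standard Gaussian variable *)

Section gaussian_moments.
Context {R : realType}.
Notation gam := (@normal_prob R 0 1).

Let msq (l : R) : measurable_fun [set: R] (fun x : R => l * x ^+ 2).
Proof. by apply: measurable_funM => //; exact: measurable_funX. Qed.

Let mexp (l : R) : measurable_fun [set: R] (fun x : R => expR (l * x ^+ 2)).
Proof. exact: measurableT_comp. Qed.

(** Integrating [1 + l x^2 <= exp (l x^2)] and using the closed form of the right side gives at most
    [1 + 4 l] for every small [l > 0]; letting [l] tend to 0 avoids integration by parts. *)
Lemma gam_sq : (\int[gam]_x (x ^+ 2)%:E <= 1)%E.
Proof.
have key (l : R) : 0 < l < 1 / 20 -> (\int[gam]_x (x ^+ 2)%:E <= (1 + 4 * l)%:E)%E.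
  move=> /andP[l0 l1].
  have lx0 (x : R) : 0 <= l * x ^+ 2 by rewrite mulr_ge0 ?sqr_ge0// ltW.
  rewrite -(@lee_pmul2l _ l%:E)// -EFinM -nnintZ ?(ltW l0)//; last by move=> x; exact: sqr_ge0.
  rewrite -(@leeD2lE _ 1%E)//.
  have -> : (1 + \int[gam]_x (l * x ^+ 2)%:E = \int[gam]_x (1 + l * x ^+ 2)%:E)%E.
    have h := @nnintD _ _ _ gam (cst 1) (fun x : R => l * x ^+ 2) (measurable_cst _) (msq l) (fun=> ler01) lx0.
    apply/esym; etransitivity; first exact: h.
    congr (_ + _)%E; rewrite (integral_cst gam measurableT 1).
    by rewrite [X in (_ * X)%E](@probability_setT _ _ _ gam) mule1.
  apply: (@le_trans _ _ (\int[gam]_x (expR (l * x ^+ 2))%:E)%E).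
    apply: nnint_le => //.
    - by apply: measurable_funD => //; exact: msq.
    - exact: mexp.
    - by move=> x; rewrite addr_ge0.
    - by move=> x; rewrite expR_ge1Dx.
  rewrite gam_expR_sq; last by lra.
  rewrite -EFinD lee_fin -[leRHS]invrK lef_pV2 ?posrE ?sqrtr_gt0 ?invr_gt0; last 2 first.
  - by rewrite mulr2n; lra.
  - by nra.
  have q0 : 0 < 1 + l * (1 + 4 * l) by nra.
  rewrite -[leLHS]ger0_norm ?invr_ge0 ?(ltW q0)// -sqrtr_sqr ler_wsqrtr//.
  rewrite exprVn -div1r ler_pdivrMr; last by rewrite exprn_gt0.
  rewrite mulr2n.
  have h1 : 0 <= l * l by nra.
  have h2 : l * l * l <= l * l / 20 by nra.
  have h3 : 0 <= l * l * l * l by nra.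
  have h4 : l * l * l * l * l <= l * l * l * l / 20 by nra.
  have h5 : l * l * l * l <= l * l * l / 20 by nra.
  have -> : (1 - (l + l)) * (1 + l * (1 + 4 * l)) ^+ 2 =
    1 + 5 * (l * l) - 10 * (l * l * l) - 32 * (l * l * l * l * l) by ring.
  by lra.
apply/lee_addgt0Pr => _/posnumP[e].
apply: (le_trans (key (Num.min (e%:num / 4) (1 / 40)) _)).
  have h40 : 0 < 1 / 40 :> R by lra.
  have h20 : 1 / 40 < 1 / 20 :> R by lra.
  by rewrite lt_min gt_min h20 orbT h40 divr_gt0.
rewrite -EFinD lee_fin lerD2l.
have : Num.min (e%:num / 4) (1 / 40) <= e%:num / 4 :> R by rewrite ge_min lexx.
by move: (Num.min _ _) => m hm; lra.
Qed.

(** The second-order lower bound of the exponential gives [x^4 <= 32 exp (x^2 / 4)]. The constant is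
    far from the true value 3, but it only enters a remainder term. *)
Lemma gam_pow4 : (\int[gam]_x (x ^+ 4)%:E <= 64%:E)%E.
Proof.
apply: (@le_trans _ _ (\int[gam]_x (32 * expR (4^-1 * x ^+ 2))%:E)%E).
  apply: nnint_le => //.
  - by apply: measurable_funM => //; exact: mexp.
  - by move=> x; rewrite (_ : 4 = 2 * 2)%N// exprM sqr_ge0.
  - move=> x.
    have x0 : 0 <= 4^-1 * x ^+ 2 :> R by rewrite mulr_ge0 ?sqr_ge0// invr_ge0.
    have := expR_ge1Dxn 1 x0; set E := expR _; rewrite (_ : 2`!%:R = 2 :> R)// => h.
    have -> : x ^+ 4 = 16 * (4^-1 * x ^+ 2) ^+ 2 by field.
    by lra.
rewrite nnintZ//; last exact: mexp.
rewrite gam_expR_sq; last by lra.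
rewrite -EFinM lee_fin -ler_pdivlMl//.
rewrite -[leRHS]invrK lef_pV2 ?posrE ?sqrtr_gt0 ?invr_gt0; last 2 first.
- by rewrite mulr2n; lra.
- by lra.
rewrite (_ : (32^-1 * 64)^-1 = 1 / 2 :> R); last by field.
have h : 0 <= 1 / 2 :> R by lra.
rewrite -[leLHS]ger0_norm// -sqrtr_sqr ler_wsqrtr//.
have -> : 1 - 4^-1 *+ 2 = 1 / 2 :> R by field.
have -> : (1 / 2) ^+ 2 = 1 / 4 :> R by field.
by lra.
Qed.

(** The logarithm of the left side is [l^2 + O(l^3)]; the coefficient 3/2 absorbs the cubic part on
    the given range of [l]. *)
Lemma gam_expR_chisq (l : R) : - (1 / 20) <= l <= 1 / 20 ->
  (\int[gam]_x (expR (l * (x ^+ 2 - 1)))%:E <= (expR (3 / 2 * l ^+ 2))%:E)%E.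
Proof.
move=> /andP[l0 l1].
have -> : (\int[gam]_x (expR (l * (x ^+ 2 - 1)))%:E =
    \int[gam]_x (expR (- l) * expR (l * x ^+ 2))%:E)%E.
  by apply: eq_integral => x _; rewrite -expRD; congr (expR _)%:E; ring.
rewrite nnintZ ?expR_ge0//; last exact: mexp.
rewrite gam_expR_sq; last by lra.
rewrite -EFinM lee_fin -ler_pdivlMl ?expR_gt0// -expRN opprK -expRD.
rewrite -[leRHS]invrK lef_pV2 ?posrE ?sqrtr_gt0 ?invr_gt0 ?expR_gt0//; last first.
  by rewrite mulr2n; lra.
rewrite -expRN -[leLHS]ger0_norm ?expR_ge0// -sqrtr_sqr ler_wsqrtr//.
rewrite -expRM_natr.
(* After squaring and inverting, the claim is [exp (- v) <= 1 - 2 l]. The lower bound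
   [(1 + v / 4)^4] of [exp v], multiplied by [1 - 2 l], is [1 + l^2 (1/2 + O(l))], whereas [1 + v]
   would leave a negative coefficient of [l^2]. *)
set v := 2 * l + 3 * l ^+ 2.
have -> : - (l + 3 / 2 * l ^+ 2) * 2%:R = - v by rewrite /v; field.
have l2 : 0 <= l ^+ 2 by exact: sqr_ge0.
have v0 : 0 < 1 + v / 4 by rewrite /v; lra.
have e4 : (1 + v / 4) ^+ 4 <= expR v.
  have -> : expR v = expR (v / 4) ^+ 4 by rewrite -expRM_natr divfK.
  by apply: lerXn2r; rewrite ?nnegrE ?expR_ge0 ?expR_ge1Dx// ltW.
rewrite expRN -[leRHS]invrK lef_pV2 ?posrE ?expR_gt0 ?invr_gt0//; last first.
  by rewrite mulr2n; lra.
apply: le_trans e4; rewrite -div1r ler_pdivrMr; last by rewrite mulr2n; lra.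
have -> : (1 + v / 4) ^+ 4 * (1 - l *+ 2) = 1 + l ^+ 2 * (1 / 2 - l * (4 + l * (69 / 16 +
    l * (61 / 8 + l * (159 / 32 + l * (135 / 32 + l * (351 / 256 + l * (81 / 128)))))))).
  by rewrite /v; field.
(* One stage of Horner's scheme: since [|l| <= 1/20], the inner bound [c] contributes at most
   [c / 20]. *)
have step (a b c : R) : 0 <= a -> `|b| <= c -> `|a + l * b| <= a + c / 20.
  move=> a0 /ler_normlP[b1 b2]; apply/ler_normlP; split; nra.
have : `|4 + l * (69 / 16 + l * (61 / 8 + l * (159 / 32 + l * (135 / 32 +
    l * (351 / 256 + l * (81 / 128))))))| <= 5.
  have q1 : `|81 / 128| <= 1 :> R by rewrite ger0_norm; lra.
  have q2 : `|351 / 256 + l * (81 / 128)| <= 2.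
    by apply: le_trans (step _ _ _ _ q1) _; lra.
  have q3 := le_trans (step (135 / 32) _ _ ltac:(lra) q2) (_ : _ <= 5).
  have {}q3 := q3 ltac:(lra).
  have q4 := le_trans (step (159 / 32) _ _ ltac:(lra) q3) (_ : _ <= 6).
  have {}q4 := q4 ltac:(lra).
  have q5 := le_trans (step (61 / 8) _ _ ltac:(lra) q4) (_ : _ <= 8).
  have {}q5 := q5 ltac:(lra).
  have q6 := le_trans (step (69 / 16) _ _ ltac:(lra) q5) (_ : _ <= 5).
  have {}q6 := q6 ltac:(lra).
  by apply: le_trans (step _ _ _ _ q6) _; lra.
move: (4 + _) => q /ler_normlP[q1 q2].
rewrite lerDl mulr_ge0//; nra.
Qed.
End gaussian_moments.

(** * Finite measures are determined by their values on boxes *)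

Section uniqueness_on_boxes.
Context {R : realType}.

Lemma integral_push d1 d2 (T1 : measurableType d1) (T2 : measurableType d2)
    (m : {measure set T1 -> \bar R}) (m' : {measure set T2 -> \bar R})
    (phi : T1 -> T2) (f : T2 -> \bar R) :
  measurable_fun setT phi -> measurable_fun setT f -> (forall y, 0 <= f y)%E ->
  (forall A, measurable A -> m (phi @^-1` A) = m' A) ->
  (\int[m]_x f (phi x) = \int[m']_y f y)%E.
Proof.
move=> mphi mf f0 mm'.
have := @ge0_integral_pushforward _ _ _ _ _ _ mphi m setT f measurableT mf (fun t _ => f0 t).
rewrite preimage_setT => <-.
apply: (@eq_measure_integral _ _ _ _ m') => A mA _; exact: mm'.
Qed.

(** Rectangles are stable under intersection and generate the product sigma-algebra; as the total
    mass is finite, the constant sequence [setT] serves as the exhaustion in the uniqueness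
    theorem. *)
Lemma prod_measure_eq d1 d2 (T1 : measurableType d1) (T2 : measurableType d2)
    (m1 m2 : {measure set (T1 * T2) -> \bar R}) :
  (m1 setT < +oo)%E ->
  (forall A B, measurable A -> measurable B -> m1 (A `*` B) = m2 (A `*` B)) ->
  forall X, measurable X -> m1 X = m2 X.
Proof.
move=> fin m12 X mX.
pose C : set (set (T1 * T2)) :=
  [set C | exists A, measurable A /\ exists B, measurable B /\ C = A `*` B].
have CI : setI_closed C.
  move=> /= _ _ [X1 [mX1 [X2 [mX2 ->]]]] [Y1 [mY1 [Y2 [mY2 ->]]]].
  rewrite -setXI; exists (X1 `&` Y1); split; first exact: measurableI.
  by exists (X2 `&` Y2); split => //; exact: measurableI.
apply: (measure_unique C (fun=> setT)) => //.
- rewrite measurable_prod_measurableType //; congr (<<s _ >>).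
  rewrite predeqE; split => [[A mA [B mB <-]]|[A [mA [B [mB ->]]]]].
    by exists A; split => //; exists B.
  by exists A => //; exists B.
- by move=> _; exists setT; split => //; exists setT; split => //; rewrite setXTT.
- by rewrite bigcup_const.
- by move=> _ [A [mA [B [mB ->]]]]; exact: m12.
Qed.

Lemma tuple_measure_eq d (T : measurableType d) n
    (m1 m2 : {measure set (n.-tuple T) -> \bar R}) :
  (m1 setT < +oo)%E ->
  (forall B : 'I_n -> set T, (forall i, measurable (B i)) ->
     m1 [set t | forall i, B i (tnth t i)] = m2 [set t | forall i, B i (tnth t i)]) ->
  forall X, measurable X -> m1 X = m2 X.
Proof.
move=> fin m12 X mX.
pose box (B : 'I_n -> set T) := [set t : n.-tuple T | forall i, B i (tnth t i)].
pose C : set (set (n.-tuple T)) :=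
  [set C | exists B, (forall i, measurable (B i)) /\ C = box B].
have boxE B : box B = \bigcap_(i in [set: 'I_n]) ((fun t => tnth t i) @^-1` B i).
  by apply/seteqP; split => t /= h => [i _|i]; apply: h.
have mbox B : (forall i, measurable (B i)) -> measurable (box B).
  move=> mB; rewrite boxE; apply: fin_bigcap_measurable; first exact: finite_finset.
  by move=> i _; rewrite -[X in measurable X]setTI; apply: measurable_tnth.
have CI : setI_closed C.
  move=> /= _ _ [B1 [mB1 ->]] [B2 [mB2 ->]].
  exists (fun i => B1 i `&` B2 i); split; first by move=> i; exact: measurableI.
  apply/seteqP; split => t /=; first by move=> [h1 h2] i; split.
  by move=> h; split => i; case: (h i).
have CT : C setT.
  by exists (fun=> setT); split => //; apply/seteqP; split.
apply: (measure_unique C (fun=> setT)) => //.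
- apply/seteqP; split.
  + apply: smallest_sub; first exact: smallest_sigma_algebra.
    move=> A; rewrite -bigcup_seq/= => -[i _ [B mB <-]].
    apply: sub_sigma_algebra; exists (fun j => if j == i then B else setT); split.
      by move=> j; case: ifP.
    apply/seteqP; split => t /=.
      by move=> [_ h] j; case: eqP => [->|].
    by move=> /(_ i); rewrite eqxx.
  + apply: smallest_sub; first exact: sigma_algebra_measurable.
    by move=> _ [B [mB ->]]; exact: mbox.
- by rewrite bigcup_const.
- by move=> _ [B [mB ->]]; exact: m12.
Qed.

End uniqueness_on_boxes.

(** * Independence of the noise pairs, with index 0 left out because frequencies start at 1 *)

Definition iid_law {R : realType} {d d' : measure_display} {Omega : measurableType d}
    {T : measurableType d'} (law : set T -> \bar R)
    (P : probability Omega R) (X : nat -> Omega -> T) : Prop :=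
  (forall k, (0 < k)%N -> measurable_fun setT (X k)) /\
  forall (s : seq nat) (B : nat -> set T),
    uniq s -> all (fun k => 0 < k)%N s -> (forall k, measurable (B k)) ->
    P [set w | forall k, k \in s -> B k (X k w)] = (\prod_(k <- s) law (B k))%E.

Definition pair_law {R : realType} :
    probability (measurableTypeR R * measurableTypeR R)%type R :=
  lebesgue_integral_fubini_product_measure1__canonical__probability_measure_Probability
    (@normal_prob R 0 1) (@normal_prob R 0 1).

Section iid_pairs.
Context {R : realType}.
Notation T := (measurableTypeR R).
Notation gam := (@normal_prob R 0 1).
Notation g2 := (@pair_law R).

Definition iid_pairs {d : measure_display} {Omega : measurableType d}
    (P : probability Omega R) (X : nat -> Omega -> T * T) : Prop :=
  iid_law g2 P X.

Context {d : measure_display} {Omega : measurableType d} (P : probability Omega R).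

Lemma measurable_forall_in (I : eqType) (s : seq I) (E : I -> set Omega) :
  (forall i, i \in s -> measurable (E i)) ->
  measurable [set w | forall i, i \in s -> E i w].
Proof.
elim: s => [|i s ih] mE.
  by rewrite (_ : [set w | _] = setT)//; apply/seteqP; split.
rewrite (_ : [set w | _] = E i `&` [set w | forall i, i \in s -> E i w]).
  apply: measurableI; first by apply: mE; rewrite mem_head.
  by apply: ih => j js; apply: mE; rewrite inE js orbT.
apply/seteqP; split => w /=.
  by move=> h; split => [|j js]; apply: h; rewrite inE ?eqxx// js orbT.
by move=> [h1 h2] j; rewrite inE => /predU1P[->//|]; exact: h2.
Qed.

Let preim_meas d' (T' : measurableType d') (X : Omega -> T') (B : set T') :
  measurable_fun setT X -> measurable B -> measurable [set w | B (X w)].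
Proof.
move=> mX mB; have := mX measurableT _ mB.
by rewrite setTI.
Qed.

Let pairs_of (s : seq nat) : seq (nat * bool) :=
  flatten [seq [:: (k, false); (k, true)] | k <- s].

Let mem_pairs_of s k b : ((k, b) \in pairs_of s) = (k \in s).
Proof.
elim: s => //= i s ih; rewrite !inE ih !xpair_eqE.
by case: b {ih}; case: (k == i); rewrite //= ?orbT.
Qed.

Let uniq_pairs_of s : uniq s -> uniq (pairs_of s).
Proof.
elim: s => //= i s ih /andP[nis us]; rewrite !inE !xpair_eqE !mem_pairs_of.
by rewrite (negbTE nis) andbF ih.
Qed.

Let prod_pairs_of (F : nat * bool -> \bar R) s :
  (\prod_(i <- pairs_of s) F i = \prod_(k <- s) (F (k, false) * F (k, true)))%E.
Proof.
elim: s => [|i s ih]; first by rewrite !big_nil.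
by rewrite /pairs_of/= !big_cons ih muleA.
Qed.

(** Independence of scalars only speaks of rectangles, independence of pairs of arbitrary planar
    sets. The sets are enlarged one index at a time: with the events of the other indices frozen,
    both sides are finite measures of the set at this index that agree on rectangles. *)
Lemma std_gauss_iid_pairs (Z : nat * bool -> Omega -> R) :
  std_gauss_iid P Z -> iid_pairs P (fun k w => (Z (k, false) w, Z (k, true) w)).
Proof.
case=> mZ lawZ indZ.
pose X k w : T * T := (Z (k, false) w, Z (k, true) w).
have mX k : (0 < k)%N -> measurable_fun setT (X k).
  move=> k0; apply/measurable_fun_pairP.
  by split; [exact: (mZ (k, false))|exact: (mZ (k, true))].
split => //.
(* Indices in [s1] carry arbitrary sets, those in [s2] rectangles. The induction applies the
   hypothesis with the head of [s1] moved to [s2], where its set is a rectangle. *)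
suff key (s1 s2 : seq nat) (B : nat -> set (T * T)) (A : nat * bool -> set T) :
    uniq (s1 ++ s2) -> all (fun k => 0 < k)%N (s1 ++ s2) ->
    (forall k, measurable (B k)) -> (forall i, measurable (A i)) ->
    P ([set w | forall k, k \in s1 -> B k (X k w)] `&`
       [set w | forall k, k \in s2 -> (A (k, false) `*` A (k, true)) (X k w)]) =
    ((\prod_(k <- s1) g2 (B k)) *
     (\prod_(k <- s2) (gam (A (k, false)) * gam (A (k, true)))))%E.
  move=> s B us s0 mB.
  have := key s [::] B (fun=> setT); rewrite cats0 => /(_ us s0 mB (fun=> measurableT)).
  rewrite big_nil mule1 => <-; congr (P _).
  by apply/seteqP; split => w /=; [move=> h; split|case].
elim: s1 s2 A => [|k s1 ih] s2 A us s0 mB mA.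
  rewrite big_nil mul1e; transitivity (P [set w | forall i, i \in pairs_of s2 -> A i (Z i w)]).
    congr (P _); apply/seteqP; split => w /=.
      move=> [_ h] [k []]; rewrite mem_pairs_of => ks; by case: (h k ks).
    move=> h; split => // k ks; split; apply: h; rewrite mem_pairs_of//.
  rewrite indZ//; last 2 first.
  - exact: uniq_pairs_of.
  - by apply/allP => -[k b]; rewrite mem_pairs_of => ks; exact: (allP s0).
  rewrite prod_pairs_of; apply: eq_big_seq => k ks.
  have k0 : (0 < k)%N := allP s0 _ ks.
  by rewrite (lawZ (k, false) _ k0 (mA _)) (lawZ (k, true) _ k0 (mA _)).
have /andP[kn us'] : (k \notin s1 ++ s2) && uniq (s1 ++ s2) by [].
have /andP[k0 s0'] : (0 < k)%N && all (fun k => 0 < k)%N (s1 ++ s2) by [].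
pose E := [set w | forall k, k \in s1 -> B k (X k w)] `&`
  [set w | forall k, k \in s2 -> (A (k, false) `*` A (k, true)) (X k w)].
have mE : measurable E.
  apply: measurableI; apply: measurable_forall_in => i is_.
    by apply: (preim_meas (mX _ _) (mB i)); apply: (allP s0'); rewrite mem_cat is_.
  apply: (preim_meas (mX _ _)); first by apply: (allP s0'); rewrite mem_cat is_ orbT.
  exact: measurableX.
pose c := ((\prod_(k <- s1) g2 (B k)) *
     (\prod_(k <- s2) (gam (A (k, false)) * gam (A (k, true)))))%E.
have cE : c = P E by rewrite /c -(ih s2 A).
have cfin : c \is a fin_num by rewrite cE fin_num_measure.
have c0 : 0 <= fine c by rewrite fine_ge0// cE.
have mXk := mX _ k0.
pose m1 := measure_function_pushforward__canonical__measure_function_Measure (mrestr P mE) mXk.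
pose m2 := mscale (NngNum c0) g2.
have m1E C : m1 C = P (X k @^-1` C `&` E) by [].
have m2E C : m2 C = (c * g2 C)%E by rewrite /m2 /mscale/= fineK.
have H : forall C, measurable C -> m1 C = m2 C.
  apply: (@prod_measure_eq _ _ _ _ _ m1 m2) => //.
    by rewrite /= m1E (le_lt_trans (probability_le1 _ _))// ?ltry//; apply: measurableI => //; exact: (preim_meas mXk).
  move=> A1 A2 mA1 mA2.
  transitivity (c * g2 (A1 `*` A2))%E; last by rewrite -m2E.
  rewrite -[LHS]/(P (X k @^-1` (A1 `*` A2) `&` E)) [X in (_ * X)%E]product_measure1E//.
  pose A' i := if i == (k, false) then A1 else if i == (k, true) then A2 else A i.
  have A'f : A' (k, false) = A1 by rewrite /A' eqxx.
  have A't : A' (k, true) = A2 by rewrite /A' xpair_eqE andbF eqxx.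
  have := ih (k :: s2) A'.
  rewrite (perm_uniq (_ : perm_eq (s1 ++ k :: s2) (k :: s1 ++ s2))); last by rewrite perm_catC/= perm_cons perm_catC.
  rewrite (eq_all_r (_ : s1 ++ k :: s2 =i k :: s1 ++ s2)); last first.
    by move=> i; rewrite !(mem_cat, inE); case: (i == k); rewrite ?orbT.
  move=> /(_ us s0 mB); rewrite big_cons.
  have A'E i b : i \in s2 -> A' (i, b) = A (i, b).
    move=> is2; rewrite /A' !xpair_eqE; case: eqP => [ik|]//=.
    by move: kn; rewrite mem_cat -ik is2 orbT.
  have -> : (\prod_(j <- s2) (gam (A' (j, false)) * gam (A' (j, true))) =
             \prod_(j <- s2) (gam (A (j, false)) * gam (A (j, true))))%E.
    by apply: eq_big_seq => i is2; rewrite !A'E.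
  rewrite A'f A't muleCA -/c muleC => <-.
  - congr (P _); apply/seteqP; split => w /=.
      move=> [[h1 h2] [h3 h4]]; split => // i; rewrite inE => /predU1P[->|is2].
        by rewrite A'f A't.
      by rewrite !A'E//; exact: h4.
    move=> [h3 h4]; split.
      by have := h4 k (mem_head _ _); rewrite A'f A't.
    split => // i is2; have := h4 i; rewrite inE is2 orbT => /(_ isT).
    by rewrite !A'E.
  - by move=> i; rewrite /A'; case: ifP => // _; case: ifP.
have mBk := mB k.
rewrite big_cons -muleA -/c muleC -m2E -[RHS]H//; congr (P _).
apply/seteqP; split => w /=.
  move=> [h1 h2]; split; first by apply: h1; rewrite mem_head.
  by split => // i is1; apply: h1; rewrite inE is1 orbT.
move=> [h1 [h2 h3]]; split => // i; rewrite inE => /predU1P[->//|]; exact: h2.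
Qed.

End iid_pairs.

(** * Joint laws, transformations and product integrals of i.i.d. sequences *)

Section iid_law_theory.
Context {R : realType}.
Context {d d' : measure_display} {Omega : measurableType d} {T : measurableType d'}.
Variables (P : probability Omega R) (law : probability T R).
Implicit Types X : nat -> Omega -> T.

(** Coordinate [i] holds the variable of index [i.+1], since index 0 is not part of the model. *)
Definition tup n X w : n.-tuple T := [tuple X (i : 'I_n).+1 w | i < n].

Lemma tnth_tup n X w (i : 'I_n) : tnth (tup n X w) i = X i.+1 w.
Proof. by rewrite tnth_mktuple. Qed.

Lemma measurable_tup n X : iid_law law P X -> measurable_fun setT (tup n X).
Proof.
move=> [mX _]; apply/measurable_fun_tnthP => i.
rewrite (_ : _ \o _ = X i.+1); first exact: mX.
by apply/funext => w /=; rewrite tnth_tup.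
Qed.

Lemma tup_law n X X' : iid_law law P X -> iid_law law P X' ->
  forall A, measurable A -> P (tup n X @^-1` A) = P (tup n X' @^-1` A).
Proof.
move=> iX iX'.
have mt := @measurable_tup n _ iX; have mt' := @measurable_tup n _ iX'.
pose m1 := measure_function_pushforward__canonical__measure_function_Measure P mt.
pose m2 := measure_function_pushforward__canonical__measure_function_Measure P mt'.
apply: (@tuple_measure_eq _ _ _ _ m1 m2).
  by rewrite /m1/= /pushforward/= preimage_setT probability_setT ltry.
move=> B mB.
(* Transfers the box to indices from 1 to [n]; outside this range the set is full. *)
pose B' k := if insub k.-1 is Some i then B i else setT.
have mB' k : measurable (B' k) by rewrite /B'; case: insub.
have B'E (i : 'I_n) : B' i.+1 = B i by rewrite /B'/= valK.
have key Y : iid_law law P Y -> P (tup n Y @^-1` [set t | forall i, B i (tnth t i)]) =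
    (\prod_(k <- iota 1 n) law (B' k))%E.
  move=> [_ <-] //; last 2 first.
  - exact: iota_uniq.
  - by apply/allP => k; rewrite mem_iota => /andP[].
  congr (P _); apply/seteqP; split => w /=.
    move=> h k; rewrite mem_iota add1n ltnS => /andP[k0 kn].
    have kn' : (k.-1 < n)%N by rewrite prednK.
    by have := h (Ordinal kn'); rewrite tnth_tup -B'E/= prednK.
  move=> h i; rewrite tnth_tup -B'E; apply: h.
  by rewrite mem_iota add1n !ltnS ltn_ord.
by rewrite /m1 /m2/= /pushforward !key.
Qed.

Lemma tup_integral n X X' (G : n.-tuple T -> \bar R) :
  iid_law law P X -> iid_law law P X' ->
  measurable_fun setT G -> (forall t, 0 <= G t)%E ->
  (\int[P]_w G (tup n X w) = \int[P]_w G (tup n X' w))%E.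
Proof.
move=> iX iX' mG G0.
have mt := @measurable_tup n _ iX; have mt' := @measurable_tup n _ iX'.
rewrite (integral_push (m' := measure_function_pushforward__canonical__measure_function_Measure P mt')
  mt mG G0 (tup_law iX iX')).
exact/esym/(integral_push mt' mG G0).
Qed.

(** The map may depend on the index: rotation angles vary with the frequency, and a sign flip acts
    on a single index. *)
Lemma iid_law_map X (f : nat -> T -> T) : iid_law law P X ->
  (forall k, measurable_fun setT (f k)) ->
  (forall k B, measurable B -> law (f k @^-1` B) = law B) ->
  iid_law law P (fun k w => f k (X k w)).
Proof.
move=> [mX iX] mf pf; split.
  by move=> k k0; exact: measurableT_comp (mf k) (mX k k0).
move=> s B us s0 mB.
have mfB k : measurable (f k @^-1` B k).
  by rewrite -[X in measurable X]setTI; exact: mf.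
rewrite -(eq_bigr _ (fun k _ => pf k _ (mB k))).
exact: (iX s (fun k => f k @^-1` B k)).
Qed.

Lemma law_preserved (f : T -> T) : measurable_fun setT f ->
  (forall g : T -> \bar R, measurable_fun setT g -> (forall z, 0 <= g z)%E ->
     \int[law]_z g (f z) = \int[law]_z g z)%E ->
  forall B, measurable B -> law (f @^-1` B) = law B.
Proof.
move=> mf inv B mB.
have mfB : measurable (f @^-1` B).
  by rewrite -[X in measurable X]setTI; exact: mf.
rewrite -[B in RHS]setIT -[_ @^-1` _ in LHS]setIT -!integral_indic//.
apply: (inv (fun z => (\1_B z)%:E)); last by move=> z; rewrite lee_fin.
by apply/measurable_EFinP; exact: measurable_indic.
Qed.

Lemma iid_law_integral X k (g : T -> \bar R) : iid_law law P X -> (0 < k)%N ->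
  measurable_fun setT g -> (forall z, 0 <= g z)%E ->
  (\int[P]_w g (X k w) = \int[law]_z g z)%E.
Proof.
move=> [mX iX] k0 mg g0.
apply: (integral_push (mX k k0) mg g0) => A mA.
have := iX [:: k] (fun=> A) isT; rewrite /= k0 big_seq1 => <- //.
congr (P _); apply/seteqP; split => w /=; first by move=> h i; rewrite inE => /eqP ->.
by apply; rewrite inE.
Qed.

(** By induction, the first variable is separated from the tuple of the others: their joint law is
    shown to be a product measure, and Tonelli factors the integral. *)
Lemma iid_prod X (s : seq nat) (g : nat -> T -> R) : iid_law law P X ->
  uniq s -> all (fun k => 0 < k)%N s ->
  (forall k, measurable_fun setT (g k)) -> (forall k z, 0 <= g k z) ->
  (\int[P]_w (\prod_(k <- s) g k (X k w))%:E = \prod_(k <- s) \int[law]_z (g k z)%:E)%E.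
Proof.
move=> iX + + mg g0; have [mX lawX] := iX.
elim: s => [|k s ih] us s0.
  under eq_integral do rewrite big_nil.
  by rewrite big_nil (integral_cst P measurableT 1) [X in (_ * X)%E](@probability_setT _ _ _ P) mule1.
have /andP[ks us'] : (k \notin s) && uniq s by [].
have /andP[k0 s0'] : (0 < k)%N && all (fun k => 0 < k)%N s by [].
rewrite big_cons -ih//.
pose n := size s.
pose Y w : n.-tuple T := [tuple X (nth 0%N s i) w | i < n].
have sn (i : 'I_n) : nth 0%N s i \in s by rewrite mem_nth.
have mY : measurable_fun setT Y.
  apply/measurable_fun_tnthP => i.
  rewrite (_ : _ \o _ = X (nth 0%N s i)); first by apply: mX; exact: (allP s0').
  by apply/funext => w /=; rewrite tnth_mktuple.
have mXk := mX k k0.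
pose Ym : {mfun Omega >-> n.-tuple T} := HB.pack Y (isMeasurableFun.Build _ _ _ _ _ mY).
pose PY := distribution P Ym.
have mXY : measurable_fun setT (fun w => (X k w, Y w)).
  by apply/measurable_fun_pairP; split.
pose m' := measure_function_pushforward__canonical__measure_function_Measure P mXY.
have key : forall C, measurable C -> m' C = (law \x PY)%E C.
  apply: (@prod_measure_eq _ _ _ _ _ m' (law \x PY)%E).
    by rewrite /m'/= /pushforward/= preimage_setT probability_setT ltry.
  move=> A B mA mB; transitivity (law A * PY B)%E; last exact/esym/product_measure1E.
  have mEA : measurable (X k @^-1` A).
    by rewrite -[X in measurable X]setTI; exact: mXk.
  have gA0 : 0 <= fine (law A) by rewrite fine_ge0.
  have gAfin : law A \is a fin_num by exact: fin_num_measure.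
  (* With [A] fixed, both are finite measures of the set attached to the tuple, so that comparison
     on boxes suffices. *)
  pose n1 := measure_function_pushforward__canonical__measure_function_Measure (mrestr P mEA) mY.
  pose n2 := mscale (NngNum gA0) (measure_function_pushforward__canonical__measure_function_Measure P mY).
  have n12 : forall B, measurable B -> n1 B = n2 B.
    apply: (@tuple_measure_eq _ _ _ _ n1 n2).
      rewrite /n1/= /pushforward/= preimage_setT /mrestr setTI.
      by rewrite (le_lt_trans (probability_le1 _ _))// ltry.
    move=> D mD; rewrite /n1 /n2/= /mscale/= /pushforward/= /mrestr fineK//.
    pose D' j := if insub (index j s) is Some i then D i else setT.
    have mD' j : measurable (D' j) by rewrite /D'; case: insub.
    have D'E (i : 'I_n) : D' (nth 0%N s i) = D i by rewrite /D' index_uniq// valK.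
    have YE : Y @^-1` [set t | forall i, D i (tnth t i)] =
        [set w | forall j, j \in s -> D' j (X j w)].
      apply/seteqP; split => w /=.
        move=> h j js; have jn : (index j s < n)%N by rewrite index_mem.
        have := h (Ordinal jn); rewrite tnth_mktuple/= nth_index// -D'E/= nth_index//.
      by move=> h i; rewrite tnth_mktuple -D'E; exact: h.
    rewrite YE (lawX s D')//.
    have -> : (\prod_(j <- s) law (D' j) = \prod_(j <- s) law (if j == k then A else D' j))%E.
      apply: eq_big_seq => j js; case: eqP => // jk.
      by move: ks; rewrite -jk js.
    have := lawX (k :: s) (fun j => if j == k then A else D' j) us s0.
    rewrite big_cons eqxx => <-; last by move=> j; case: ifP.
    congr (P _); apply/seteqP; split => w /=.
      move=> [h1 h2] j; rewrite inE; case: eqP => [->//|/= jk js]; exact: h1.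
    move=> h; split; last by have := h k (mem_head _ _); rewrite eqxx.
    move=> j js; have := h j; rewrite inE js orbT => /(_ isT).
    by case: eqP => // jk; move: ks; rewrite -jk js.
  have := n12 B mB; rewrite /n1 /n2/= /mscale/= fineK// => <-.
  by rewrite /m'/= /pushforward/= /mrestr; congr (P _); apply/seteqP; split => w /= -[].
pose G (t : n.-tuple T) := \prod_(i < n) g (nth 0%N s i) (tnth t i).
have mG : measurable_fun setT G.
  apply: measurable_prod => i _; apply: measurableT_comp (mg _) _.
  exact: measurable_tnth.
have G0 t : 0 <= G t by rewrite prodr_ge0.
have GE w : G (Y w) = \prod_(j <- s) g j (X j w).
  rewrite (big_nth 0%N) big_mkord; apply: eq_bigr => i _.
  by rewrite tnth_mktuple.
have mEg j : measurable_fun setT (EFin \o g j) by exact/measurable_EFinP.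
have mEG : measurable_fun setT (EFin \o G) by exact/measurable_EFinP.
pose H (z : T * n.-tuple T) := ((g k z.1)%:E * (G z.2)%:E)%E.
have mH : measurable_fun setT H.
  apply: emeasurable_funM; first exact: measurableT_comp (mEg k) measurable_fst.
  exact: measurableT_comp mEG measurable_snd.
have H0 z : (0 <= H z)%E by rewrite mule_ge0// lee_fin.
transitivity (\int[P]_w H (X k w, Y w))%E.
  by apply: eq_integral => w _; rewrite big_cons /H/= GE EFinM.
transitivity (\int[law \x PY]_z H z)%E.
  exact: (integral_push mXY mH H0 key).
have Eg0 z : (0 <= (EFin \o g k) z)%E by rewrite lee_fin.
have EG0 t : (0 <= (EFin \o G) t)%E by rewrite lee_fin.
apply: (eq_trans (integral_prodM law PY (mEg k) mEG Eg0 EG0)); congr (_ * _)%E.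
rewrite -(integral_push (m := P) (m' := PY) mY mEG EG0)//.
by apply: eq_integral => w _; rewrite /= GE.
Qed.

End iid_law_theory.

(** * Symmetries of the noise and functions of finitely many pairs *)

Section gaussian_pairs.
Context {R : realType}.
Notation T := (measurableTypeR R).
Notation gam := (@normal_prob R 0 1).
Notation g2 := (@pair_law R).

Definition flip2 (z : T * T) : T * T := (z.1, - z.2).
Definition flip1 (z : T * T) : T * T := (- z.1, z.2).

Lemma measurable_flip2 : measurable_fun setT flip2.
Proof.
apply/measurable_fun_pairP; split; first exact: measurable_fst.
exact: (measurableT_comp (measurable_funN (@measurable_id _ _ _)) measurable_snd).
Qed.

Lemma measurable_flip1 : measurable_fun setT flip1.
Proof.
apply/measurable_fun_pairP; split; last exact: measurable_snd.
exact: (measurableT_comp (measurable_funN (@measurable_id _ _ _)) measurable_fst).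
Qed.

Definition g2_preserving (f : T * T -> T * T) :=
  measurable_fun setT f /\ forall B, measurable B -> g2 (f @^-1` B) = g2 B.

Lemma flip2_preserving : g2_preserving flip2.
Proof.
split; first exact: measurable_flip2.
by apply: (@law_preserved _ _ _ pair_law _ measurable_flip2) => g mg g0; exact: g2_oppr.
Qed.

Lemma flip1_preserving : g2_preserving flip1.
Proof.
split; first exact: measurable_flip1.
by apply: (@law_preserved _ _ _ pair_law _ measurable_flip1) => g mg g0; exact: g2_oppl.
Qed.

Lemma rot_preserving c s : c ^+ 2 + s ^+ 2 = 1 -> g2_preserving (plane_rot c s).
Proof.
move=> cs; split; first exact: measurable_plane_rot.
by apply: (@law_preserved _ _ _ pair_law _ (measurable_plane_rot c s)) => g mg g0; exact: g2_rot.
Qed.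

Lemma id_preserving : g2_preserving id.
Proof. by split. Qed.

(* Functions of the first [n] pairs: testing against every family [u] expresses measurability
   without a product sigma-algebra on infinite sequences. *)
Record coordinate_measurable (n : nat) (G : (nat -> T * T) -> R) : Prop := {
  cm_measurable : forall (d : measure_display) (S : measurableType d) (u : nat -> S -> T * T),
    (forall k, measurable_fun setT (u k)) -> measurable_fun setT (fun w => G (u^~ w)) ;
  cm_ext : forall v v', (forall k, (0 < k <= n)%N -> v k = v' k) -> G v = G v' }.

Context {d : measure_display} {Omega : measurableType d} (P : probability Omega R).
Implicit Types X : nat -> Omega -> T * T.

Lemma cm_measurable_iid n G X : iid_pairs P X -> coordinate_measurable n G ->
  measurable_fun setT (fun w => G (X^~ w)).
Proof.
move=> [mX _] [mG eG].
(* No measurability is known at index 0; a constant is substituted there, which [G] does not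
   read. *)
pose X' k w := if (0 < k)%N then X k w else (0, 0).
rewrite (_ : (fun w => _) = (fun w => G (X'^~ w))).
  apply: (mG _ _ X') => k; rewrite /X'; case: (ltnP 0 k) => // k0; exact: mX.
by apply/funext => w; apply: eG => k /andP[k0 _]; rewrite /X' k0.
Qed.

(** A function of the first [n] pairs factors through their tuple, whose law is unchanged when each
    pair is moved by a map preserving the planar law. *)
Lemma cm_integral_map n G X (f : nat -> T * T -> T * T) : iid_pairs P X ->
  coordinate_measurable n G -> (forall v, 0 <= G v) ->
  (forall k, g2_preserving (f k)) ->
  (\int[P]_w (G (X^~ w))%:E = \int[P]_w (G (fun k => f k (X k w)))%:E)%E.
Proof.
move=> iX [mG eG] G0 pf.
pose X' k w := f k (X k w).
have iX' : iid_pairs P X'.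
  by apply: (iid_law_map (f := f) iX); [move=> k; case: (pf k)|move=> k B mB; case: (pf k) => _; apply].
pose vof (t : n.-tuple (T * T)) k : T * T :=
  if insub k.-1 is Some i then tnth t i else (0, 0).
have vofE (Y : nat -> Omega -> T * T) w k : (0 < k <= n)%N -> vof (tup n Y w) k = Y k w.
  move=> /andP[k0 kn]; rewrite /vof.
  have kn' : (k.-1 < n)%N by rewrite prednK.
  by rewrite (insubT (fun i => (i < n)%N) kn')/= tnth_tup/= prednK.
have mvof : measurable_fun setT (fun t => (G (vof t))%:E).
  apply/measurable_EFinP; apply: (mG _ _ (fun k t => vof t k)) => k; rewrite /vof.
  by case: insub => // i; exact: measurable_tnth.
have GE (Y : nat -> Omega -> T * T) w : G (Y^~ w) = G (vof (tup n Y w)).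
  by apply: eG => k kn; rewrite vofE.
transitivity (\int[P]_w (G (vof (tup n X w)))%:E)%E.
  by apply: eq_integral => w _; rewrite GE.
have vge0 t : (0 <= (G (vof t))%:E)%E by rewrite lee_fin.
rewrite (tup_integral iX iX' mvof vge0).
by apply: eq_integral => w _; rewrite -(GE X').
Qed.

(** Form in which all symmetries are used: odd parts cancel inside the averaged integrand, and no
    difference of possibly infinite integrals is taken. *)
Lemma integral_half_sum (p q : Omega -> R) : measurable_fun setT p -> measurable_fun setT q ->
  (forall w, 0 <= p w) -> (forall w, 0 <= q w) ->
  (\int[P]_w (p w)%:E = \int[P]_w (q w)%:E)%E ->
  (\int[P]_w (p w)%:E = \int[P]_w (2^-1 * (p w + q w))%:E)%E.
Proof.
move=> mp mq p0 q0 pq.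
rewrite nnintZ//; last 2 first.
- exact: measurable_funD.
- by move=> w; rewrite addr_ge0.
rewrite nnintD// -pq.
have x0 := nnint_ge0 P p0; set x := (\int[P]_w _)%E in x0 *.
rewrite ge0_muleDr// -ge0_muleDl ?lee_fin//.
by rewrite (_ : (_ + _)%E = 1%E) ?mul1e// -EFinD; congr EFin; field.
Qed.

Definition flip_at (l : nat) (v : nat -> T * T) (k : nat) : T * T :=
  if k == l then flip2 (v k) else v k.

Lemma cm_integral_flip n G X l : iid_pairs P X ->
  coordinate_measurable n G -> (forall v, 0 <= G v) ->
  (\int[P]_w (G (X^~ w))%:E = \int[P]_w (G (flip_at l (X^~ w)))%:E)%E.
Proof.
move=> iX cG G0.
have pf k : g2_preserving (if k == l then flip2 else id).
  by case: ifP => _; [exact: flip2_preserving|exact: id_preserving].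
rewrite (cm_integral_map iX cG G0 pf).
apply: eq_integral => w _; congr (G _)%:E; apply/funext => k.
by rewrite /flip_at; case: ifP.
Qed.

Lemma cmD n F G : coordinate_measurable n F -> coordinate_measurable n G ->
  coordinate_measurable n (fun v => F v + G v).
Proof.
move=> [mF eF] [mG eG]; split.
  by move=> d' S u mu_; apply: measurable_funD; [exact: mF|exact: mG].
by move=> v v' vv'; rewrite (eF _ _ vv') (eG _ _ vv').
Qed.

Lemma cmM n F G : coordinate_measurable n F -> coordinate_measurable n G ->
  coordinate_measurable n (fun v => F v * G v).
Proof.
move=> [mF eF] [mG eG]; split.
  by move=> d' S u mu_; apply: measurable_funM; [exact: mF|exact: mG].
by move=> v v' vv'; rewrite (eF _ _ vv') (eG _ _ vv').
Qed.

Lemma cm_cst n c : coordinate_measurable n (fun=> c).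
Proof. by split => // d' S u mu_; exact: measurable_cst. Qed.

Lemma cmB n F G : coordinate_measurable n F -> coordinate_measurable n G ->
  coordinate_measurable n (fun v => F v - G v).
Proof.
move=> [mF eF] [mG eG]; split.
  by move=> d' S u mu_; apply: measurable_funB; [exact: mF|exact: mG].
by move=> v v' vv'; rewrite (eF _ _ vv') (eG _ _ vv').
Qed.

Lemma cmX n F m : coordinate_measurable n F -> coordinate_measurable n (fun v => F v ^+ m).
Proof.
move=> [mF eF]; split.
  by move=> d' S u mu_; apply: measurable_funX; exact: mF.
by move=> v v' vv'; rewrite (eF _ _ vv').
Qed.

Lemma cm_max n F G : coordinate_measurable n F -> coordinate_measurable n G ->
  coordinate_measurable n (fun v => Num.max (F v) (G v)).
Proof.
move=> [mF eF] [mG eG]; split.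
  by move=> d' S u mu_; apply: measurable_maxr; [exact: mF|exact: mG].
by move=> v v' vv'; rewrite (eF _ _ vv') (eG _ _ vv').
Qed.

(** The inverse is the real power of exponent -1, known to be measurable; this is where
    nonnegativity enters. *)
Lemma cmV n F : coordinate_measurable n F -> (forall v, 0 <= F v) ->
  coordinate_measurable n (fun v => (F v)^-1).
Proof.
move=> [mF eF] F0; split.
  move=> d' S u mu_; rewrite (_ : (fun w => _) = (@powR R ^~ (-1)) \o (fun w => F (u^~ w))).
    by apply: measurableT_comp; [exact: measurable_powR|exact: mF].
  by apply/funext => w /=; rewrite powR_inv1.
by move=> v v' vv'; rewrite (eF _ _ vv').
Qed.

Lemma cm_fst n k : (0 < k <= n)%N -> coordinate_measurable n (fun v => (v k).1).
Proof.
move=> kn; split; last by move=> v v' /(_ _ kn) ->.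
by move=> d' S u mu_; exact: (measurableT_comp measurable_fst (mu_ k)).
Qed.

Lemma cm_snd n k : (0 < k <= n)%N -> coordinate_measurable n (fun v => (v k).2).
Proof.
move=> kn; split; last by move=> v v' /(_ _ kn) ->.
by move=> d' S u mu_; exact: (measurableT_comp measurable_snd (mu_ k)).
Qed.

Lemma cm_sum n (I : eqType) (s : seq I) (F : I -> (nat -> T * T) -> R) :
  (forall i, i \in s -> coordinate_measurable n (F i)) ->
  coordinate_measurable n (fun v => \sum_(i <- s) F i v).
Proof.
elim: s => [|i s ih] cF.
  rewrite (_ : (fun v => _) = fun=> 0); first exact: cm_cst.
  by apply/funext => v; rewrite big_nil.
rewrite (_ : (fun v => _) = fun v => F i v + \sum_(j <- s) F j v).
  apply: cmD; first by apply: cF; rewrite mem_head.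
  by apply: ih => j js; apply: cF; rewrite inE js orbT.
by apply/funext => v; rewrite big_cons.
Qed.

Lemma cm_le n F G : coordinate_measurable n F -> coordinate_measurable n G ->
  coordinate_measurable n (fun v => ((F v <= G v)%R%:R : R)).
Proof.
move=> [mF eF] [mG eG]; split.
  move=> d' S u mu_; apply: (measurableT_comp (f := fun b : bool => b%:R : R)).
    by move=> _ B mB.
  by apply: measurable_fun_ler; [exact: mF|exact: mG].
by move=> v v' vv'; rewrite (eF _ _ vv') (eG _ _ vv').
Qed.

(** * Random signs: moments of sums whose terms are odd in separate coordinates *)

Section rademacher.
Variables (N : nat) (m : nat -> (nat -> T * T) -> R) (X : nat -> Omega -> T * T).
Hypothesis iX : iid_pairs P X.
Hypothesis cm_m : forall k, (0 < k <= N)%N -> coordinate_measurable N (m k).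
Hypothesis m_flip : forall k v, m k (flip_at k v) = - m k v.
Hypothesis m_flip' : forall k l v, k != l -> m k (flip_at l v) = m k v.

Let S n v := \sum_(1 <= k < n.+1) m k v.
Let V n v := \sum_(1 <= k < n.+1) m k v ^+ 2.

Let cmS n : (n <= N)%N -> coordinate_measurable N (S n).
Proof.
move=> nN; apply: cm_sum => k; rewrite mem_index_iota => /andP[k0 kn].
by apply: cm_m; rewrite k0/= (leq_trans _ nN).
Qed.

Let cmV' n : (n <= N)%N -> coordinate_measurable N (V n).
Proof.
move=> nN; apply: cm_sum => k; rewrite mem_index_iota => /andP[k0 kn].
by apply/cmX/cm_m; rewrite k0/= (leq_trans _ nN).
Qed.

Let S_flip n v : S n (flip_at n.+1 v) = S n v.
Proof.
rewrite /S !big_seq; apply: eq_bigr => k; rewrite mem_index_iota => /andP[_ kn].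
by apply: m_flip'; rewrite ltn_eqF.
Qed.

Let m2_flip k l v : m k (flip_at l v) ^+ 2 = m k v ^+ 2.
Proof.
by have [->|kl] := eqVneq k l; [rewrite m_flip sqrrN|rewrite m_flip'].
Qed.

(** Averaging over the sign of the last term cancels the cross product. The weight [g] may be any
    function of the noise that ignores the signs, in particular the indicator of the good event. *)
Lemma rademacher2 n g : (n <= N)%N -> coordinate_measurable N g -> (forall v, 0 <= g v) ->
  (forall l v, g (flip_at l v) = g v) ->
  (\int[P]_w (S n (X^~ w) ^+ 2 * g (X^~ w))%:E =
   \int[P]_w (V n (X^~ w) * g (X^~ w))%:E)%E.
Proof.
elim: n => [|n ih] nN cg g0 gf.
  by apply: eq_integral => w _; rewrite /S /V !big_nil expr0n.
have n1 : (0 < n.+1 <= N)%N by [].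
have nN' := ltnW nN.
pose p v := (S n v + m n.+1 v) ^+ 2 * g v.
pose q v := (S n v - m n.+1 v) ^+ 2 * g v.
have cp : coordinate_measurable N p.
  by apply: cmM => //; apply/cmX/cmD; [exact: cmS|exact: cm_m].
have cq : coordinate_measurable N q.
  by apply: cmM => //; apply/cmX/cmB; [exact: cmS|exact: cm_m].
have p0 v : 0 <= p v by rewrite mulr_ge0// sqr_ge0.
have q0 v : 0 <= q v by rewrite mulr_ge0// sqr_ge0.
transitivity (\int[P]_w (p (X^~ w))%:E)%E.
  by apply: eq_integral => w _; rewrite /p /S big_nat_recr.
rewrite (@integral_half_sum (fun w => p (X^~ w)) (fun w => q (X^~ w)))//; first last.
- rewrite (cm_integral_flip n.+1 iX cp)//; apply: eq_integral => w _.
  by rewrite /p /q S_flip m_flip gf.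
- exact: cm_measurable_iid cq.
- exact: cm_measurable_iid cp.
pose t1 v := S n v ^+ 2 * g v.
pose t2 v := m n.+1 v ^+ 2 * g v.
pose t3 v := V n v * g v.
have c1 : coordinate_measurable N t1 by apply: cmM => //; apply/cmX/cmS.
have c2 : coordinate_measurable N t2 by apply: cmM => //; apply/cmX/cm_m.
have c3 : coordinate_measurable N t3 by apply: cmM => //; exact: cmV'.
have t10 v : 0 <= t1 v by rewrite mulr_ge0// sqr_ge0.
have t20 v : 0 <= t2 v by rewrite mulr_ge0// sqr_ge0.
have t30 v : 0 <= t3 v by rewrite mulr_ge0// sumr_ge0// => i _; rewrite sqr_ge0.
transitivity (\int[P]_w (t1 (X^~ w) + t2 (X^~ w))%:E)%E.
  by apply: eq_integral => w _; congr EFin; rewrite /p /q /t1 /t2; field.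
transitivity (\int[P]_w (t3 (X^~ w) + t2 (X^~ w))%:E)%E; last first.
  by apply: eq_integral => w _; rewrite /t3 /t2 /V [in RHS]big_nat_recr//= mulrDl.
rewrite (@nnintD _ _ _ P (fun w => t1 (X^~ w)) (fun w => t2 (X^~ w)))//; last 2 first.
- exact: cm_measurable_iid c1.
- exact: cm_measurable_iid c2.
rewrite (@nnintD _ _ _ P (fun w => t3 (X^~ w)) (fun w => t2 (X^~ w)))//; last 2 first.
- exact: cm_measurable_iid c3.
- exact: cm_measurable_iid c2.
by rewrite ih.
Qed.

(** Averaging over the last sign leaves [S^4 + 6 S^2 m^2 + m^4]. The middle term is the
    second-moment identity with weight [6 m^2 g], again blind to signs, and
    [3 V^2 + 6 V m^2 + m^4 <= 3 (V + m^2)^2] closes the induction. *)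
Lemma rademacher4 n g : (n <= N)%N -> coordinate_measurable N g -> (forall v, 0 <= g v) ->
  (forall l v, g (flip_at l v) = g v) ->
  (\int[P]_w (S n (X^~ w) ^+ 4 * g (X^~ w))%:E <=
   \int[P]_w (3 * (V n (X^~ w) ^+ 2 * g (X^~ w)))%:E)%E.
Proof.
elim: n => [|n ih] nN cg g0 gf.
  rewrite [leLHS]integral0_eq.
    have V0 w : 0 <= V 0 w by rewrite /V big_nil.
    apply: (@nnint_ge0 _ _ _ P (fun w => 3 * (V 0 (X^~ w) ^+ 2 * g (X^~ w)))) => w.
    by have ? := g0 (X^~ w); nneg.
  by move=> w _; rewrite /S !big_nil !expr0n !mul0r.
have n1 : (0 < n.+1 <= N)%N by [].
have nN' := ltnW nN.
pose p v := (S n v + m n.+1 v) ^+ 4 * g v.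
pose q v := (S n v - m n.+1 v) ^+ 4 * g v.
have cp : coordinate_measurable N p.
  by apply: cmM => //; apply/cmX/cmD; [exact: cmS|exact: cm_m].
have cq : coordinate_measurable N q.
  by apply: cmM => //; apply/cmX/cmB; [exact: cmS|exact: cm_m].
have pow4 (x : R) : 0 <= x ^+ 4 by rewrite (_ : 4 = 2 * 2)%N// exprM sqr_ge0.
have p0 v : 0 <= p v by rewrite mulr_ge0.
have q0 v : 0 <= q v by rewrite mulr_ge0.
have -> : (\int[P]_w (S n.+1 (X^~ w) ^+ 4 * g (X^~ w))%:E = \int[P]_w (p (X^~ w))%:E)%E.
  by apply: eq_integral => w _; rewrite /p /S big_nat_recr.
rewrite (@integral_half_sum (fun w => p (X^~ w)) (fun w => q (X^~ w)))//; first last.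
- rewrite (cm_integral_flip n.+1 iX cp)//; apply: eq_integral => w _.
  by rewrite /p /q S_flip m_flip gf.
- exact: cm_measurable_iid cq.
- exact: cm_measurable_iid cp.
pose g' v := 6 * (m n.+1 v ^+ 2 * g v).
have cg' : coordinate_measurable N g'.
  by apply: cmM; [exact: cm_cst|apply: cmM => //; apply/cmX/cm_m].
have g'0 v : 0 <= g' v by rewrite /g'; have ? := g0 v; nneg.
have g'f l v : g' (flip_at l v) = g' v by rewrite /g' m2_flip gf.
have V0 v : 0 <= V n v by rewrite sumr_ge0// => i _; rewrite sqr_ge0.
pose t1 v := S n v ^+ 4 * g v.
pose t2 v := S n v ^+ 2 * g' v.
pose t3 v := m n.+1 v ^+ 4 * g v.
pose s1 v := 3 * (V n v ^+ 2 * g v).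
pose s2 v := V n v * g' v.
have c1 : coordinate_measurable N t1 by apply: cmM => //; apply/cmX/cmS.
have c2 : coordinate_measurable N t2 by apply: cmM => //; apply/cmX/cmS.
have c3 : coordinate_measurable N t3 by apply: cmM => //; apply/cmX/cm_m.
have cs1 : coordinate_measurable N s1.
  by apply: cmM; [exact: cm_cst|apply: cmM => //; apply/cmX/cmV'].
have cs2 : coordinate_measurable N s2 by apply: cmM => //; exact: cmV'.
have t10 v : 0 <= t1 v by rewrite mulr_ge0.
have t20 v : 0 <= t2 v by rewrite mulr_ge0// sqr_ge0.
have t30 v : 0 <= t3 v by rewrite mulr_ge0.
have s10 v : 0 <= s1 v by rewrite /s1; have ? := g0 v; nneg.
have s20 v : 0 <= s2 v by rewrite mulr_ge0.
have D3 (a b c : (nat -> T * T) -> R) : coordinate_measurable N a -> coordinate_measurable N b ->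
    coordinate_measurable N c -> (forall v, 0 <= a v) -> (forall v, 0 <= b v) -> (forall v, 0 <= c v) ->
    (\int[P]_w (a (X^~ w) + b (X^~ w) + c (X^~ w))%:E = \int[P]_w (a (X^~ w))%:E +
      \int[P]_w (b (X^~ w))%:E + \int[P]_w (c (X^~ w))%:E)%E.
  move=> ca cb cc a0 b0 c0.
  have ma := cm_measurable_iid iX ca; have mb := cm_measurable_iid iX cb.
  have mc := cm_measurable_iid iX cc.
  rewrite (@nnintD _ _ _ P (fun w => a (X^~ w) + b (X^~ w)) (fun w => c (X^~ w)))//.
  - by rewrite (@nnintD _ _ _ P (fun w => a (X^~ w)) (fun w => b (X^~ w))).
  - exact: measurable_funD.
  - by move=> w; rewrite addr_ge0.
have -> : (\int[P]_w (2^-1 * (p (X^~ w) + q (X^~ w)))%:E =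
    \int[P]_w (t1 (X^~ w) + t2 (X^~ w) + t3 (X^~ w))%:E)%E.
  by apply: eq_integral => w _; congr EFin; rewrite /p /q /t1 /t2 /t3 /g'; field.
rewrite D3//.
apply: (@le_trans _ _ (\int[P]_w (s1 (X^~ w) + s2 (X^~ w) + t3 (X^~ w))%:E)%E).
  rewrite D3// leeD2r// leeD//; first exact: ih.
  by rewrite rademacher2.
apply: nnint_le.
- have c123 : coordinate_measurable N (fun v => s1 v + s2 v + t3 v) by do 2 apply: cmD => //.
  exact: (cm_measurable_iid iX c123).
- have cV1 : coordinate_measurable N (fun v => 3 * (V n.+1 v ^+ 2 * g v)).
    by apply: cmM; [exact: cm_cst|apply: cmM => //; apply/cmX/cmV'].
  exact: (cm_measurable_iid iX cV1).
- by move=> w; rewrite !addr_ge0.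
- have VS v : V n.+1 v = V n v + m n.+1 v ^+ 2 by rewrite /V big_nat_recr.
  move=> w; rewrite /s1 /s2 /t3 /g' VS.
  set a := V n _; set b := m _ _; set c := g _.
  have c0 : 0 <= c by exact: g0.
  rewrite -subr_ge0.
  have -> : 3 * ((a + b ^+ 2) ^+ 2 * c) - (3 * (a ^+ 2 * c) + a * (6 * (b ^+ 2 * c)) + b ^+ 4 * c) =
    2 * (b ^+ 4 * c) by ring.
  by rewrite mulr_ge0// mulr_ge0.
Qed.

End rademacher.

(** Markov's inequality for the exponential of the sum; the free Chernoff parameter is absorbed in
    [q] and [t]. *)
Lemma chernoff_pairs X (s : seq nat) (q : nat -> T * T -> R) (v : nat -> R) (t : R) :
  iid_pairs P X -> uniq s -> all (fun k => 0 < k)%N s ->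
  (forall k, measurable_fun setT (q k)) ->
  (forall k, k \in s -> \int[g2]_z (expR (q k z))%:E <= (expR (v k))%:E)%E ->
  (P [set w | (t <= \sum_(k <- s) q k (X k w))%R] <= (expR (\sum_(k <- s) v k - t))%:E)%E.
Proof.
move=> iX us s0 mq hq; have [mX _] := iX.
pose S w := \sum_(k <- s) q k (X k w).
have mS : measurable_fun setT S.
  rewrite (_ : S = fun w => \sum_(k <- s | (0 < k)%N) q k (X k w)).
    by apply: measurable_bigsum => k k0; exact: measurableT_comp (mq k) (mX k k0).
  apply/funext => w; rewrite /S [LHS]big_seq [RHS]big_seq_cond.
  by apply: eq_bigl => k; case: (boolP (k \in s)) => //= ks; rewrite (allP s0 _ ks).
have mE : measurable [set w | t <= S w].
  have := measurable_fun_ler (measurable_cst t) mS measurableT (Y := [set true]) I.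
  by rewrite setTI; congr measurable; apply/seteqP; split => w.
rewrite -[X in P X]setIT -integral_indic//.
have mexp : measurable_fun setT (fun w => expR (S w)) by exact: measurableT_comp.
apply: (@le_trans _ _ (\int[P]_w (expR (- t) * expR (S w))%:E)%E).
  apply: nnint_le => //.
  - exact: measurable_funM.
  - move=> w; rewrite indicE; have [|_] := boolP (w \in _); last by rewrite mulr_ge0 ?expR_ge0.
    by rewrite inE /= => tS; rewrite -expRD -[leLHS]expR0 ler_expR addrC subr_ge0.
rewrite nnintZ ?expR_ge0//.
have -> : (\int[P]_w (expR (S w))%:E = \int[P]_w (\prod_(k <- s) expR (q k (X k w)))%:E)%E.
  by apply: eq_integral => w _; rewrite /S expR_sum.
rewrite (iid_prod (g := fun k z => expR (q k z)) iX)//; last first.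
  by move=> k; exact: measurableT_comp.
rewrite addrC expRD EFinM lee_wpmul2l ?lee_fin ?expR_ge0//.
rewrite expR_sum -prodEFin.
elim: s us s0 hq {S mS mE mexp} => [|k s ih] us s0 hq; first by rewrite !big_nil.
rewrite !big_cons; apply: lee_pmul.
- by apply: integral_ge0 => z _; rewrite lee_fin expR_ge0.
- by apply: prode_ge0 => i _; apply: integral_ge0 => z _; rewrite lee_fin expR_ge0.
- by apply: hq; rewrite mem_head.
- case/andP: us => _ us; case/andP: s0 => _ s0.
  by apply: ih => // j js; apply: hq; rewrite inE js orbT.
Qed.

Lemma g2_expR_lin (c : R) : (\int[g2]_z (expR (c * z.1))%:E = (expR (c ^+ 2 / 2))%:E)%E.
Proof.
have mc : measurable_fun [set: T] (fun x : T => (expR (c * x))%:E).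
  by apply/measurable_EFinP; apply: measurableT_comp => //; exact: measurable_funM.
have c0 (x : T) : (0 <= (expR (c * x))%:E)%E by rewrite lee_fin expR_ge0.
have := integral_prodM gam gam mc (measurable_cst 1%E) c0 (fun=> lee01).
rewrite [X in (_ * X)%E](integral_cst gam measurableT 1) [X in (_ * (_ * X))%E](@probability_setT _ _ _ gam) !mule1.
rewrite gam_expR_lin => <-; by apply: eq_integral => z _; rewrite mule1.
Qed.

Lemma g2_expR_chisq (c c' : R) : - (1 / 20) <= c <= 1 / 20 -> - (1 / 20) <= c' <= 1 / 20 ->
  (\int[g2]_z (expR (c * (z.1 ^+ 2 - 1) + c' * (z.2 ^+ 2 - 1)))%:E <=
   (expR (3 / 2 * (c ^+ 2 + c' ^+ 2)))%:E)%E.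
Proof.
move=> hc hc'.
have mc (b : R) : measurable_fun [set: T] (fun x : T => (expR (b * (x ^+ 2 - 1)))%:E).
  apply/measurable_EFinP; apply: measurableT_comp => //; apply: measurable_funM => //.
  by apply: measurable_funB => //; exact: measurable_funX.
have c0 (b : R) (x : T) : (0 <= (expR (b * (x ^+ 2 - 1)))%:E)%E by rewrite lee_fin expR_ge0.
have H := integral_prodM gam gam (mc c) (mc c') (c0 c) (c0 c').
have -> : (\int[g2]_z (expR (c * (z.1 ^+ 2 - 1) + c' * (z.2 ^+ 2 - 1)))%:E =
  \int[g2]_z ((expR (c * (z.1 ^+ 2 - 1)))%:E * (expR (c' * (z.2 ^+ 2 - 1)))%:E))%E.
  by apply: eq_integral => z _; rewrite expRD EFinM.
rewrite H mulrDr expRD EFinM; apply: lee_pmul.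
- exact: integral_ge0.
- exact: integral_ge0.
- exact: gam_expR_chisq.
- exact: gam_expR_chisq.
Qed.

End gaussian_pairs.

(** * Stein and oracle weights on one block *)

Section one_block.
Context {R : realType}.
Implicit Types F s ph L Q D h hh : R.

(** Replaces [sqrt (F s)] by a linear expression with a free balance [t]; it serves with [t = 1],
    with [t = 10], and with the value that minimizes a sum over blocks. *)
Lemma sqr_bound_amgm L ph F s t : 0 <= ph -> 0 <= F -> 0 <= s -> 0 < t ->
  L ^+ 2 <= ph ^+ 2 * (F * s) -> `|L| <= ph / 2 * (t * F + s / t).
Proof.
move=> ph0 F0 s0 t0 hL.
have B0 : 0 <= ph / 2 * (t * F + s / t).
  by rewrite mulr_ge0 ?divr_ge0 ?addr_ge0 ?mulr_ge0 ?invr_ge0// ltW.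
rewrite -(ger0_norm B0) -ler_sqr ?nnegrE ?normr_ge0// !real_normK ?num_real//.
apply: (le_trans hL).
have -> : (ph / 2 * (t * F + s / t)) ^+ 2 = ph ^+ 2 * (F * s + ((t * F - s / t) / 2) ^+ 2).
  by field; rewrite gt_eqF.
by rewrite ler_wpM2l ?sqr_ge0// lerDl sqr_ge0.
Qed.

Definition oracle_weight F s := F / (F + s).

Definition stein_weight s ph y := Num.max 0 (1 - s * (1 + ph) / (Num.max 0 (y - 2 * s) + s)).

(** The block energy is [F + 2 s + L + Q] with [L] linear and [Q] centred quadratic in the noise;
    [D] is the difference of its two quadratic parts. The factor 19/20 leaves room [ph * s / 20],
    which absorbs the noise part of [L] in [stein_le_oracle]. *)
Record good_block F s ph L Q D : Prop := GoodBlock {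
  gb_F : 0 <= F ; gb_s : 0 < s ; gb_ph0 : 0 <= ph ; gb_ph : ph <= 1 / 100 ;
  gb_L : L ^+ 2 <= ph ^+ 2 * (F * s) ;
  gb_Q : - (ph * s) <= Q <= 19 / 20 * (ph * s) ;
  gb_D : - (ph * s) <= D <= ph * s }.

Lemma oracle_weight_ge0 F s : 0 <= F -> 0 < s -> 0 <= oracle_weight F s.
Proof. by move=> F0 s0; rewrite divr_ge0// addr_ge0// ltW. Qed.

Lemma oracle_weight_le1 F s : 0 <= F -> 0 < s -> oracle_weight F s <= 1.
Proof. by move=> F0 s0; rewrite ler_pdivrMr ?mul1r; lra. Qed.

Lemma oracle_weightE F s : 0 <= F -> 0 < s -> oracle_weight F s * (F + s) = F.
Proof. by move=> F0 s0; rewrite divfK// gt_eqF//; lra. Qed.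

Section good.
Variables (F s ph L Q D : R).
Hypothesis gb : good_block F s ph L Q D.
Let h := oracle_weight F s.
Let hh := stein_weight s ph (F + 2 * s + L + Q).

Let F0 := gb_F gb. Let s0 := gb_s gb. Let ph0 := gb_ph0 gb. Let ph1 := gb_ph gb.

Let L1 : `|L| <= ph / 2 * (F + s).
Proof.
have := sqr_bound_amgm ph0 F0 (ltW s0) ltr01 (gb_L gb).
by rewrite mul1r divr1.
Qed.

Let L10 : `|L| <= ph * (5 * F + s / 20).
Proof.
have t0 : 0 < 10 :> R by [].
have := sqr_bound_amgm ph0 F0 (ltW s0) t0 (gb_L gb).
by congr (_ <= _); field.
Qed.

Lemma stein_weight_ge0 : 0 <= hh.
Proof. by rewrite /hh /stein_weight le_max lexx. Qed.

Let E := F + L + Q.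

Let hhE : hh = Num.max 0 (1 - s * (1 + ph) / (Num.max 0 E + s)).
Proof.
rewrite /hh /stein_weight; have -> : F + 2 * s + L + Q - 2 * s = E by rewrite /E; ring.
by [].
Qed.

Let Ebound : (1 - 3 / 2 * ph) * (F + s) <= Num.max 0 E + s <= (1 + 3 / 2 * ph) * (F + s).
Proof.
have /ler_normlP[la lb] := L1; have /andP[qa qb] := gb_Q gb.
have := F0; have := s0; have := ph0; have := ph1 => p1 p0 s0' F0'.
have pF : 0 <= ph * F by rewrite mulr_ge0.
have ps : 0 <= ph * s by rewrite mulr_ge0// ltW.
apply/andP; split.
  have hm : E <= Num.max 0 E by rewrite le_max lexx orbT.
  by apply: (@le_trans _ _ (E + s)); [rewrite /E; lra|rewrite lerD2r].
rewrite -lerBrDr ge_max; apply/andP; split; first by lra.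
by rewrite /E; lra.
Qed.

(** Before truncation, [1 - hh] is [s (1 + ph)] over a quantity within a factor [1 + O(ph)] of
    [F + s], hence relatively close to [1 - h = s / (F + s)]. Truncation at 0 can only bring the
    weight nearer to [h >= 0]. *)
Lemma stein_oracle_close : `|hh - h| <= 4 * ph * (1 - h).
Proof.
have /andP[e1 e2] := Ebound.
have := F0; have := s0; have := ph0; have := ph1 => p1 p0 s0' F0'.
set X := Num.max 0 E + s in e1 e2.
have Fs0 : 0 < F + s by lra.
have X0 : 0 < X by nra.
have h1 : (1 - h) * (F + s) = s by rewrite mulrBl mul1r oracle_weightE//; ring.
have h1' : 0 <= 1 - h by rewrite subr_ge0 oracle_weight_le1.
have key : (1 - ph) * (1 - h) <= s * (1 + ph) / X <= (1 + 4 * ph) * (1 - h).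
  apply/andP; split.
    rewrite ler_pdivlMr// -[in leRHS]h1.
    apply: (@le_trans _ _ ((1 - ph) * (1 - h) * ((1 + 3 / 2 * ph) * (F + s)))).
      by rewrite ler_wpM2l// mulr_ge0//; lra.
    rewrite (_ : _ * (_ * _) = (1 - ph) * (1 + 3 / 2 * ph) * ((1 - h) * (F + s))); last by ring.
    rewrite [leRHS]mulrC ler_wpM2r ?h1 ?(ltW s0')//; nra.
  rewrite ler_pdivrMr// -[in leLHS]h1.
  apply: (@le_trans _ _ ((1 + 4 * ph) * (1 - h) * ((1 - 3 / 2 * ph) * (F + s)))); last first.
    by rewrite ler_wpM2l// mulr_ge0//; lra.
  rewrite (_ : _ * (1 - h) * _ = (1 + 4 * ph) * (1 - 3 / 2 * ph) * ((1 - h) * (F + s))); last by ring.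
  rewrite mulrC ler_wpM2r ?h1 ?(ltW s0')//; nra.
case/andP: key => k1 k2.
rewrite hhE -/X; set q := s * (1 + ph) / X in k1 k2 *.
have hh0 := oracle_weight_ge0 F0' s0'; rewrite -/h in hh0.
have p4 : 0 <= ph * (1 - h) by rewrite mulr_ge0.
have [q1|q1] := leP 0 (1 - q).
  by apply/ler_normlP; split; lra.
by apply/ler_normlP; split; lra.
Qed.

(** Closeness alone says nothing useful when [h] is much smaller than [ph]. Here the penalty pays:
    it exceeds the positive fluctuation of the noise, so the numerator of the untruncated weight is
    at most [(1 + 5 ph) F]. *)
Lemma stein_le_oracle : hh <= 2 * h.
Proof.
have := F0; have := s0; have := ph0; have := ph1 => p1 p0 s0' F0'.
have h0 := oracle_weight_ge0 F0' s0'; rewrite -/h in h0.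
have /andP[e1 e2] := Ebound.
have /ler_normlP[la lb] := L10; have /andP[qa qb] := gb_Q gb.
rewrite hhE; set X := Num.max 0 E + s in e1 e2 *.
have Fs0 : 0 < F + s by lra.
have X0 : 0 < X by nra.
rewrite ge_max mulr_ge0//=.
have XE : X = Num.max 0 E + s by [].
have [E0|E0] := leP 0 E.
  rewrite max_r// in XE.
  have -> : 1 - s * (1 + ph) / X = (E - ph * s) / X.
    by rewrite XE; field; rewrite gt_eqF// -XE.
  rewrite ler_pdivrMr// .
  have pF : 0 <= ph * F by rewrite mulr_ge0.
  have pF1 : ph * F <= F / 100 by nra.
  apply: (@le_trans _ _ ((1 + 5 * ph) * F)); first by rewrite /E; lra.
  have hF := oracle_weightE F0' s0'; rewrite -/h in hF.
  apply: (@le_trans _ _ (2 * h * ((1 - 3 / 2 * ph) * (F + s)))); last first.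
    by rewrite ler_wpM2l// mulr_ge0.
  have -> : 2 * h * ((1 - 3 / 2 * ph) * (F + s)) = 2 * (1 - 3 / 2 * ph) * (h * (F + s)) by ring.
  by rewrite hF; lra.
rewrite max_l ?(ltW E0)// add0r in XE.
rewrite XE -mulrAC divff ?gt_eqF// mul1r.
by have := h0; lra.
Qed.

Let hF : h * (F + s) = F. Proof. exact: oracle_weightE. Qed.
Let h0 : 0 <= h. Proof. exact: oracle_weight_ge0. Qed.
Let h1 : h <= 1. Proof. exact: oracle_weight_le1. Qed.

(** In [(hh - h) (hh + h)] closeness bounds one factor and [hh <= 2 h] the other. Keeping the
    product [h (1 - h)] matters: multiplied by [F + s] it becomes [h s]. *)
Lemma stein_sqr_le : hh ^+ 2 <= h ^+ 2 + 12 * ph * (h * (1 - h)).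
Proof.
have /ler_normlP[c1 c2] := stein_oracle_close.
have c3 := stein_le_oracle; have c4 := stein_weight_ge0.
have -> : hh ^+ 2 = h ^+ 2 + (hh - h) * (hh + h) by ring.
rewrite lerD2l; apply: (@le_trans _ _ (4 * ph * (1 - h) * (hh + h))).
  by rewrite ler_wpM2r// addr_ge0.
have : 4 * ph * (1 - h) * (hh + h) <= 4 * ph * (1 - h) * (3 * h).
  rewrite ler_wpM2l//; last by lra.
  by rewrite !mulr_ge0// subr_ge0.
by move=> /le_trans; apply; rewrite le_eqVlt; apply/orP; left; apply/eqP; ring.
Qed.

(** On the signal part closeness is used with [F (1 - h) = h s], on the noise part [|hh - h| <= h];
    both contributions are [ph] times the oracle risk of the block. *)
Lemma block_information : `|(hh - h) * (F + L + D)| <= 10 * ph * (h * s).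
Proof.
have /ler_normlP[c1 c2] := stein_oracle_close.
have c3 := stein_le_oracle; have c4 := stein_weight_ge0.
have := F0; have := s0; have := ph0; have := ph1 => p1 p0 s0' F0'.
have /ler_normlP[la lb] := L1; have /andP[da db] := gb_D gb.
have pF : 0 <= ph * F by rewrite mulr_ge0.
have pF1 : ph * F <= F / 100 by nra.
have ps : 0 <= ph * s by rewrite mulr_ge0// ltW.
have H : `|F + L + D| <= 2 * F + 2 * (ph * s).
  by apply/ler_normlP; split; lra.
have d1 : `|hh - h| <= 4 * ph * (1 - h) by apply/ler_normlP; split; lra.
have d2 : `|hh - h| <= h by apply/ler_normlP; split; lra.
have FR : F * (1 - h) = h * s by rewrite mulrBr mulr1 -[X in X - _]hF; ring.
rewrite normrM; apply: (@le_trans _ _ (`|hh - h| * (2 * F + 2 * (ph * s)))).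
  by rewrite ler_wpM2l.
rewrite mulrDr.
have u1 : `|hh - h| * (2 * F) <= 8 * ph * (h * s).
  apply: (@le_trans _ _ (4 * ph * (1 - h) * (2 * F))); first by rewrite ler_wpM2r// mulr_ge0.
  by rewrite -FR le_eqVlt; apply/orP; left; apply/eqP; ring.
have u2 : `|hh - h| * (2 * (ph * s)) <= 2 * ph * (h * s).
  apply: (@le_trans _ _ (h * (2 * (ph * s)))); first by rewrite ler_wpM2r// mulr_ge0.
  by rewrite le_eqVlt; apply/orP; left; apply/eqP; ring.
by lra.
Qed.

Lemma block_energy : F + 2 * s + L + Q <= 2 * F + 4 * s.
Proof.
have := F0; have := s0; have := ph0; have := ph1 => p1 p0 s0' F0'.
have /ler_normlP[la lb] := L1; have /andP[qa qb] := gb_Q gb.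
have pF1 : ph * F <= F / 100 by nra.
have ps1 : ph * s <= s / 100 by nra.
by lra.
Qed.

Lemma block_noise : s + (Q - D) / 2 <= 2 * s.
Proof.
have := s0; have := ph1 => p1 s0'.
have /andP[qa qb] := gb_Q gb; have /andP[da db] := gb_D gb.
have ps1 : ph * s <= s / 100 by nra.
by lra.
Qed.

End good.
End one_block.

(** * From the first-order condition to a bound on the squared error *)

Section final_algebra.
Context {R : realType}.

(* First-order condition [|u| I <= |M| + u^2 Q] turned into a bound on [u^2]; the expansion
   [1/(1+x)^2 <= 1 - 2x + 4x^2] keeps the term linear in [Wa], whose mean vanishes. *)
Lemma error_bound (u M I Q F r Wa Dl phi e l K c : R) :
  0 < c -> c <= 1 -> c <= F -> 0 < e -> 0 <= K ->
  0 <= r -> r <= 1 -> r <= F / 32 -> 0 <= phi -> phi <= 1 / 100 ->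
  0 <= Q -> Q <= K * (phi * r) / e -> `|u| <= 4 * e * l -> 16 * K * (l * (phi * r)) <= F ->
  `|u| * I <= `|M| + u ^+ 2 * Q ->
  I = F - r + Wa + Dl -> Wa ^+ 2 <= phi ^+ 2 * (F * r) -> `|Dl| <= 11 * (phi * r) ->
  u ^+ 2 <= M ^+ 2 / F ^+ 2 * (1 + 2 * (r / F) - 2 * (Wa / F) +
      (100 + 64 * K) / c ^+ 2 * ((phi + r) * r)) +
    (64 * K + 1024 * K ^+ 2) / c ^+ 6 * (phi * r) * (M ^+ 4 / e ^+ 2).
Proof.
move=> c0 c1 cF e0 K0 r0 r1 rF p0 p1 Q0 hQ hu hl foc IE hW hD.
have F0 : 0 < F by lra.
have Wb : `|Wa| <= F / 32.
  have W2 : `|Wa| ^+ 2 <= (F / 32) ^+ 2.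
    rewrite real_normK ?num_real//; apply: (le_trans hW).
    have : F * r <= F * (F / 32) by rewrite ler_wpM2l// ltW.
    have : 0 <= F * r by rewrite mulr_ge0// ltW.
    have p2 : phi ^+ 2 <= (1 / 100) ^+ 2 by rewrite ler_sqr ?nnegrE//; lra.
    move=> a0 a1; apply: (@le_trans _ _ ((1 / 100) ^+ 2 * (F * (F / 32)))).
      by apply: ler_pM => //; exact: sqr_ge0.
    have : 0 <= F ^+ 2 by exact: sqr_ge0.
    by move: (F ^+ 2) => F2 h; rewrite !expr2; nra.
  by rewrite -(@ler_pXn2r _ 2)// ?nnegrE//; lra.
have pr0 : 0 <= phi * r by rewrite mulr_ge0.
have pr1 : phi * r <= r / 100 by nra.
have /ler_normlP[w1 w2] := Wb; have /ler_normlP[d1 d2] := hD.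
have I2 : F / 2 <= I by rewrite IE; lra.
have I0 : 0 < I by lra.
have u0 := normr_ge0 u; have M0 := normr_ge0 M.
have uu : u ^+ 2 = `|u| ^+ 2 by rewrite real_normK ?num_real.
have MM : M ^+ 2 = `|M| ^+ 2 by rewrite real_normK ?num_real.
have M4 : M ^+ 4 = `|M| ^+ 4 by rewrite !(exprM _ 2 2) MM.
move: uu MM M4 u0 M0 foc hu; set U := `|u|; set m := `|M| => uu MM M4 u0 m0 foc hu.
rewrite uu MM M4; rewrite uu in foc.
(* The a priori bound on [u] makes the quadratic remainder at most half of [U * I], since
   [I >= F / 2]; a first bound [U <= 4 m / F] follows. *)
have UQ : U * Q <= F / 4.
  apply: (@le_trans _ _ (4 * e * l * (K * (phi * r) / e))).
    by apply: ler_pM.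
  have -> : 4 * e * l * (K * (phi * r) / e) = 4 * K * (l * (phi * r)).
    by field; rewrite gt_eqF.
  by lra.
have U1 : U <= 4 * m / F.
  rewrite ler_pdivlMr//.
  have : U * I <= m + U * (U * Q) by move: foc; congr (_ <= _ + _); ring.
  have : U * (U * Q) <= U * (F / 4) by rewrite ler_wpM2l.
  have : U * (F / 2) <= U * I by rewrite ler_wpM2l.
  by lra.
(* The first bound is fed back into the quadratic term, which becomes a correction [G] to the
   leading term [m / I]. *)
have U2 : U <= m / I + 32 * (m ^+ 2 * Q) / F ^+ 3.
  have h1 : U <= (m + (4 * m / F) ^+ 2 * Q) / I.
    rewrite ler_pdivlMr//; apply: (le_trans foc); rewrite lerD2l ler_wpM2r//.
    by rewrite ler_sqr ?nnegrE// divr_ge0// ?mulr_ge0// ltW.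
  apply: (le_trans h1); rewrite mulrDl lerD2l.
  rewrite ler_pdivrMr//.
  have -> : (4 * m / F) ^+ 2 * Q = 32 * (m ^+ 2 * Q) / F ^+ 3 * (F / 2).
    by field; rewrite gt_eqF.
  by rewrite ler_wpM2l// !mulr_ge0 ?invr_ge0 ?exprn_ge0// ltW.
set A := m / I in U2.
have A0 : 0 <= A by rewrite divr_ge0// ltW.
have A2 : A <= 2 * m / F.
  rewrite ler_pdivrMr// -mulrA mulrC mulrA; apply: (@le_trans _ _ (F / 2 * (2 * m / F))).
    by rewrite le_eqVlt; apply/orP; left; apply/eqP; field; rewrite gt_eqF.
  by rewrite ler_wpM2r// divr_ge0 ?mulr_ge0// ltW.
set G := 32 * (m ^+ 2 * Q) / F ^+ 3 in U2.
have G0 : 0 <= G by rewrite !mulr_ge0 ?invr_ge0 ?exprn_ge0// ltW.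
set i := F^-1; set cc := c^-1.
have i0 : 0 < i by rewrite invr_gt0.
have ic : i <= cc by rewrite lef_pV2.
have cc1 : 1 <= cc by rewrite invf_ge1.
have cc0 : 0 <= cc by exact: le_trans ler01 cc1.
have i0' := ltW i0.
have X0 : 0 <= phi * r by [].
have m2i : 0 <= m ^+ 2 * i ^+ 2 by rewrite mulr_ge0 ?exprn_ge0// ltW.
have m4e : 0 <= m ^+ 4 / e ^+ 2 by rewrite mulr_ge0 ?invr_ge0 ?exprn_ge0// ltW.
have i2c : i ^+ 2 <= cc ^+ 2 by apply: lerXn2r; rewrite ?nnegrE.
have i4c : i ^+ 4 <= cc ^+ 6.
  apply: (@le_trans _ _ (cc ^+ 4)); first by apply: lerXn2r; rewrite ?nnegrE.
  by apply: ler_weXn2l.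
have i6c : i ^+ 6 <= cc ^+ 6 by apply: lerXn2r; rewrite ?nnegrE.
(* With [I / F = 1 + x], the term [x^2] only involves the squares of [Wa], [Dl] and [r], all of
   order [(phi + r) r], so only the linear part of [x] is kept exactly. *)
have T1 : A ^+ 2 <= m ^+ 2 * i ^+ 2 *
    (1 + 2 * (r * i) - 2 * (Wa * i) + 100 * cc ^+ 2 * ((phi + r) * r)).
  pose x := (Wa + Dl - r) * i.
  have IF : I * i = 1 + x by rewrite IE /x /i; field; rewrite gt_eqF.
  have x8 : - (1 / 8) <= x <= 1 / 8.
    rewrite /x ler_pdivlMr// ler_pdivrMr//.
    by clear - w1 w2 d1 d2 rF pr1 r0 F0; apply/andP; split; lra.
  have /andP[xa xb] := x8.
  have -> : A ^+ 2 = m ^+ 2 * i ^+ 2 * ((1 + x) ^+ 2)^-1.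
    rewrite -IF /A /i; field; rewrite !gt_eqF//.
  rewrite ler_wpM2l//.
  have x1 : 0 < (1 + x) ^+ 2 by rewrite exprn_gt0//; clear - xa; lra.
  apply: (@le_trans _ _ (1 - 2 * x + 4 * x ^+ 2)).
    rewrite -div1r ler_pdivrMr//.
    have -> : (1 - 2 * x + 4 * x ^+ 2) * (1 + x) ^+ 2 = 1 + x ^+ 2 * (1 + 6 * x + 4 * x ^+ 2) by ring.
    by rewrite lerDl mulr_ge0 ?sqr_ge0//; have := sqr_ge0 x; clear - xa; lra.
  have h1 : - 2 * x <= 2 * (r * i) - 2 * (Wa * i) + 22 * ((phi * r) * i).
    have Di : - Dl * i <= 11 * (phi * r) * i by rewrite ler_wpM2r.
    by rewrite /x; clear - Di; lra.
  have h2 : x ^+ 2 <= 3 * ((Wa ^+ 2 + Dl ^+ 2 + r ^+ 2) * i ^+ 2).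
    rewrite /x exprMn mulrA ler_wpM2r ?exprn_ge0 ?(ltW i0)//.
    rewrite -subr_ge0 (_ : _ - _ = (Wa - Dl) ^+ 2 + (Wa + r) ^+ 2 + (Dl + r) ^+ 2); last by ring.
    by rewrite !addr_ge0// sqr_ge0.
  have h3 : Wa ^+ 2 * i ^+ 2 <= cc ^+ 2 * (phi * r) / 100.
    apply: (@le_trans _ _ (phi ^+ 2 * (F * r) * i ^+ 2)); first by rewrite ler_wpM2r ?exprn_ge0 ?(ltW i0).
    have -> : phi ^+ 2 * (F * r) * i ^+ 2 = phi * (phi * r) * i by rewrite /i; field; rewrite gt_eqF.
    have -> : cc ^+ 2 * (phi * r) / 100 = (1 / 100 * (phi * r)) * cc ^+ 2 by field.
    apply: ler_pM => //; [exact: mulr_ge0|exact: ler_wpM2r|].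
    by apply: (le_trans ic); rewrite expr2; exact: ler_peMl cc0 cc1.
  have h4 : Dl ^+ 2 * i ^+ 2 <= 2 * cc ^+ 2 * (phi * r).
    have hd : Dl ^+ 2 <= 2 * (phi * r).
      have : Dl ^+ 2 <= (11 * (phi * r)) ^+ 2.
        by rewrite -[Dl ^+ 2](real_normK (num_real _)) ler_sqr ?nnegrE ?mulr_ge0.
      move=> /le_trans; apply; rewrite expr2.
      have : phi * r <= 1 / 100 by apply: (le_trans pr1); rewrite ler_wpM2r.
      by move: (phi * r) X0 => X X0 X1; clear - X0 X1; nra.
    have -> : 2 * cc ^+ 2 * (phi * r) = (2 * (phi * r)) * cc ^+ 2 by ring.
    by apply: ler_pM => //; rewrite ?sqr_ge0.
  have h5 : r ^+ 2 * i ^+ 2 <= r ^+ 2 * cc ^+ 2 by rewrite ler_wpM2l ?sqr_ge0.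
  have h6 : phi * r * i <= phi * r * cc ^+ 2.
    by rewrite ler_wpM2l//; apply: (le_trans ic); rewrite expr2; exact: ler_peMl cc0 cc1.
  have h7 : 0 <= cc ^+ 2 * (phi * r) by rewrite mulr_ge0// sqr_ge0.
  have h8 : 0 <= r ^+ 2 * cc ^+ 2 by rewrite mulr_ge0// sqr_ge0.
  have -> : 100 * cc ^+ 2 * ((phi + r) * r) = 100 * (cc ^+ 2 * (phi * r)) + 100 * (r ^+ 2 * cc ^+ 2) by ring.
  move: h1 h2 h3 h4 h5 h6 h7 h8; clear; clearbody x i cc.
  by rewrite (mulrC (phi * r) (cc ^+ 2)); lra.
have QK : Q <= K * (phi * r) / e by [].
have KX : 0 <= K * (phi * r) by rewrite mulr_ge0.
have T2 : 2 * (A * G) <= m ^+ 2 * i ^+ 2 * (64 * K * cc ^+ 2 * (phi * r)) +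
    64 * K * cc ^+ 6 * (phi * r) * (m ^+ 4 / e ^+ 2).
  apply: (@le_trans _ _ (2 * (2 * m / F * (32 * (m ^+ 2 * (K * (phi * r) / e)) / F ^+ 3)))).
    rewrite ler_wpM2l//; apply: ler_pM => //.
    by rewrite /G ler_wpM2r ?invr_ge0 ?exprn_ge0 ?(ltW F0)// ler_wpM2l// ler_wpM2l ?exprn_ge0.
  (* As [m] is of order [e], both terms on the right have order [e^2]; their expectations are second
     and fourth moments. *)
  have am : 2 * (m ^+ 3 / e) <= m ^+ 2 + m ^+ 4 / e ^+ 2.
    rewrite -subr_ge0 (_ : _ - _ = (m - m ^+ 2 / e) ^+ 2) ?sqr_ge0//.
    by field; rewrite gt_eqF.
  have -> : 2 * (2 * m / F * (32 * (m ^+ 2 * (K * (phi * r) / e)) / F ^+ 3)) =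
    64 * (K * (phi * r)) * i ^+ 4 * (2 * (m ^+ 3 / e)).
    by rewrite /i; field; rewrite !gt_eqF.
  apply: (@le_trans _ _ (64 * (K * (phi * r)) * i ^+ 4 * (m ^+ 2 + m ^+ 4 / e ^+ 2))).
    by apply: ler_wpM2l => //; nneg.
  rewrite mulrDr lerD//.
    have -> : 64 * (K * (phi * r)) * i ^+ 4 * m ^+ 2 = (m ^+ 2 * i ^+ 2 * (64 * (K * (phi * r)))) * i ^+ 2 by ring.
    have -> : m ^+ 2 * i ^+ 2 * (64 * K * cc ^+ 2 * (phi * r)) =
      (m ^+ 2 * i ^+ 2 * (64 * (K * (phi * r)))) * cc ^+ 2 by ring.
    by apply: ler_wpM2l => //; nneg.
  rewrite ler_wpM2r//.
  have -> : 64 * K * cc ^+ 6 * (phi * r) = 64 * (K * (phi * r)) * cc ^+ 6 by ring.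
  by apply: ler_wpM2l => //; nneg.
have T3 : G ^+ 2 <= 1024 * K ^+ 2 * cc ^+ 6 * (phi * r) * (m ^+ 4 / e ^+ 2).
  apply: (@le_trans _ _ ((32 * (m ^+ 2 * (K * (phi * r) / e)) / F ^+ 3) ^+ 2)).
    rewrite ler_sqr ?nnegrE//; last first.
      rewrite (le_trans G0)// /G ler_wpM2r ?invr_ge0 ?exprn_ge0 ?(ltW F0)// ler_wpM2l//.
      by rewrite ler_wpM2l ?exprn_ge0.
    by rewrite /G ler_wpM2r ?invr_ge0 ?exprn_ge0 ?(ltW F0)// ler_wpM2l// ler_wpM2l ?exprn_ge0.
  have -> : (32 * (m ^+ 2 * (K * (phi * r) / e)) / F ^+ 3) ^+ 2 =
    (1024 * K ^+ 2 * (phi * r) * (m ^+ 4 / e ^+ 2)) * (i ^+ 6 * (phi * r)).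
    by rewrite /i; field; rewrite !gt_eqF.
  have -> : 1024 * K ^+ 2 * cc ^+ 6 * (phi * r) * (m ^+ 4 / e ^+ 2) =
    (1024 * K ^+ 2 * (phi * r) * (m ^+ 4 / e ^+ 2)) * (cc ^+ 6 * 1) by ring.
  apply: ler_wpM2l; first by nneg.
  by apply: ler_pM => //; rewrite ?exprn_ge0 ?(ltW i0)//; lra.
have U3 : U ^+ 2 <= A ^+ 2 + 2 * (A * G) + G ^+ 2.
  rewrite (_ : _ + _ + _ = (A + G) ^+ 2); last by ring.
  by rewrite ler_sqr ?nnegrE// addr_ge0.
apply: (le_trans U3); apply: (le_trans (lerD (lerD T1 T2) T3)).
have -> : m ^+ 2 / F ^+ 2 = m ^+ 2 * i ^+ 2 by rewrite /i exprVn.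
have -> : (100 + 64 * K) / c ^+ 2 = (100 + 64 * K) * cc ^+ 2 by rewrite /cc exprVn.
have -> : (64 * K + 1024 * K ^+ 2) / c ^+ 6 = (64 * K + 1024 * K ^+ 2) * cc ^+ 6 by rewrite /cc exprVn.
have rest : 0 <= m ^+ 2 * i ^+ 2 * (64 * K * cc ^+ 2 * r ^+ 2).
  by nneg.
rewrite -subr_ge0 [X in 0 <= X](_ : _ = m ^+ 2 * i ^+ 2 * (64 * K * cc ^+ 2 * r ^+ 2))//.
by ring.
Qed.
End final_algebra.

(** * The first-order condition *)

Section trigonometry.
Context {R : realType}.

Lemma ge0_sin_le (x : R) : 0 <= x -> sin x <= x.
Proof.
rewrite le_eqVlt => /predU1P[<-|x0]; first by rewrite sin0.
have dsin y : y \in `]0, x[ -> is_derive y 1 (@sin R) (cos y) by move=> _; exact: is_derive_sin.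
have [c _] := MVT_segment (ltW x0) dsin (continuous_subspaceT (@continuous_sin R)).
rewrite sin0 !subr0 => ->.
by rewrite ger_pMl// cos_le1.
Qed.

Lemma norm_sin_le (x : R) : `|sin x| <= `|x|.
Proof.
have pos (y : R) : 0 <= y -> `|sin y| <= y.
  move=> y0; apply/ler_normlP; split; last exact: ge0_sin_le.
  have [y1|y1] := leP y pi.
    by rewrite (@le_trans _ _ 0)// oppr_le0 sin_ge0_pi// y0.
  by have := sin_geN1 y; have := pi_ge2 R; lra.
have [x0|x0] := lerP 0 x; first by rewrite (ger0_norm x0) pos.
by rewrite (ltr0_norm x0) -[`|sin x|]normrN -sinN pos// oppr_ge0 ltW.
Qed.

Lemma sin_sqr_le (x : R) : sin x ^+ 2 <= x ^+ 2.
Proof.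
by rewrite -[leLHS](real_normK (num_real _)) -[leRHS](real_normK (num_real _))
  ler_sqr ?nnegrE// norm_sin_le.
Qed.

Lemma one_sub_cos_le (x : R) : 1 - cos x <= x ^+ 2 / 2.
Proof.
have h := sin_sqr_le (x / 2).
have -> : cos x = 1 - 2 * sin (x / 2) ^+ 2.
  have {1}-> : x = (x / 2) *+ 2 by rewrite -mulr_natr divfK.
  by have := cos2Dsin2 (x / 2); rewrite cos_mulr2n mulr2n; lra.
have -> : x ^+ 2 / 2 = 2 * (x / 2) ^+ 2 by field.
by lra.
Qed.

Lemma sin_cube (y : R) : 0 <= y -> 0 <= y - sin y <= y ^+ 3 / 2.
Proof.
move=> y0; rewrite subr_ge0 ge0_sin_le//=.
move: y0; rewrite le_eqVlt => /predU1P[<-|y0]; first by rewrite sin0 subrr expr0n/= mul0r.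
have dsin z : z \in `]0, y[ -> is_derive z 1 (@sin R) (cos z) by move=> _; exact: is_derive_sin.
have [c] := MVT_segment (ltW y0) dsin (continuous_subspaceT (@continuous_sin R)).
rewrite sin0 !subr0 in_itv/= => /andP[c0 cy] ->.
have -> : y - cos c * y = (1 - cos c) * y by ring.
have -> : y ^+ 3 / 2 = (y ^+ 2 / 2) * y by field.
rewrite ler_wpM2r ?(ltW y0)//; apply: (le_trans (one_sub_cos_le c)).
by rewrite ler_wpM2r// ler_sqr ?nnegrE// ltW.
Qed.

Lemma sin_cos_cube (y : R) : 0 <= y -> `|sin y * cos y - y| <= y ^+ 3.
Proof.
move=> y0; have /andP[s1 s2] := sin_cube y0.
have c1 := one_sub_cos_le y; have c2 := cos_le1 y.
have s3 := norm_sin_le y; rewrite (ger0_norm y0) in s3.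
have -> : sin y * cos y - y = - (sin y * (1 - cos y)) - (y - sin y) by ring.
apply: (le_trans (ler_normB _ _)); rewrite normrN normrM.
rewrite (ger0_norm s1) (@ger0_norm _ (1 - cos y)) ?subr_ge0//.
have : `|sin y| * (1 - cos y) <= y * (y ^+ 2 / 2) by apply: ler_pM => //; rewrite subr_ge0.
have -> : y * (y ^+ 2 / 2) = y ^+ 3 / 2 by field.
by lra.
Qed.

(** Derivative in [u] of [(a cos (om u) + b sin (om u))^2 / 2]. *)
Definition score (a b om u : R) : R :=
  om * ((a * cos (om * u) + b * sin (om * u)) * (b * cos (om * u) - a * sin (om * u))).

(** Expansion at 0 with slope [- om^2 (a^2 - b^2)]. The error in [a b] comes from [sin^2], that in
    [a^2 - b^2] from [sin y cos y - y]. An upper bound for [u >= 0] is enough, because a reflection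
    treats the other sign. *)
Lemma score_le (a b om u : R) : 0 <= om -> 0 <= u ->
  score a b om u <= om * (a * b) - u * (om ^+ 2 * (a ^+ 2 - b ^+ 2)) +
    u ^+ 2 * (2 * (om ^+ 3 * `|a * b|) + u * (om ^+ 4 * (a ^+ 2 + b ^+ 2))).
Proof.
move=> om0 u0; rewrite /score; set y := om * u.
have y0 : 0 <= y by rewrite mulr_ge0.
set c := cos y; set s := sin y.
have cs : c ^+ 2 = 1 - s ^+ 2 by rewrite -(cos2Dsin2 y) -/c -/s; ring.
have -> : (a * c + b * s) * (b * c - a * s) =
    a * b - a * b * (2 * s ^+ 2) - (a ^+ 2 - b ^+ 2) * y - (a ^+ 2 - b ^+ 2) * (s * c - y).
  have -> : (a * c + b * s) * (b * c - a * s) =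
    a * b * (c ^+ 2) - a * b * s ^+ 2 - (a ^+ 2 - b ^+ 2) * (s * c) by ring.
  by rewrite cs; ring.
have h1 : - (a * b * (2 * s ^+ 2)) <= `|a * b| * (2 * y ^+ 2).
  rewrite -mulNr; apply: (@le_trans _ _ (`|a * b| * (2 * s ^+ 2))).
    by apply: ler_wpM2r; [nneg|rewrite -normrN ler_norm].
  by rewrite ler_wpM2l// ler_wpM2l// sin_sqr_le.
have h2 : - ((a ^+ 2 - b ^+ 2) * (s * c - y)) <= (a ^+ 2 + b ^+ 2) * y ^+ 3.
  rewrite -mulNr; apply: (le_trans (ler_norm _)); rewrite normrM.
  apply: ler_pM => //; last exact: sin_cos_cube.
  rewrite normrN; apply: (le_trans (ler_normB _ _)).
  by rewrite !ger0_norm// sqr_ge0.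
apply: (@le_trans _ _ (om * (a * b - (a ^+ 2 - b ^+ 2) * y + `|a * b| * (2 * y ^+ 2) + (a ^+ 2 + b ^+ 2) * y ^+ 3))).
  by rewrite ler_wpM2l//; move: h1 h2; lra.
by rewrite le_eqVlt; apply/orP; left; apply/eqP; rewrite /y; ring.
Qed.

Lemma scoreN (a b om u : R) : score a (- b) om (- u) = - score a b om u.
Proof. by rewrite /score mulrN cosN sinN; ring. Qed.

(** Negative [u] reduces to positive [u] by changing the signs of [u] and of all [b k]: the score is
    odd under this change, information and remainder are even. Only the sign of the derivative is
    assumed, so that the maximizer may be an endpoint of the search interval. *)
Lemma first_order_condition (s : seq nat) (h a b om : nat -> R) (u : R) :
  (forall k, 0 <= h k) -> (forall k, 0 <= om k) ->
  (0 < u -> 0 <= \sum_(k <- s) h k * score (a k) (b k) (om k) u) ->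
  (u < 0 -> \sum_(k <- s) h k * score (a k) (b k) (om k) u <= 0) ->
  `|u| * \sum_(k <- s) h k * (om k ^+ 2 * (a k ^+ 2 - b k ^+ 2)) <=
  `|\sum_(k <- s) h k * (om k * (a k * b k))| +
  u ^+ 2 * \sum_(k <- s) h k * (2 * (om k ^+ 3 * `|a k * b k|) +
     `|u| * (om k ^+ 4 * (a k ^+ 2 + b k ^+ 2))).
Proof.
move=> h0 om0.
have pos (b' : nat -> R) (v : R) : 0 <= v ->
    0 <= \sum_(k <- s) h k * score (a k) (b' k) (om k) v ->
    v * \sum_(k <- s) h k * (om k ^+ 2 * (a k ^+ 2 - b' k ^+ 2)) <=
    \sum_(k <- s) h k * (om k * (a k * b' k)) +
    v ^+ 2 * \sum_(k <- s) h k * (2 * (om k ^+ 3 * `|a k * b' k|) +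
     v * (om k ^+ 4 * (a k ^+ 2 + b' k ^+ 2))).
  move=> v0 sc.
  rewrite -subr_ge0; apply: (le_trans sc).
  rewrite !mulr_sumr -!big_split/= -sumrB; apply: ler_sum => k _.
  have := ler_wpM2l (h0 k) (score_le (a k) (b' k) (om0 k) v0).
  by move=> /le_trans; apply; rewrite le_eqVlt; apply/orP; left; apply/eqP; ring.
move=> hp hn; have [u0|u0|u0] := ltgtP 0 u.
- rewrite (gtr0_norm u0); apply: (le_trans (pos b u (ltW u0) (hp u0))).
  by rewrite lerD2r ler_norm.
- rewrite (ltr0_norm u0); have := pos (fun k => - b k) (- u); rewrite oppr_ge0 => /(_ (ltW u0)).
  under eq_bigr do rewrite scoreN mulrN.
  rewrite sumrN oppr_ge0 => /(_ (hn u0)).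
  under eq_bigr do rewrite sqrrN.
  move=> /le_trans; apply; rewrite sqrrN; apply: lerD.
    under eq_bigr do rewrite !mulrN.
    by rewrite sumrN -normrN ler_norm.
  rewrite ler_wpM2l ?sqr_ge0//; apply: ler_sum => k _.
  by rewrite sqrrN mulrN normrN.
- by rewrite -u0 normr0 mul0r expr0n/= mul0r addr0.
Qed.

(** One-sided version of Fermat's rule: difference quotients taken on the admissible side are
    nonnegative, even if [t] is the right end of the domain of maximization. *)
Lemma left_max_derive (f : R -> R) (a t D : R) : is_derive t 1 f D -> a < t ->
  (forall x, a <= x <= t -> f x <= f t) -> 0 <= D.
Proof.
move=> [df <-] at_ fmax.
have /cvg_ex[l hl] := df; rewrite /derive (cvg_lim _ hl)//.
have hl' := cvg_dnbhs_at_left hl.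
apply: (cvgr_to_ge hl'); near=> h.
have h0 : h < 0 by near: h; exact: nbhs_left_lt.
have ha : a - t < h by near: h; apply: nbhs_left_gt; rewrite subr_lt0.
rewrite /= /GRing.scale/= mulr1; apply: mulr_le0; first by rewrite invr_le0 ltW.
by rewrite subr_le0 fmax//; apply/andP; split; lra.
Unshelve. all: by end_near. Qed.

Lemma right_max_derive (f : R -> R) (b t D : R) : is_derive t 1 f D -> t < b ->
  (forall x, t <= x <= b -> f x <= f t) -> D <= 0.
Proof.
move=> [df <-] at_ fmax.
have /cvg_ex[l hl] := df; rewrite /derive (cvg_lim _ hl)//.
have hl' := cvg_dnbhs_at_right hl.
apply: (cvgr_to_le hl'); near=> h.
have h0 : 0 < h by near: h; exact: nbhs_right_gt.
have ha : h < b - t by near: h; apply: nbhs_right_lt; rewrite subr_gt0.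
rewrite /= /GRing.scale/= mulr1; apply: mulr_ge0_le0; first by rewrite invr_ge0 ltW.
by rewrite subr_le0 fmax//; apply/andP; split; lra.
Unshelve. all: by end_near. Qed.

Lemma is_derive_Phi (N : nat) (x xs h : nat -> R) (t : R) :
  is_derive t 1 (Phi N x xs h) (\sum_(1 <= k < N.+1) h k * ((2 * pi * k%:R) *
    ((x k * cos (2 * pi * k%:R * t) + xs k * sin (2 * pi * k%:R * t)) *
     (xs k * cos (2 * pi * k%:R * t) - x k * sin (2 * pi * k%:R * t))))).
Proof.
elim: N => [|N ih].
  rewrite big_nil (_ : Phi _ _ _ _ = cst 0); first exact: is_derive_cst.
  by apply/funext => u; rewrite /Phi big_nil mulr0.
pose om : R := 2 * pi * N.+1%:R.
pose g u := 1 / 2 * (h N.+1 * (x N.+1 * cos (om * u) + xs N.+1 * sin (om * u)) ^+ 2).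
have -> : Phi N.+1 x xs h = Phi N x xs h \+ g.
  by apply/funext => u; rewrite /Phi /g big_nat_recr//= mulrDr.
rewrite big_nat_recr//=.
have dl : is_derive t 1 (fun u => om * u) om.
  by apply: is_derive_eq; rewrite /GRing.scale/= mulr1.
have dc : is_derive t 1 (fun u => cos (om * u)) (- sin (om * t) * om).
  by have := @is_derive1_comp _ (@cos R) (fun u => om * u) t _ _ (is_derive_cos (om * t)) dl.
have ds : is_derive t 1 (fun u => sin (om * u)) (cos (om * t) * om).
  by have := @is_derive1_comp _ (@sin R) (fun u => om * u) t _ _ (is_derive_sin (om * t)) dl.
have dg : is_derive t 1 g (h N.+1 * (om * ((x N.+1 * cos (om * t) + xs N.+1 * sin (om * t)) *
     (xs N.+1 * cos (om * t) - x N.+1 * sin (om * t))))).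
  rewrite /g; apply: is_derive_eq.
  by rewrite /GRing.scale/=; field.
exact: is_deriveD.
Qed.

End trigonometry.

(** * The block model in rotated coordinates *)

Section blocks.
Context {R : realType}.
Variables (kap : nat -> nat) (J N : nat).
Hypothesis kap0 : kap 0%N = 1%N.
Hypothesis kapS : forall j, (j < J)%N -> (kap j < kap j.+1)%N.
Hypothesis kapJ : kap J = N.+1.

Definition bsum (g : nat -> R) (j : nat) : R := \sum_(kap j <= k < kap j.+1) g k.

(** Written as a sum over all blocks, at most one term being nonzero, to coincide with the shape of
    [hstar] and [hJS]. *)
Definition spread (w : nat -> R) (k : nat) : R :=
  \sum_(j < J) if (kap j <= k < kap j.+1)%N then w j else 0.

Lemma kap_le i j : (i <= j <= J)%N -> (kap i <= kap j)%N.
Proof.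
elim: j => [|j ih] /andP[ij jJ]; first by move: ij; rewrite leqn0 => /eqP ->.
move: ij; rewrite leq_eqVlt => /predU1P[->//|]; rewrite ltnS => ij.
by apply: (leq_trans (ih _)); rewrite ?ij ?(ltnW jJ)// ltnW// kapS.
Qed.

Lemma kap_ge1 j : (j <= J)%N -> (0 < kap j)%N.
Proof. by move=> jJ; rewrite -kap0 kap_le. Qed.

Lemma block_range j k : (j < J)%N -> (kap j <= k < kap j.+1)%N -> (0 < k <= N)%N.
Proof.
move=> jJ /andP[k1 k2]; rewrite (leq_trans (kap_ge1 (ltnW jJ)) k1)/=.
by rewrite -ltnS -kapJ (leq_trans k2)// kap_le// jJ/= leqnn.
Qed.

Lemma sum_blocks (g : nat -> R) : \sum_(1 <= k < N.+1) g k = \sum_(j < J) bsum g j.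
Proof.
rewrite -kapJ -kap0.
suff H j : (j <= J)%N -> \sum_(kap 0 <= k < kap j) g k = \sum_(i < j) bsum g i.
  exact: H.
elim: j => [|j ih] jJ; first by rewrite big_geq// big_ord0.
rewrite big_ord_recr/= -ih ?(ltnW jJ)//.
by rewrite -big_cat_nat//= ?kap_le ?(ltnW jJ)// ltnW// kapS.
Qed.

Lemma spreadE w j k : (j < J)%N -> (kap j <= k < kap j.+1)%N -> spread w k = w j.
Proof.
move=> jJ /andP[k1 k2]; rewrite /spread (bigD1 (Ordinal jJ))//= k1 k2/= big1 ?addr0// => i ij.
case: ifP => // /andP[i1 i2].
have {}ij : (i : nat) != j by apply: contra ij => /eqP ij; apply/eqP/val_inj.
move: ij; rewrite neq_ltn => /orP[ij|ji].
- have : (kap i.+1 <= kap j)%N by rewrite kap_le// ij ltnW.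
  by move=> /(leq_trans i2); rewrite ltnNge k1.
- have : (kap j.+1 <= kap i)%N by rewrite kap_le// ji ltnW.
  by move=> /(leq_trans k2); rewrite ltnNge i1.
Qed.

Lemma spread_ge0 w k : (forall j, (j < J)%N -> 0 <= w j) -> 0 <= spread w k.
Proof. by move=> w0; apply: sumr_ge0 => j _; case: ifP => // _; exact: w0. Qed.

Lemma eq_bsum g1 g2 j : (forall k, (kap j <= k < kap j.+1)%N -> g1 k = g2 k) ->
  bsum g1 j = bsum g2 j.
Proof. by move=> h; apply: eq_big_nat => k /h. Qed.

Lemma sum_spread w g : \sum_(1 <= k < N.+1) spread w k * g k = \sum_(j < J) w j * bsum g j.
Proof.
rewrite sum_blocks; apply: eq_bigr => j _; rewrite /bsum mulr_sumr.
by apply: eq_big_nat => k kj; rewrite (spreadE _ (ltn_ord j) kj).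
Qed.

Lemma bsumD g1 g2 j : bsum (fun k => g1 k + g2 k) j = bsum g1 j + bsum g2 j.
Proof. exact: big_split. Qed.

Lemma bsumZ c g j : bsum (fun k => c * g k) j = c * bsum g j.
Proof. by rewrite /bsum mulr_sumr. Qed.

Lemma bsum_ge0 g j : (forall k, 0 <= g k) -> 0 <= bsum g j.
Proof. by move=> g0; exact: sumr_ge0. Qed.

Lemma ler_bsum g1 g2 j : (forall k, (kap j <= k < kap j.+1)%N -> g1 k <= g2 k) ->
  bsum g1 j <= bsum g2 j.
Proof. by move=> h; rewrite /bsum; apply: ler_sum_nat => k /h. Qed.

End blocks.

(** * Block statistics, the good event and the pathwise error bound *)

Section block_model.
Context {R : realType}.
Notation T := (measurableTypeR R).
Implicit Types v : nat -> T * T.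

Definition om (k : nat) : R := 2 * pi * k%:R.

Lemma om_ge0 k : 0 <= om k.
Proof. by rewrite /om; have ? := pi_ge0 R; nneg. Qed.

Variables (e : R) (f : nat -> R) (kap : nat -> nat) (ph : nat -> R).
Local Notation bsm := (@bsum R kap).

Definition sigF j := bsm (fun k => om k ^+ 2 * f k ^+ 2) j.
Definition noise j := e ^+ 2 * bsm (fun k => om k ^+ 2) j.
Definition av v k := f k + e * (v k).1.
Definition bv v k := e * (v k).2.
Definition Lb v j := 2 * e * bsm (fun k => om k ^+ 2 * (f k * (v k).1)) j.
Definition Qb v j := e ^+ 2 * bsm (fun k => om k ^+ 2 * ((v k).1 ^+ 2 + (v k).2 ^+ 2 - 2)) j.
Definition Db v j := e ^+ 2 * bsm (fun k => om k ^+ 2 * ((v k).1 ^+ 2 - (v k).2 ^+ 2)) j.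
Definition energy v j := bsm (fun k => om k ^+ 2 * (av v k ^+ 2 + bv v k ^+ 2)) j.

Lemma energyE v j : energy v j = sigF j + 2 * noise j + Lb v j + Qb v j.
Proof.
rewrite /energy /sigF /noise /Lb /Qb !(mulrCA 2) -!bsumZ -!bsumD.
by apply: eq_bsum => k _; rewrite /av /bv; ring.
Qed.

Lemma informationE v j : bsm (fun k => om k ^+ 2 * (av v k ^+ 2 - bv v k ^+ 2)) j =
  sigF j + Lb v j + Db v j.
Proof.
rewrite /sigF /Lb /Db -!bsumZ -!bsumD.
by apply: eq_bsum => k _; rewrite /av /bv; ring.
Qed.

Lemma noise_energyE v j : bsm (fun k => om k ^+ 2 * bv v k ^+ 2) j =
  noise j + (Qb v j - Db v j) / 2.
Proof.
rewrite (_ : (Qb v j - Db v j) / 2 = 2^-1 * Qb v j + - 2^-1 * Db v j); last by ring.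
rewrite /noise /Qb /Db -!bsumZ -!bsumD.
by apply: eq_bsum => k _; rewrite /bv; field.
Qed.

Definition stein v j := stein_weight (noise j) (ph j) (energy v j).
Definition oracle j := oracle_weight (sigF j) (noise j).

Variables (J N : nat) (l phi tail FM : R).
Hypothesis e0 : 0 < e.
Hypothesis kap0 : kap 0%N = 1%N.
Hypothesis kapS : forall j, (j < J)%N -> (kap j < kap j.+1)%N.
Hypothesis kapJ : kap J = N.+1.
Hypothesis l1 : 1 <= l.
Hypothesis phi0 : 0 <= phi.
Hypothesis phi1 : phi <= 1 / 100.
Hypothesis ph0 : forall j, (j < J)%N -> 0 < ph j <= phi.
Hypothesis noise1 : forall j, (j < J)%N -> noise j <= 1.
(** Here [l] stands for [log (1/e)]: the squared penalty [24 log (e^-5) / T_j] equals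
    [120 l / T_j]. *)
Hypothesis phT : forall j, (j < J)%N -> ph j ^+ 2 * (kap j.+1 - kap j)%N%:R = 120 * l.
Hypothesis omT : forall j k, (j < J)%N -> (kap j <= k < kap j.+1)%N ->
  e ^+ 2 * om k ^+ 2 * (kap j.+1 - kap j)%N%:R <= 3 * noise j.
Hypothesis tail0 : 0 <= tail.

(** [tail] stands for the signal beyond the last block. No filter sees it, so it enters the total
    energy and the oracle risk alike and cancels in their difference. *)
Definition Ftot := tail + \sum_(j < J) sigF j.
Definition orisk := tail + \sum_(j < J) oracle j * noise j.
Hypothesis FtotM : Ftot <= FM.

Lemma sigF_ge0 j : 0 <= sigF j.
Proof. by apply: bsum_ge0 => k; rewrite mulr_ge0// sqr_ge0. Qed.

Lemma noise_gt0 j : (j < J)%N -> 0 < noise j.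
Proof.
move=> jJ; rewrite /noise mulr_gt0 ?exprn_gt0// /bsum big_ltn ?kapS//.
rewrite ltr_wpDr ?sumr_ge0// => [k _|]; first exact: sqr_ge0.
rewrite exprn_gt0// /om !mulr_gt0 ?pi_gt0// ltr0n.
exact: (kap_ge1 kap0 kapS (ltnW jJ)).
Qed.

(** In a long block a single frequency carries at most a fraction [ph^2 / l] of the block noise;
    this pays for the extra powers of [om] in the Taylor remainder. *)
Lemma om_small j k : (j < J)%N -> (kap j <= k < kap j.+1)%N ->
  e ^+ 2 * om k ^+ 2 * l <= ph j ^+ 2 * noise j.
Proof.
move=> jJ kj; have := ler_wpM2l (sqr_ge0 (ph j)) (omT jJ kj); have := phT jJ.
set t := (kap j.+1 - kap j)%N%:R => E h.
have : e ^+ 2 * om k ^+ 2 * (ph j ^+ 2 * t) <= 3 * (ph j ^+ 2 * noise j).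
  by move: h; congr (_ <= _); ring.
rewrite E; have : 0 <= ph j ^+ 2 * noise j.
  by have ? := ltW (noise_gt0 jJ); nneg.
by move: (ph j ^+ 2 * noise j) (e ^+ 2 * om k ^+ 2) => x y; lra.
Qed.

Definition good v := forall j, (j < J)%N ->
  [/\ Lb v j ^+ 2 <= ph j ^+ 2 * (sigF j * noise j),
      - (ph j * noise j) <= Qb v j <= 19 / 20 * (ph j * noise j) &
      - (ph j * noise j) <= Db v j <= ph j * noise j].

Lemma good_blockP v j : good v -> (j < J)%N ->
  good_block (sigF j) (noise j) (ph j) (Lb v j) (Qb v j) (Db v j).
Proof.
move=> gv jJ; have [g1 g2 g3] := gv _ jJ; have /andP[p0 p1] := ph0 jJ.
split => //; [exact: sigF_ge0|exact: noise_gt0|exact: ltW|exact: le_trans p1 phi1].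
Qed.

Lemma oracle_ge0 j : (j < J)%N -> 0 <= oracle j.
Proof. by move=> jJ; apply: oracle_weight_ge0; [exact: sigF_ge0|exact: noise_gt0]. Qed.

Lemma oracle_le1 j : (j < J)%N -> oracle j <= 1.
Proof. by move=> jJ; apply: oracle_weight_le1; [exact: sigF_ge0|exact: noise_gt0]. Qed.

Lemma oracleE j : (j < J)%N -> oracle j * (sigF j + noise j) = sigF j.
Proof. by move=> jJ; apply: oracle_weightE; [exact: sigF_ge0|exact: noise_gt0]. Qed.

Lemma stein_ge0 v j : 0 <= stein v j.
Proof. by rewrite /stein /stein_weight le_max lexx. Qed.

Lemma Ftot_orisk : Ftot - orisk = \sum_(j < J) oracle j * sigF j.
Proof.
rewrite /Ftot /orisk opprD addrACA subrr add0r -sumrB; apply: eq_bigr => j _.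
by have := oracleE (ltn_ord j); lra.
Qed.

Lemma sigF_le j : (j < J)%N -> sigF j <= Ftot.
Proof.
move=> jJ; rewrite /Ftot (bigD1 (Ordinal jJ))//= addrCA lerDl addr_ge0// sumr_ge0// => i _.
exact: sigF_ge0.
Qed.

Definition Wa v := \sum_(j < J) oracle j * Lb v j.
Definition weight v k := spread kap J (stein v) k.
Definition mk k v := weight v k * (om k * (av v k * bv v k)).
Definition Mf v := \sum_(1 <= k < N.+1) mk k v.
Definition Info v := \sum_(1 <= k < N.+1) weight v k * (om k ^+ 2 * (av v k ^+ 2 - bv v k ^+ 2)).
Definition Rem v (u : R) := \sum_(1 <= k < N.+1) weight v k *
  (2 * (om k ^+ 3 * `|av v k * bv v k|) + `|u| * (om k ^+ 4 * (av v k ^+ 2 + bv v k ^+ 2))).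

Lemma sum_oracle_noise : \sum_(j < J) oracle j * noise j <= orisk.
Proof. by rewrite /orisk lerDr. Qed.

(* Cauchy-Schwarz over the blocks, through AM-GM with the optimal parameter. *)
Lemma Wa_sqr v : good v -> 0 < orisk -> 0 < Ftot -> Wa v ^+ 2 <= phi ^+ 2 * (Ftot * orisk).
Proof.
move=> gv r0 Ft0.
have bnd (t : R) : 0 < t -> `|Wa v| <= phi / 2 * (t * Ftot + orisk / t).
  move=> t0; apply: (le_trans (ler_norm_sum _ _ _)).
  apply: (@le_trans _ _ (\sum_(j < J) phi / 2 * (t * sigF j + oracle j * noise j / t))).
    apply: ler_sum => j _; have jJ := ltn_ord j.
    have [gL _ _] := gv _ jJ; have /andP[p0 p1] := ph0 jJ.
    have o0 := oracle_ge0 jJ; have n0 := noise_gt0 jJ; have F0 := sigF_ge0 j.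
    have gL2 : (oracle j * Lb v j) ^+ 2 <= ph j ^+ 2 * (sigF j * (oracle j * noise j)).
      rewrite exprMn; apply: (@le_trans _ _ (oracle j * (ph j ^+ 2 * (sigF j * noise j)))).
        apply: ler_pM => //; rewrite ?sqr_ge0//.
        by rewrite expr2 ler_piMr// oracle_le1.
      by rewrite le_eqVlt; apply/orP; left; apply/eqP; ring.
    have on0 : 0 <= oracle j * noise j by rewrite mulr_ge0// ltW.
    have := sqr_bound_amgm (ltW p0) F0 on0 t0 gL2.
    move=> /le_trans; apply; rewrite ler_wpM2r ?ler_wpM2r// addr_ge0// mulr_ge0// ?invr_ge0// ltW//.
  rewrite -mulr_sumr big_split/= -mulr_sumr -mulr_suml ler_wpM2l ?divr_ge0//.
  have FF : \sum_(j < J) sigF j <= Ftot by rewrite /Ftot lerDr.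
  apply: lerD; first by rewrite ler_wpM2l// ltW.
  by rewrite ler_wpM2r ?invr_ge0 ?sum_oracle_noise// ltW.
pose t := Num.sqrt (orisk / Ftot).
have t0 : 0 < t by rewrite sqrtr_gt0 divr_gt0.
have t2 : t ^+ 2 = orisk / Ftot by rewrite sqr_sqrtr// ltW// divr_gt0.
have E : phi / 2 * (t * Ftot + orisk / t) = phi * (t * Ftot).
  have -> : orisk = t ^+ 2 * Ftot by rewrite t2 divfK// gt_eqF.
  by field; rewrite gt_eqF.
have := bnd _ t0; rewrite E => h.
have B0 : 0 <= phi * (t * Ftot) by rewrite !mulr_ge0// ltW.
rewrite -[leLHS](real_normK (num_real _)).
apply: (@le_trans _ _ ((phi * (t * Ftot)) ^+ 2)); first by rewrite ler_sqr ?nnegrE.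
rewrite !exprMn t2 le_eqVlt; apply/orP; left; apply/eqP.
by field; rewrite gt_eqF.
Qed.

(** Replacing the Stein weights by the oracle weights costs [O(phi)] times the oracle risk of each
    block, and so does [D]. Of the oracle-weighted information only the linear part [Wa] is too
    large for the remainder. *)
Lemma Info_split v : good v -> exists2 Dl, Info v = Ftot - orisk + Wa v + Dl &
  `|Dl| <= 11 * (phi * orisk).
Proof.
move=> gv.
exists (\sum_(j < J) ((stein v j - oracle j) * (sigF j + Lb v j + Db v j) + oracle j * Db v j)).
  rewrite /Info /weight (sum_spread kap0 kapS kapJ) Ftot_orisk /Wa -!big_split/=.
  apply: eq_bigr => j _; rewrite informationE; ring.
apply: (le_trans (ler_norm_sum _ _ _)).
apply: (@le_trans _ _ (\sum_(j < J) 11 * (phi * (oracle j * noise j)))).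
  apply: ler_sum => j _; have jJ := ltn_ord j.
  have gb := good_blockP gv jJ; have := block_information gb.
  rewrite -energyE -/(stein v j) -/(oracle j) => bi.
  have [_ _ /andP[d1 d2]] := gv _ jJ; have /andP[p0 p1] := ph0 jJ.
  have o0 := oracle_ge0 jJ; have n0 := noise_gt0 jJ.
  have on0 : 0 <= oracle j * noise j by rewrite mulr_ge0// ltW.
  have hD : `|oracle j * Db v j| <= ph j * (oracle j * noise j).
    rewrite normrM ger0_norm// mulrCA ler_wpM2l//; apply/ler_normlP; split; lra.
  have hp : ph j * (oracle j * noise j) <= phi * (oracle j * noise j) by rewrite ler_wpM2r.
  apply: (le_trans (ler_normD _ _)); lra.
by rewrite -mulr_sumr -mulr_sumr !ler_wpM2l// sum_oracle_noise.
Qed.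

(** The third power of [om] is reduced by AM-GM and the fourth by [|u| <= 4 e l], both through
    [om_small], to [om^2] with a factor [ph s / e]. The weight contributes [2 h], and [h s] is
    summed to the oracle risk. *)
Lemma Rem_le v u : good v -> `|u| <= 4 * e * l ->
  Rem v u <= (6 * FM + 14) * (phi * orisk) / e.
Proof.
move=> gv hu.
rewrite /Rem /weight (sum_spread kap0 kapS kapJ).
apply: (@le_trans _ _ (\sum_(j < J) (6 * FM + 14) * (phi * (oracle j * noise j)) / e)).
  apply: ler_sum => j _; have jJ := ltn_ord j.
  have gb := good_blockP gv jJ; have /andP[p0 p1] := ph0 jJ.
  have o0 := oracle_ge0 jJ; have n0 := noise_gt0 jJ; have n1 := noise1 jJ.
  have F0 := sigF_ge0 j; have FM1 := le_trans (sigF_le jJ) FtotM.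
  have hh2 := stein_le_oracle gb; rewrite -energyE -/(stein v j) -/(oracle j) in hh2.
  have en := block_energy gb; rewrite -energyE in en.
  have nn := block_noise gb; rewrite -noise_energyE in nn.
  have l0 : 0 < l by exact: lt_le_trans ltr01 l1.
  have p01 : ph j <= 1 / 100 by exact: le_trans p1 phi1.
  set s := noise j in n0 n1 hh2 en nn *; set p := ph j in p0 p1 p01 *.
  have key : bsm (fun k => 2 * (om k ^+ 3 * `|av v k * bv v k|) +
      `|u| * (om k ^+ 4 * (av v k ^+ 2 + bv v k ^+ 2))) j <= p * s / e * (3 * sigF j + 7).
    apply: (@le_trans _ _ (bsm (fun k => (p * s / e + 4 * p ^+ 2 * s / e) *
        (om k ^+ 2 * (av v k ^+ 2 + bv v k ^+ 2)) + p / e * (om k ^+ 2 * bv v k ^+ 2)) j)).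
      apply: ler_bsum => k kj; have osm := om_small jJ kj; rewrite -/s -/p in osm.
      have w0 := om_ge0 k; set w := om k in osm w0 *.
      set a := av v k; set b := bv v k.
      (* The unequal weights [s] and 1 compensate the sizes of the sums: that of [om^2 b^2] over the
         block is itself at most [2 s]. *)
      have h1 : 2 * (w * `|a * b|) <= p / e * (s * a ^+ 2 + b ^+ 2).
        have B0 : 0 <= p / e * (s * a ^+ 2 + b ^+ 2).
          by have ? := ltW p0; have ? := ltW n0; have ? := ltW e0; nneg.
        rewrite -ler_sqr ?nnegrE//; last by nneg.
        rewrite !exprMn real_normK ?num_real//.
        apply: (@le_trans _ _ ((p / e) ^+ 2 * (4 * s * (a ^+ 2 * b ^+ 2)))).
          have : w ^+ 2 <= (p / e) ^+ 2 * s.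
            have -> : (p / e) ^+ 2 * s = p ^+ 2 * s / e ^+ 2 by field; rewrite gt_eqF.
            rewrite ler_pdivlMr ?exprn_gt0// mulrC.
            apply: le_trans osm; rewrite ler_peMr//; nneg.
          move=> hw.
          have ab0 : 0 <= 4 * (a ^+ 2 * b ^+ 2) by nneg.
          have := ler_wpM2r ab0 hw; congr (_ <= _); rewrite ?exprMn; ring.
        rewrite -exprMn ler_wpM2l ?sqr_ge0// -subr_ge0.
        by rewrite (_ : _ - _ = (s * a ^+ 2 - b ^+ 2) ^+ 2) ?sqr_ge0//; rewrite exprMn; ring.
      have h2 : `|u| * w ^+ 2 <= 4 * p ^+ 2 * s / e.
        apply: (@le_trans _ _ (4 * e * l * w ^+ 2)); first by rewrite ler_wpM2r ?sqr_ge0.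
        rewrite ler_pdivlMr//.
        have -> : 4 * e * l * w ^+ 2 * e = 4 * (e ^+ 2 * w ^+ 2 * l) by ring.
        by rewrite -[leRHS]mulrA ler_wpM2l.
      have w20 : 0 <= w ^+ 2 by nneg.
      have := ler_wpM2l w20 h1.
      have ab0 : 0 <= w ^+ 2 * (a ^+ 2 + b ^+ 2) by nneg.
      have := ler_wpM2r ab0 h2.
      have : 0 <= p * s / e * (w ^+ 2 * b ^+ 2).
        by have ? := ltW p0; have ? := ltW n0; have ? := ltW e0; nneg.
      have -> : `|u| * (w ^+ 4 * (a ^+ 2 + b ^+ 2)) = `|u| * w ^+ 2 * (w ^+ 2 * (a ^+ 2 + b ^+ 2)) by ring.
      have -> : 2 * (w ^+ 3 * `|a * b|) = w ^+ 2 * (2 * (w * `|a * b|)) by ring.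
      have -> : (p * s / e + 4 * p ^+ 2 * s / e) * (w ^+ 2 * (a ^+ 2 + b ^+ 2)) + p / e * (w ^+ 2 * b ^+ 2) =
        w ^+ 2 * (p / e * (s * a ^+ 2 + b ^+ 2)) + p * s / e * (w ^+ 2 * b ^+ 2) +
        4 * p ^+ 2 * s / e * (w ^+ 2 * (a ^+ 2 + b ^+ 2)) by ring.
      lra.
    rewrite bsumD !bsumZ -/(energy v j).
    have pse : 0 < p * s / e by rewrite divr_gt0// mulr_gt0.
    have h1 : (p * s / e + 4 * p ^+ 2 * s / e) * energy v j <=
        p * s / e * (1 + 4 * p) * (2 * sigF j + 4 * s).
      have -> : p * s / e + 4 * p ^+ 2 * s / e = p * s / e * (1 + 4 * p) by ring.
      by rewrite ler_wpM2l// mulr_ge0 ?(ltW pse)//; lra.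
    have pe : 0 <= p / e by rewrite ltW// divr_gt0.
    have h2 := ler_wpM2l pe nn.
    have h3 : (1 + 4 * p) * (2 * sigF j + 4 * s) + 2 <= 3 * sigF j + 7 by nra.
    have := ler_wpM2l (ltW pse) h3.
    have -> : p * s / e * ((1 + 4 * p) * (2 * sigF j + 4 * s) + 2) =
      p * s / e * (1 + 4 * p) * (2 * sigF j + 4 * s) + p / e * (2 * s) by ring.
    lra.
  apply: (@le_trans _ _ (2 * oracle j * (p * s / e * (3 * FM + 7)))).
    apply: ler_pM => //.
    - exact: stein_ge0.
    - by apply: bsum_ge0 => k; have ? := om_ge0 k; nneg.
    - apply: (le_trans key); rewrite ler_wpM2l//; last by lra.
      by have ? := ltW p0; have ? := ltW n0; have ? := ltW e0; nneg.
  have -> : (6 * FM + 14) * (phi * (oracle j * s)) / e = 2 * oracle j * (phi * s / e * (3 * FM + 7)) by ring.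
  have FMp : 0 <= 3 * FM + 7 by lra.
  have ? := ltW n0; have ? := ltW e0.
  apply: ler_wpM2l; first by nneg.
  by apply: ler_wpM2r => //; apply: ler_wpM2r; [nneg|apply: ler_wpM2r].
rewrite -mulr_suml -mulr_sumr -mulr_sumr ler_wpM2r ?invr_ge0 ?(ltW e0)//.
have FM0 : 0 <= FM by rewrite (le_trans _ FtotM)// /Ftot addr_ge0// sumr_ge0// => j _; exact: sigF_ge0.
rewrite ler_wpM2l ?addr_ge0 ?mulr_ge0// ler_wpM2l//; exact: sum_oracle_noise.
Qed.

Lemma pathwise_bound v u c : good v -> 0 < c -> c <= 1 -> c <= Ftot -> `|u| <= 4 * e * l ->
  0 < orisk -> orisk <= 1 -> orisk <= Ftot / 32 ->
  16 * (6 * FM + 14) * (l * (phi * orisk)) <= Ftot ->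
  (0 < u -> 0 <= \sum_(1 <= k < N.+1) weight v k * score (av v k) (bv v k) (om k) u) ->
  (u < 0 -> \sum_(1 <= k < N.+1) weight v k * score (av v k) (bv v k) (om k) u <= 0) ->
  u ^+ 2 <= Mf v ^+ 2 / Ftot ^+ 2 * (1 + 2 * (orisk / Ftot) - 2 * (Wa v / Ftot) +
      (100 + 64 * (6 * FM + 14)) / c ^+ 2 * ((phi + orisk) * orisk)) +
    (64 * (6 * FM + 14) + 1024 * (6 * FM + 14) ^+ 2) / c ^+ 6 * (phi * orisk) *
      (Mf v ^+ 4 / e ^+ 2).
Proof.
move=> gv c0 c1 cF hu r0 r1 rF hl pos neg.
have Ft0 : 0 < Ftot by lra.
have FM0 : 0 <= FM by rewrite (le_trans (ltW Ft0)).
have [Dl IE hDl] := Info_split gv.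
have w0 k : 0 <= weight v k by apply: spread_ge0 => j _; exact: stein_ge0.
have foc := first_order_condition w0 om_ge0 pos neg.
apply: (error_bound c0 c1 cF e0 _ (ltW r0) r1 rF phi0 phi1 _ (Rem_le gv hu) hu hl foc IE (Wa_sqr gv r0 Ft0) hDl).
- by rewrite addr_ge0// mulr_ge0.
- by apply: sumr_ge0 => k _; have ? := om_ge0 k; have ? := w0 k; nneg.
Qed.

Definition flip1_all v (k : nat) : T * T := flip1 (v k).

Lemma eq_bsum_fun (g1 g2 : nat -> R) j : g1 =1 g2 -> bsm g1 j = bsm g2 j.
Proof. by move=> h; apply: eq_bsum => k _. Qed.

Lemma flip_at_fst i v k : (flip_at i v k).1 = (v k).1.
Proof. by rewrite /flip_at; case: eqP. Qed.

Lemma flip_at_snd_sqr i v k : (flip_at i v k).2 ^+ 2 = (v k).2 ^+ 2.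
Proof. by rewrite /flip_at; case: eqP => //= _; rewrite sqrrN. Qed.

Lemma av_flip i v k : av (flip_at i v) k = av v k.
Proof. by rewrite /av flip_at_fst. Qed.

Lemma Lb_flip i v j : Lb (flip_at i v) j = Lb v j.
Proof. by rewrite /Lb; congr (_ * _); apply: eq_bsum_fun => k; rewrite flip_at_fst. Qed.

Lemma Qb_flip i v j : Qb (flip_at i v) j = Qb v j.
Proof.
by rewrite /Qb; congr (_ * _); apply: eq_bsum_fun => k; rewrite flip_at_fst flip_at_snd_sqr.
Qed.

Lemma Db_flip i v j : Db (flip_at i v) j = Db v j.
Proof.
by rewrite /Db; congr (_ * _); apply: eq_bsum_fun => k; rewrite flip_at_fst flip_at_snd_sqr.
Qed.

Lemma energy_flip i v j : energy (flip_at i v) j = energy v j.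
Proof. by rewrite !energyE Lb_flip Qb_flip. Qed.

Lemma weight_flip i v k : weight (flip_at i v) k = weight v k.
Proof. by apply: eq_bigr => j _; rewrite /stein energy_flip. Qed.

Lemma Wa_flip i v : Wa (flip_at i v) = Wa v.
Proof. by apply: eq_bigr => j _; rewrite Lb_flip. Qed.

Lemma Lb_flip1 v j : Lb (flip1_all v) j = - Lb v j.
Proof.
rewrite /Lb -mulrN; congr (_ * _); rewrite -mulN1r -bsumZ.
by apply: eq_bsum_fun => k /=; ring.
Qed.

Lemma Qb_flip1 v j : Qb (flip1_all v) j = Qb v j.
Proof. by rewrite /Qb; congr (_ * _); apply: eq_bsum_fun => k /=; rewrite sqrrN. Qed.

Lemma Db_flip1 v j : Db (flip1_all v) j = Db v j.
Proof. by rewrite /Db; congr (_ * _); apply: eq_bsum_fun => k /=; rewrite sqrrN. Qed.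

Lemma Wa_flip1 v : Wa (flip1_all v) = - Wa v.
Proof. by rewrite /Wa -sumrN; apply: eq_bigr => j _; rewrite Lb_flip1 mulrN. Qed.

(* The good event is the zero set of a sum of nonnegative excesses, which makes its
   measurability and its symmetries immediate. *)
Definition excess v := \sum_(j < J)
  (Num.max 0 (Lb v j ^+ 2 - ph j ^+ 2 * (sigF j * noise j)) +
   Num.max 0 (- (ph j * noise j) - Qb v j) +
   Num.max 0 (Qb v j - 19 / 20 * (ph j * noise j)) +
   Num.max 0 (- (ph j * noise j) - Db v j) +
   Num.max 0 (Db v j - ph j * noise j)).

Definition goodI v : R := ((excess v <= 0)%R : bool)%:R.

Lemma maxr0_ge0 (x : R) : 0 <= Num.max 0 x.
Proof. by rewrite le_max lexx. Qed.

Lemma goodP v : reflect (good v) (excess v <= 0).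
Proof.
have m0 (x : R) : x <= 0 -> Num.max 0 x = 0 by move=> x0; rewrite max_l.
have m1 (x : R) : Num.max 0 x = 0 -> x <= 0 by move=> <-; rewrite le_max lexx orbT.
have p (x : R) := maxr0_ge0 x.
apply: (iffP idP) => [h j jJ|gv].
  have e0' : excess v == 0.
    by rewrite eq_le h/= sumr_ge0// => i _; rewrite !addr_ge0.
  move: e0'; rewrite /excess psumr_eq0; last by move=> i _; rewrite !addr_ge0.
  move=> /allP /(_ (Ordinal jJ)); rewrite mem_index_enum => /(_ isT) /=.
  rewrite !paddr_eq0 ?addr_ge0// => /andP[/andP[/andP[/andP[/eqP a /eqP b] /eqP c] /eqP d] /eqP i].
  move: a b c d i => /m1 a /m1 b /m1 c /m1 d /m1 i.
  by split; [lra|apply/andP; split; lra|apply/andP; split; lra].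
rewrite /excess big1// => j _; have [a /andP[b c] /andP[d i]] := gv _ (ltn_ord j).
by rewrite !m0 ?addr0//; lra.
Qed.

Lemma goodI_ge0 v : 0 <= goodI v.
Proof. exact: ler0n. Qed.

Lemma goodI_flip i v : goodI (flip_at i v) = goodI v.
Proof.
by congr ((_ <= 0)%R : bool)%:R; apply: eq_bigr => j _; rewrite Lb_flip Qb_flip Db_flip.
Qed.

Lemma good_flip1 v : good (flip1_all v) <-> good v.
Proof.
have E : excess (flip1_all v) = excess v.
  by apply: eq_bigr => j _; rewrite Lb_flip1 Qb_flip1 Db_flip1 sqrrN.
by split => /goodP h; apply/goodP; rewrite ?E// -E.
Qed.

Lemma cm_bsum j (g : nat -> (nat -> T * T) -> R) : (j < J)%N ->
  (forall k, (0 < k <= N)%N -> coordinate_measurable N (g k)) ->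
  coordinate_measurable N (fun v => bsm (g^~ v) j).
Proof.
move=> jJ cg; apply: cm_sum => k; rewrite mem_index_iota => kj.
exact: cg (block_range kap0 kapS kapJ jJ kj).
Qed.

Lemma cmZ n c F : coordinate_measurable n F -> coordinate_measurable n (fun v => c * F v : R).
Proof. by apply: cmM; exact: cm_cst. Qed.

Lemma cmN n G : coordinate_measurable n G -> coordinate_measurable n (fun v => - G v : R).
Proof.
move=> cG; rewrite (_ : (fun v => _) = fun v => 0 - G v); first by apply: cmB => //; exact: cm_cst.
by apply/funext => v; rewrite sub0r.
Qed.

Lemma cm_av k : (0 < k <= N)%N -> coordinate_measurable N (av^~ k).
Proof. by move=> kN; apply: cmD; [exact: cm_cst|apply: cmZ; exact: cm_fst]. Qed.

Lemma cm_bv k : (0 < k <= N)%N -> coordinate_measurable N (bv^~ k).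
Proof. by move=> kN; apply: cmZ; exact: cm_snd. Qed.

Lemma cm_Lb j : (j < J)%N -> coordinate_measurable N (Lb^~ j).
Proof.
by move=> jJ; apply/cmZ/cm_bsum => // k kN; apply/cmZ/cmZ; exact: cm_fst.
Qed.

Lemma cm_Qb j : (j < J)%N -> coordinate_measurable N (Qb^~ j).
Proof.
move=> jJ; apply/cmZ/cm_bsum => // k kN; apply/cmZ/cmB; last exact: cm_cst.
by apply: cmD; apply: cmX; [exact: cm_fst|exact: cm_snd].
Qed.

Lemma cm_Db j : (j < J)%N -> coordinate_measurable N (Db^~ j).
Proof.
move=> jJ; apply/cmZ/cm_bsum => // k kN; apply/cmZ.
by apply: cmB; apply: cmX; [exact: cm_fst|exact: cm_snd].
Qed.

Lemma cm_energy j : (j < J)%N -> coordinate_measurable N (energy^~ j).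
Proof.
move=> jJ; apply/cm_bsum => // k kN; apply/cmZ.
by apply: cmD; apply: cmX; [exact: cm_av|exact: cm_bv].
Qed.

Lemma cm_Wa : coordinate_measurable N Wa.
Proof. by apply: cm_sum => j _; apply/cmZ/cm_Lb. Qed.

Lemma cm_goodI : coordinate_measurable N goodI.
Proof.
apply: cm_le; last exact: cm_cst.
apply: cm_sum => j _; have jJ := ltn_ord j.
by do !apply: cmD; apply: cm_max; try exact: cm_cst; apply: cmB; try exact: cm_cst;
  [apply: cmX; exact: cm_Lb|exact: cm_Qb|exact: cm_Qb|exact: cm_Db|exact: cm_Db].
Qed.

Lemma cm_stein j : (j < J)%N -> coordinate_measurable N (stein^~ j).
Proof.
move=> jJ; apply: cm_max; first exact: cm_cst.
apply: cmB; first exact: cm_cst.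
apply: cmZ; apply: cmV; last by move=> v; rewrite addr_ge0 ?maxr0_ge0// ltW// noise_gt0.
apply: cmD; last exact: cm_cst.
apply: cm_max; first exact: cm_cst.
by apply: cmB; [exact: cm_energy|exact: cm_cst].
Qed.

Lemma cm_weight k : coordinate_measurable N (weight^~ k).
Proof.
apply: cm_sum => j _; case: (kap j <= k < kap j.+1)%N; last exact: cm_cst.
exact: cm_stein.
Qed.

Lemma cm_mk k : (0 < k <= N)%N -> coordinate_measurable N (mk k).
Proof. by move=> kN; apply: cmM; [exact: cm_weight|apply/cmZ/cmM; [exact: cm_av|exact: cm_bv]]. Qed.

Lemma cm_Mf : coordinate_measurable N Mf.
Proof. by apply: cm_sum => k; rewrite mem_index_iota ltnS => kN; exact: cm_mk. Qed.

Lemma mk_flip k v : mk k (flip_at k v) = - mk k v.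
Proof. by rewrite /mk weight_flip av_flip /bv /flip_at eqxx/=; ring. Qed.

Lemma mk_flip' k i v : k != i -> mk k (flip_at i v) = mk k v.
Proof. by move=> ki; rewrite /mk weight_flip av_flip /bv /flip_at (negbTE ki). Qed.

(* Deterministic majorant of the squared Stein weight on the good event. *)
Definition wbar j := oracle j ^+ 2 + 12 * ph j * (oracle j * (1 - oracle j)).

Lemma wbar_ge0 j : (j < J)%N -> 0 <= wbar j.
Proof.
move=> jJ; have o0 := oracle_ge0 jJ; have /andP[p0 _] := ph0 jJ.
have o1 : 0 <= 1 - oracle j by rewrite subr_ge0 oracle_le1.
by rewrite /wbar; nneg.
Qed.

Lemma wbar_le j : (j < J)%N -> wbar j <= 2 * oracle j.
Proof.
move=> jJ; have o0 := oracle_ge0 jJ; have /andP[p0 p1] := ph0 jJ.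
have o1 := oracle_le1 jJ; have p2 := le_trans p1 phi1.
have oo : 0 <= oracle j * (1 - oracle j) by rewrite mulr_ge0// subr_ge0.
have h1 : 12 * ph j * (oracle j * (1 - oracle j)) <= oracle j * (1 - oracle j).
  by rewrite ler_piMl//; lra.
by rewrite /wbar expr2 in h1 *; lra.
Qed.

Lemma wbar_energy j : (j < J)%N ->
  wbar j * (sigF j + noise j) = oracle j * sigF j + 12 * ph j * (oracle j * noise j).
Proof.
move=> jJ; have E := oracleE jJ.
have -> : wbar j * (sigF j + noise j) = oracle j * (oracle j * (sigF j + noise j)) +
  12 * ph j * (oracle j * (sigF j + noise j - oracle j * (sigF j + noise j))) by rewrite /wbar; ring.
by rewrite E; ring.
Qed.

Lemma sum_wbar_energy : \sum_(j < J) wbar j * (sigF j + noise j) <= Ftot - orisk + 12 * (phi * orisk).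
Proof.
rewrite Ftot_orisk.
apply: (@le_trans _ _ (\sum_(j < J) (oracle j * sigF j + 12 * (phi * (oracle j * noise j))))).
  apply: ler_sum => j _; have jJ := ltn_ord j; rewrite wbar_energy// lerD2l -mulrA ler_wpM2l//.
  have /andP[_ p1] := ph0 jJ; rewrite ler_wpM2r// mulr_ge0 ?oracle_ge0// ltW// noise_gt0//.
by rewrite big_split/= lerD2l -mulr_sumr -mulr_sumr !ler_wpM2l// sum_oracle_noise.
Qed.

(** On the good event, [e^2] times this dominates the sum of the squared terms of [Mf]; its weights
    are deterministic, which makes the expectation computable. *)
Definition Vp v := \sum_(1 <= k < N.+1) spread kap J wbar k * (om k ^+ 2 * (av v k ^+ 2 * (v k).2 ^+ 2)).

Lemma cm_Vp : coordinate_measurable N Vp.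
Proof.
apply: cm_sum => k; rewrite mem_index_iota ltnS => kN.
by do 2 apply: cmZ; apply: cmM; apply: cmX; [exact: cm_av|exact: cm_snd].
Qed.

Lemma Vp_ge0 v : 0 <= Vp v.
Proof.
apply: sumr_ge0 => k _; have ? : 0 <= spread kap J wbar k by apply: spread_ge0; exact: wbar_ge0.
by nneg.
Qed.

Lemma sum_mk_sqr v : good v -> \sum_(1 <= k < N.+1) mk k v ^+ 2 <= e ^+ 2 * Vp v.
Proof.
move=> gv; rewrite /Vp mulr_sumr !(sum_blocks kap0 kapS kapJ); apply: ler_sum => j _.
have jJ := ltn_ord j; apply: ler_bsum => k kj.
rewrite /mk /weight !(spreadE kapS _ jJ kj).
have := stein_sqr_le (good_blockP gv jJ); rewrite -energyE -/(stein v j) -/(oracle j) -/(wbar j) => h.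
have X0 : 0 <= e ^+ 2 * (om k ^+ 2 * (av v k ^+ 2 * (v k).2 ^+ 2)) by nneg.
have := ler_wpM2r X0 h; congr (_ <= _); rewrite /bv; ring.
Qed.

Lemma cm_flip1_all n G : coordinate_measurable n G ->
  coordinate_measurable n (fun v => G (flip1_all v)).
Proof.
move=> [mG eG]; split.
  move=> d' S u mu_; apply: (mG _ _ (fun k w => flip1_all (u^~ w) k)) => k.
  exact: measurableT_comp measurable_flip1 (mu_ k).
by move=> v v' vv'; apply: eG => k kn; rewrite /flip1_all vv'.
Qed.

(** Cauchy-Schwarz for weights of total mass at most [S], read off from the nonnegative sum of
    [p k (x k S - A)^2]. *)
Lemma wsum_sqr_le (p x : nat -> R) (S : R) n : (forall k, 0 <= p k) -> 0 < S ->
  \sum_(1 <= k < n) p k <= S ->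
  (\sum_(1 <= k < n) p k * x k) ^+ 2 <= S * \sum_(1 <= k < n) p k * x k ^+ 2.
Proof.
move=> p0 S0 hS; set A := \sum_(1 <= k < n) p k * x k; set B := \sum_(1 <= k < n) p k * x k ^+ 2.
have : 0 <= \sum_(1 <= k < n) p k * (x k * S - A) ^+ 2.
  by apply: sumr_ge0 => k _; rewrite mulr_ge0// sqr_ge0.
have -> : \sum_(1 <= k < n) p k * (x k * S - A) ^+ 2 =
    S ^+ 2 * B - 2 * S * A * \sum_(1 <= k < n) p k * x k + A ^+ 2 * \sum_(1 <= k < n) p k.
  move: A => a.
  rewrite /B !mulr_sumr -sumrB -big_split/=.
  by apply: eq_bigr => k _; ring.
have : A ^+ 2 * \sum_(1 <= k < n) p k <= A ^+ 2 * S by rewrite ler_wpM2l// sqr_ge0.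
rewrite -/A => h1 h2; rewrite -(ler_pM2l S0).
by move: h1 h2; rewrite !expr2; lra.
Qed.

(** * Moments on the good event and probabilities of its complement *)

Section moments.
Context {d : measure_display} {Omega : measurableType d} (P : probability Omega R).
Variable X : nat -> Omega -> T * T.
Hypothesis iX : iid_pairs P X.
Notation gam := (@normal_prob R 0 1).

Lemma cm_integral_sum (s : seq nat) (g : nat -> (nat -> T * T) -> R) :
  (forall k, k \in s -> coordinate_measurable N (g k)) -> (forall k v, 0 <= g k v) ->
  (\int[P]_w (\sum_(k <- s) g k (X^~ w))%:E = \sum_(k <- s) \int[P]_w (g k (X^~ w))%:E)%E.
Proof.
move=> cg g0; elim: s cg => [|k s ih] cg.
  by rewrite big_nil; under eq_integral do rewrite big_nil; rewrite integral0.
rewrite big_cons; under eq_integral do rewrite big_cons.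
have cs i : i \in s -> coordinate_measurable N (g i) by move=> si; apply: cg; rewrite inE si orbT.
have ck : coordinate_measurable N (g k) by apply: cg; rewrite mem_head.
rewrite (@nnintD _ _ _ P (fun w => g k (X^~ w)) (fun w => \sum_(k <- s) g k (X^~ w))) ?ih//.
- exact: (cm_measurable_iid iX ck).
- exact: (cm_measurable_iid iX (cm_sum cs)).
- by move=> w; apply: sumr_ge0.
Qed.

Lemma pair_moment k (p q : R -> R) : (0 < k)%N -> measurable_fun setT p -> measurable_fun setT q ->
  (forall x, 0 <= p x) -> (forall x, 0 <= q x) ->
  (\int[P]_w (p (X k w).1 * q (X k w).2)%:E = (\int[gam]_x (p x)%:E) * \int[gam]_x (q x)%:E)%E.
Proof.
move=> k0 mp mq p0 q0.
have mp' : measurable_fun [set: T] (fun x : T => (p x)%:E) by exact/measurable_EFinP.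
have mq' : measurable_fun [set: T] (fun x : T => (q x)%:E) by exact/measurable_EFinP.
pose g (z : T * T) := ((p z.1)%:E * (q z.2)%:E)%E.
have mg : measurable_fun setT g.
  apply: emeasurable_funM; first exact: (measurableT_comp mp' measurable_fst).
  exact: (measurableT_comp mq' measurable_snd).
have g0 z : (0 <= g z)%E by rewrite mule_ge0// lee_fin.
have -> : (\int[P]_w (p (X k w).1 * q (X k w).2)%:E = \int[P]_w g (X k w))%E.
  by apply: eq_integral => w _; rewrite EFinM.
rewrite (iid_law_integral iX k0 mg g0).
by apply: (@integral_prodM R _ _ T T gam gam) => // x; rewrite lee_fin.
Qed.

Lemma gam_quadratic (A B : R) : 0 <= A -> 0 <= B ->
  (\int[gam]_x (A + B * x ^+ 2)%:E <= (A + B)%:E)%E.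
Proof.
move=> A0 B0; have m2 : measurable_fun [set: T] (fun x : T => x ^+ 2) by exact: measurable_funX.
have s0 (x : R) : 0 <= x ^+ 2 by exact: sqr_ge0.
have := @nnintD _ _ _ gam (cst A) (fun x : R => B * x ^+ 2) (measurable_cst _)
  (measurable_funM (measurable_cst _) m2) (fun=> A0) (fun x => mulr_ge0 B0 (s0 x)).
move=> /= ->; rewrite EFinD leeD//.
  by rewrite (integral_cst gam measurableT A%:E) [X in (_ * X)%E](@probability_setT _ _ _ gam) mule1.
by rewrite nnintZ// -[leRHS]mule1 lee_wpmul2l ?lee_fin// gam_sq.
Qed.

Lemma int_quadratic k (A B : R) : (0 < k)%N -> 0 <= A -> 0 <= B ->
  (\int[P]_w ((A + B * (X k w).1 ^+ 2) * (X k w).2 ^+ 2)%:E <= (A + B)%:E)%E.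
Proof.
move=> k0 A0 B0.
rewrite (@pair_moment k (fun x => A + B * x ^+ 2) (fun x => x ^+ 2))//; first last.
- by move=> x; exact: sqr_ge0.
- by move=> x; rewrite addr_ge0// mulr_ge0// sqr_ge0.
- have m2 : measurable_fun [set: T] (fun x : T => A + B * x ^+ 2).
    by apply: measurable_funD => //; apply: measurable_funM => //; exact: measurable_funX.
  exact: m2.
rewrite -[leRHS]mule1; apply: lee_pmul; rewrite ?gam_quadratic ?gam_sq//.
- by apply: integral_ge0 => x _; rewrite lee_fin addr_ge0// mulr_ge0// sqr_ge0.
- by apply: integral_ge0 => x _; rewrite lee_fin sqr_ge0.
Qed.

Lemma pow4_ge0 (x : R) : 0 <= x ^+ 4.
Proof. by rewrite (_ : 4 = 2 * 2)%N// exprM sqr_ge0. Qed.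

Lemma int_quartic k : (0 < k)%N ->
  (\int[P]_w ((1 + (X k w).1 ^+ 4) * (X k w).2 ^+ 4)%:E <= (65 * 64)%:E)%E.
Proof.
move=> k0.
rewrite (@pair_moment k (fun x => 1 + x ^+ 4) (fun x => x ^+ 4))//; first last.
- exact: pow4_ge0.
- by move=> x; rewrite addr_ge0// pow4_ge0.
- have m2 : measurable_fun [set: T] (fun x : T => 1 + x ^+ 4).
    by apply: measurable_funD => //; exact: measurable_funX.
  exact: m2.
rewrite EFinM.
apply: lee_pmul; rewrite ?gam_pow4//.
- by apply: integral_ge0 => x _; rewrite lee_fin addr_ge0// pow4_ge0.
- by apply: integral_ge0 => x _; rewrite lee_fin pow4_ge0.
have m4 : measurable_fun [set: T] (fun x : T => x ^+ 4) by exact: measurable_funX.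
have := @nnintD _ _ _ gam (cst 1) (fun x : R => x ^+ 4) (measurable_cst _) m4 (fun=> ler01) pow4_ge0.
move=> /= ->; have -> : 65%:E = (1 + 64%:E)%E :> \bar R by rewrite -EFinD -natr1 addrC.
rewrite leeD ?gam_pow4//.
by rewrite (integral_cst gam measurableT 1) [X in (_ * X)%E](@probability_setT _ _ _ gam) mule1.
Qed.

Hypothesis r0 : 0 < orisk.
Hypothesis rF : orisk <= Ftot / 32.

Let F0 : 0 < Ftot. Proof. by have := r0; have := rF; lra. Qed.

Lemma Wa_norm_sqr v : good v -> (Wa v / Ftot) ^+ 2 <= phi ^+ 2 * (orisk / Ftot).
Proof.
move=> gv; have := Wa_sqr gv r0 F0 => h.
rewrite expr_div_n ler_pdivrMr ?exprn_gt0//; apply: (le_trans h).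
by rewrite le_eqVlt; apply/orP; left; apply/eqP; field; rewrite gt_eqF.
Qed.

Lemma Wa_norm v : good v -> `|Wa v / Ftot| <= 1 / 2.
Proof.
move=> gv; rewrite -ler_sqr ?nnegrE// real_normK ?num_real//.
apply: (le_trans (Wa_norm_sqr gv)).
have h1 : orisk / Ftot <= 1 by rewrite ler_pdivrMr// mul1r; have := rF; have := F0; lra.
have h2 : phi ^+ 2 <= 1 / 4 by have := phi0; have := phi1; nra.
have h3 : 0 <= orisk / Ftot by rewrite divr_ge0// ltW.
rewrite [leRHS](_ : _ = 1 / 4 * 1); last by field.
by apply: ler_pM => //; exact: sqr_ge0.
Qed.

Lemma sum_wbar : \sum_(1 <= k < N.+1) spread kap J wbar k * (om k ^+ 2 * (f k ^+ 2 + e ^+ 2)) <=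
  Ftot - orisk + 12 * (phi * orisk).
Proof.
apply: le_trans sum_wbar_energy.
rewrite (sum_spread kap0 kapS kapJ) le_eqVlt; apply/orP; left; apply/eqP; apply: eq_bigr => j _.
congr (_ * _); rewrite /sigF /noise -[in RHS]bsumZ -[in RHS]bsumD.
by apply: eq_bsum_fun => k; ring.
Qed.

(** The signs of the second noise components replace [Mf^2] by a sum of squares, dominated by
    [e^2 Vp]. Reflecting all first components cancels [Wa] against the even part of [a_k^2], but not
    against its odd part [2 e f_k zeta_k]. That product of two odd factors is of order [phi r] by
    AM-GM and produces the term [8 phi r]. *)
Lemma second_moment c0 : 1 <= c0 ->
  (\int[P]_w (Mf (X^~ w) ^+ 2 * ((c0 - 2 * (Wa (X^~ w) / Ftot)) * goodI (X^~ w)))%:E <=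
   (e ^+ 2 * (c0 * (Ftot - orisk + 12 * (phi * orisk)) + 8 * (phi * orisk)))%:E)%E.
Proof.
move=> c01; pose g v := (c0 - 2 * (Wa v / Ftot)) * goodI v.
have gE v : good v -> g v = c0 - 2 * (Wa v / Ftot) by move=> /goodP h; rewrite /g /goodI h mulr1.
have gN v : ~ good v -> g v = 0 by move=> /goodP /negbTE h; rewrite /g /goodI h mulr0.
have cg : coordinate_measurable N g.
  apply: cmM; last exact: cm_goodI.
  apply: cmB; first exact: cm_cst.
  by apply: cmZ; apply: cmM; [exact: cm_Wa|exact: cm_cst].
have g0 v : 0 <= g v.
  have [gv|gv] := pselect (good v); last by rewrite gN.
  by rewrite gE//; have /ler_normlP[] := Wa_norm gv; lra.
have gf i v : g (flip_at i v) = g v by rewrite /g Wa_flip goodI_flip.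
have R2 : (\int[P]_w (Mf (X^~ w) ^+ 2 * g (X^~ w))%:E =
    \int[P]_w ((\sum_(1 <= k < N.+1) mk k (X^~ w) ^+ 2) * g (X^~ w))%:E)%E.
  exact: (rademacher2 iX cm_mk mk_flip mk_flip' (leqnn N) cg g0 gf).
rewrite R2.
have cV : coordinate_measurable N (fun v => \sum_(1 <= k < N.+1) mk k v ^+ 2).
  by apply: cm_sum => k; rewrite mem_index_iota ltnS => kN; apply: cmX; exact: cm_mk.
pose p v := Vp v * g v.
have cp : coordinate_measurable N p by apply: cmM => //; exact: cm_Vp.
have p0 v : 0 <= p v by rewrite mulr_ge0// Vp_ge0.
have cq := cm_flip1_all cp; set q := (fun v => p (flip1_all v)) in cq.
apply: (@le_trans _ _ (\int[P]_w (e ^+ 2 * p (X^~ w))%:E)%E).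
  apply: nnint_le.
  - exact: (cm_measurable_iid iX (cmM cV cg)).
  - exact: (cm_measurable_iid iX (cmZ _ cp)).
  - by move=> w; rewrite mulr_ge0// sumr_ge0// => k _; rewrite sqr_ge0.
  - move=> w; have [gv|gv] := pselect (good (X^~ w)); last by rewrite /p gN// !mulr0.
    by rewrite /p mulrA ler_wpM2r// sum_mk_sqr.
rewrite nnintZ ?sqr_ge0//; last exact: (cm_measurable_iid iX cp).
rewrite [leRHS]EFinM lee_wpmul2l ?lee_fin ?sqr_ge0//.
rewrite (@integral_half_sum _ _ _ P (fun w => p (X^~ w)) (fun w => q (X^~ w)))//; first last.
- by rewrite (cm_integral_map iX cp p0 (fun=> flip1_preserving)).
- by move=> w; rewrite /q.
- exact: (cm_measurable_iid iX cq).
- exact: (cm_measurable_iid iX cp).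
pose ro := orisk / Ftot.
have ro0 : 0 <= ro by rewrite divr_ge0// ltW.
pose A k := (c0 + 2 * (phi * ro)) * f k ^+ 2.
pose B := (c0 + 2 * phi) * e ^+ 2.
have c00 : 0 <= c0 by lra.
have A0 k : 0 <= A k by rewrite /A; have ? := phi0; nneg.
have B0 : 0 <= B by rewrite /B; have ? := phi0; nneg.
have W0 k : 0 <= spread kap J wbar k by apply: spread_ge0; exact: wbar_ge0.
pose G k v := spread kap J wbar k * om k ^+ 2 * ((A k + B * (v k).1 ^+ 2) * (v k).2 ^+ 2).
have G0 k v : 0 <= G k v by rewrite /G; have ? := A0 k; have ? := W0 k; nneg.
have cG' k : (0 < k <= N)%N ->
    coordinate_measurable N (fun v => (A k + B * (v k).1 ^+ 2) * (v k).2 ^+ 2).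
  move=> kN; apply: cmM; last by apply: cmX; exact: cm_snd.
  by apply: cmD; [exact: cm_cst|apply: cmZ; apply: cmX; exact: cm_fst].
have cG k : k \in index_iota 1 N.+1 -> coordinate_measurable N (G k).
  by rewrite mem_index_iota ltnS => kN; apply: cmZ; exact: cG'.
(* The majorant [G] drops the indicator of the good event, so that its expectation is a sum over
   single pairs. Off the event the left side vanishes, because the event is invariant under the
   reflection. *)
apply: (@le_trans _ _ (\int[P]_w (\sum_(1 <= k < N.+1) G k (X^~ w))%:E)%E).
  apply: nnint_le.
  - exact: (cm_measurable_iid iX (cmZ _ (cmD cp cq))).
  - exact: (cm_measurable_iid iX (cm_sum cG)).
  - by move=> w; rewrite mulr_ge0// ?invr_ge0// addr_ge0// /q.
  - move=> w; move: (X^~ w) => v; have [gv|gv] := pselect (good v); last first.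
      have gv' : ~ good (flip1_all v) by rewrite good_flip1.
      rewrite /q /p !gN// !mulr0 addr0 mulr0; exact: sumr_ge0.
    have gv' : good (flip1_all v) by rewrite good_flip1.
    have hy := Wa_norm_sqr gv.
    rewrite /q /p !gE// Wa_flip1 mulNr mulrN opprK; set y := Wa v / Ftot in hy *.
    rewrite /Vp !mulr_suml -big_split/= mulr_sumr.
    apply: ler_sum => k _.
    (* Half the odd part of [a_k^2] times [Wa / F]; the bound on the square lets AM-GM split it
       between the noise [e^2] and [f_k^2] times the relative risk. *)
    have hL : (e * (v k).1 * (f k * y)) ^+ 2 <= phi ^+ 2 * ((e ^+ 2 * (v k).1 ^+ 2) * (f k ^+ 2 * ro)).
      have z0 : 0 <= e ^+ 2 * (v k).1 ^+ 2 * f k ^+ 2 by nneg.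
      by have := ler_wpM2l z0 hy; congr (_ <= _); rewrite /ro; ring.
    have z1 : 0 <= e ^+ 2 * (v k).1 ^+ 2 by nneg.
    have z2 : 0 <= f k ^+ 2 * ro by nneg.
    have := sqr_bound_amgm phi0 z1 z2 ltr01 hL; rewrite mul1r divr1 => /ler_normlP[hL1 _].
    have z3 : 0 <= spread kap J wbar k * om k ^+ 2 * (v k).2 ^+ 2 by have ? := W0 k; nneg.
    rewrite /G /A /B /av /flip1_all /flip1/=.
    set z := (v k).1 in hL1 z1 *; set x := (v k).2 in z3 *; set W := spread _ _ _ _ in z3 *.
    have -> : 2^-1 * (W * (om k ^+ 2 * ((f k + e * z) ^+ 2 * x ^+ 2)) * (c0 - 2 * y) +
       W * (om k ^+ 2 * ((f k + e * - z) ^+ 2 * x ^+ 2)) * (c0 + 2 * y)) =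
      W * om k ^+ 2 * x ^+ 2 * (c0 * (f k ^+ 2 + e ^+ 2 * z ^+ 2) - 4 * (e * z * (f k * y))) by field.
    have -> : W * om k ^+ 2 * (((c0 + 2 * (phi * ro)) * f k ^+ 2 + (c0 + 2 * phi) * e ^+ 2 * z ^+ 2) * x ^+ 2) =
      W * om k ^+ 2 * x ^+ 2 * (c0 * (f k ^+ 2 + e ^+ 2 * z ^+ 2) +
       4 * (phi / 2 * (e ^+ 2 * z ^+ 2 + f k ^+ 2 * ro))) by field.
    by rewrite ler_wpM2l//; lra.
rewrite cm_integral_sum//.
apply: (@le_trans _ _ (\sum_(1 <= k < N.+1) (spread kap J wbar k * om k ^+ 2 * (A k + B))%:E)%E).
  rewrite !big_seq; apply: lee_sum => k; rewrite mem_index_iota ltnS => kN.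
  have /andP[k0 _] := kN.
  rewrite /G nnintZ; first last.
  - by move=> w; have ? := A0 k; nneg.
  - by have ? := W0 k; nneg.
  - exact: (cm_measurable_iid iX (cG' _ kN)).
  rewrite [leRHS]EFinM lee_wpmul2l ?int_quadratic// lee_fin; have ? := W0 k; nneg.
rewrite sumEFin lee_fin.
have -> : \sum_(1 <= k < N.+1) spread kap J wbar k * om k ^+ 2 * (A k + B) =
    \sum_(j < J) (c0 * (wbar j * (sigF j + noise j)) + (2 * (phi * ro) * (wbar j * sigF j) +
      2 * phi * (wbar j * noise j))).
  under eq_bigr do rewrite -mulrA; rewrite (sum_spread kap0 kapS kapJ); apply: eq_bigr => j _.
  have -> : bsm (fun k => om k ^+ 2 * (A k + B)) j =
      (c0 + 2 * (phi * ro)) * sigF j + (c0 + 2 * phi) * noise j.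
    by rewrite /sigF /noise mulrA -!bsumZ -bsumD; apply: eq_bsum_fun => k; rewrite /A /B; ring.
  by ring.
rewrite big_split/= -mulr_sumr lerD//.
  by rewrite ler_wpM2l// sum_wbar_energy.
have -> : 8 * (phi * orisk) = 2 * (phi * ro) * (2 * Ftot) + 2 * phi * (2 * orisk).
  by rewrite /ro; field; rewrite gt_eqF.
rewrite big_split/= -!mulr_sumr.
have pp := phi0; have pr : 0 <= phi * ro by rewrite mulr_ge0.
have a1 : \sum_(j < J) wbar j * sigF j <= 2 * Ftot.
  apply: (@le_trans _ _ (\sum_(j < J) 2 * sigF j)).
    apply: ler_sum => j _; have jJ := ltn_ord j; rewrite ler_wpM2r ?sigF_ge0//.
    by apply: (le_trans (wbar_le jJ)); have := oracle_le1 jJ; lra.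
  by rewrite -mulr_sumr ler_wpM2l// /Ftot lerDr.
have a2 : \sum_(j < J) wbar j * noise j <= 2 * orisk.
  apply: (@le_trans _ _ (\sum_(j < J) 2 * (oracle j * noise j))).
    apply: ler_sum => j _; have jJ := ltn_ord j; rewrite mulrA ler_wpM2r ?wbar_le//.
    by rewrite ltW// noise_gt0.
  by rewrite -mulr_sumr ler_wpM2l// sum_oracle_noise.
have b1 : 0 <= 2 * (phi * ro) by nneg.
have b2 : 0 <= 2 * phi by nneg.
exact: lerD (ler_wpM2l b1 a1) (ler_wpM2l b2 a2).
Qed.

(** The constant collects the 3 of the random signs, the 8 of [(a + b)^4 <= 8 (a^4 + b^4)] and the
    crude moments 65 and 64. Only the order [e^4 F^2] matters, because the term is later multiplied
    by [phi r]. *)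
Lemma fourth_moment :
  (\int[P]_w (Mf (X^~ w) ^+ 4 * goodI (X^~ w))%:E <= (24 * (65 * 64) * e ^+ 4 * Ftot ^+ 2)%:E)%E.
Proof.
have R4 : (\int[P]_w (Mf (X^~ w) ^+ 4 * goodI (X^~ w))%:E <=
    \int[P]_w (3 * ((\sum_(1 <= k < N.+1) mk k (X^~ w) ^+ 2) ^+ 2 * goodI (X^~ w)))%:E)%E.
  exact: (rademacher4 iX cm_mk mk_flip mk_flip' (leqnn N) cm_goodI goodI_ge0 goodI_flip).
apply: (le_trans R4).
have W0 k : 0 <= spread kap J wbar k by apply: spread_ge0; exact: wbar_ge0.
have fe0 k : 0 < f k ^+ 2 + e ^+ 2 by rewrite ltr_wpDl ?sqr_ge0// exprn_gt0.
(* Masses of total at most [Ftot]: dividing [a_k^2] by [f_k^2 + e^2] leaves variables with uniformly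
   bounded second moments, to which Cauchy-Schwarz is applied. *)
pose p k := spread kap J wbar k * (om k ^+ 2 * (f k ^+ 2 + e ^+ 2)).
have p0 k : 0 <= p k by rewrite /p; have ? := W0 k; have ? := ltW (fe0 k); nneg.
have pS : \sum_(1 <= k < N.+1) p k <= Ftot.
  apply: (le_trans sum_wbar).
  have : phi * orisk <= 1 / 100 * orisk by rewrite ler_wpM2r ?phi1// ltW.
  by have := r0; lra.
have cV : coordinate_measurable N (fun v => \sum_(1 <= k < N.+1) mk k v ^+ 2).
  by apply: cm_sum => k; rewrite mem_index_iota ltnS => kN; apply: cmX; exact: cm_mk.
pose G k v := p k * ((1 + (v k).1 ^+ 4) * (v k).2 ^+ 4).
have G0 k v : 0 <= G k v.
  by rewrite /G; have ? := p0 k; have ? := pow4_ge0 (v k).1; have ? := pow4_ge0 (v k).2; nneg.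
have cG' k : (0 < k <= N)%N ->
    coordinate_measurable N (fun v => (1 + (v k).1 ^+ 4) * (v k).2 ^+ 4).
  move=> kN; apply: cmM; last by apply: cmX; exact: cm_snd.
  by apply: cmD; [exact: cm_cst|apply: cmX; exact: cm_fst].
have cG k : k \in index_iota 1 N.+1 -> coordinate_measurable N (G k).
  by rewrite mem_index_iota ltnS => kN; apply: cmZ; exact: cG'.
have C0 : 0 <= 24 * e ^+ 4 * Ftot by have ? := ltW F0; have ? := pow4_ge0 e; nneg.
apply: (@le_trans _ _ (\int[P]_w (24 * e ^+ 4 * Ftot * \sum_(1 <= k < N.+1) G k (X^~ w))%:E)%E).
  apply: nnint_le.
  - exact: (cm_measurable_iid iX (cmZ _ (cmM (cmX 2 cV) cm_goodI))).
  - exact: (cm_measurable_iid iX (cmZ _ (cm_sum cG))).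
  - by move=> w; have ? := goodI_ge0 (X^~ w); nneg.
  move=> w; move: (X^~ w) => v; have [gv|gv] := pselect (good v); last first.
    move/goodP/negbTE: gv => h; rewrite /goodI h !mulr0 mulr_ge0//; exact: sumr_ge0.
  have -> : goodI v = 1 by rewrite /goodI; move/goodP: gv => ->.
  rewrite mulr1.
  apply: (@le_trans _ _ (3 * (e ^+ 2 * Vp v) ^+ 2)).
    have V0 := Vp_ge0 v.
    rewrite ler_wpM2l// ler_sqr ?nnegrE ?sum_mk_sqr//; last by nneg.
    by apply: sumr_ge0 => k _; exact: sqr_ge0.
  have E : Vp v = \sum_(1 <= k < N.+1) p k * (av v k ^+ 2 * (v k).2 ^+ 2 / (f k ^+ 2 + e ^+ 2)).
    by apply: eq_bigr => k _; rewrite /p; field; rewrite gt_eqF.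
  have := wsum_sqr_le (fun k => av v k ^+ 2 * (v k).2 ^+ 2 / (f k ^+ 2 + e ^+ 2)) p0 F0 pS.
  rewrite -E => h.
  have -> : 3 * (e ^+ 2 * Vp v) ^+ 2 = 3 * e ^+ 4 * Vp v ^+ 2 by ring.
  have -> : 24 * e ^+ 4 * Ftot * \sum_(1 <= k < N.+1) G k v =
    3 * e ^+ 4 * (Ftot * (8 * \sum_(1 <= k < N.+1) G k v)) by ring.
  have e34 : 0 <= 3 * e ^+ 4 by have ? := pow4_ge0 e; nneg.
  apply: (ler_wpM2l e34); apply: (le_trans h).
  rewrite ler_wpM2l ?(ltW F0)// mulr_sumr; apply: ler_sum => k _.
  rewrite /G [leRHS]mulrCA ler_wpM2l// expr_div_n ler_pdivrMr ?exprn_gt0// /av.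
  set z := (v k).1; set x := (v k).2; set a := f k.
  have x4 := pow4_ge0 x; have z4 := pow4_ge0 z; have e4 := pow4_ge0 e; have a4 := pow4_ge0 a.
  have h1 : (a + e * z) ^+ 4 <= 8 * (a ^+ 4 + e ^+ 4 * z ^+ 4).
    rewrite -exprMn; move: (e * z) => b.
    have q1 : (a + b) ^+ 2 <= 2 * (a ^+ 2 + b ^+ 2).
      by rewrite -subr_ge0 (_ : _ - _ = (a - b) ^+ 2) ?sqr_ge0//; ring.
    have q2 : ((a + b) ^+ 2) ^+ 2 <= (2 * (a ^+ 2 + b ^+ 2)) ^+ 2.
      by rewrite ler_sqr ?nnegrE ?sqr_ge0//; nneg.
    rewrite (_ : 4 = 2 * 2)%N// [_ ^+ (2 * 2)]exprM; apply: (le_trans q2).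
    rewrite -subr_ge0 !exprM (_ : _ - _ = 4 * (a ^+ 2 - b ^+ 2) ^+ 2); last by ring.
    by nneg.
  have h2 : a ^+ 4 + e ^+ 4 * z ^+ 4 <= (a ^+ 2 + e ^+ 2) ^+ 2 * (1 + z ^+ 4).
    rewrite -subr_ge0 (_ : _ - _ = e ^+ 4 + 2 * (a ^+ 2 * e ^+ 2) +
      z ^+ 4 * (a ^+ 4 + 2 * (a ^+ 2 * e ^+ 2))); last by ring.
    by nneg.
  have -> : ((a + e * z) ^+ 2 * x ^+ 2) ^+ 2 = (a + e * z) ^+ 4 * x ^+ 4 by ring.
  have -> : 8 * ((1 + z ^+ 4) * x ^+ 4) * (a ^+ 2 + e ^+ 2) ^+ 2 =
    8 * ((a ^+ 2 + e ^+ 2) ^+ 2 * (1 + z ^+ 4)) * x ^+ 4 by ring.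
  by rewrite ler_wpM2r//; apply: (le_trans h1); rewrite ler_wpM2l.
rewrite nnintZ//; first last.
- by move=> w; apply: sumr_ge0.
- exact: (cm_measurable_iid iX (cm_sum cG)).
have -> : 24 * (65 * 64) * e ^+ 4 * Ftot ^+ 2 = 24 * e ^+ 4 * Ftot * ((65 * 64) * Ftot) by ring.
rewrite [leRHS]EFinM lee_wpmul2l ?lee_fin// cm_integral_sum//.
apply: (@le_trans _ _ (\sum_(1 <= k < N.+1) ((65 * 64) * p k)%:E)%E).
  rewrite !big_seq; apply: lee_sum => k; rewrite mem_index_iota ltnS => kN.
  have /andP[k0 _] := kN.
  rewrite /G nnintZ//; first last.
  - by move=> w; have ? := pow4_ge0 (X k w).1; have ? := pow4_ge0 (X k w).2; nneg.
  - exact: (cm_measurable_iid iX (cG' _ kN)).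
  by rewrite mulrC [leRHS]EFinM lee_wpmul2l ?lee_fin// int_quartic.
by rewrite sumEFin lee_fin -mulr_sumr ler_wpM2l.
Qed.

Lemma integral_bool (b : Omega -> bool) : measurable_fun setT b ->
  (\int[P]_w ((b w)%:R)%:E = P [set w | b w])%E.
Proof.
move=> mb.
have mE : measurable [set w | b w].
  by have := mb measurableT [set true] I; rewrite setTI.
rewrite -[X in P X]setIT -integral_indic//; apply: eq_integral => w _.
by rewrite indicE; congr ((_ : bool)%:R)%:E; apply/idP/idP; rewrite inE.
Qed.

Lemma block_len_gt0 j : (j < J)%N -> 0 < (kap j.+1 - kap j)%N%:R :> R.
Proof. by move=> jJ; rewrite ltr0n subn_gt0 kapS. Qed.

Lemma block_iota_gt0 j : (j < J)%N -> all (fun k => 0 < k)%N (index_iota (kap j) (kap j.+1)).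
Proof.
move=> jJ; apply/allP => k; rewrite mem_index_iota => kj.
by have /andP[] := block_range kap0 kapS kapJ jJ kj.
Qed.

Lemma om_le j k : (j < J)%N -> (kap j <= k < kap j.+1)%N ->
  e ^+ 2 * om k ^+ 2 <= 3 * noise j / (kap j.+1 - kap j)%N%:R.
Proof. by move=> jJ kj; rewrite ler_pdivlMr ?block_len_gt0// omT. Qed.

Lemma Lb_eq0 v j : sigF j = 0 -> Lb v j = 0.
Proof.
move=> F0'; rewrite /Lb; suff -> : bsm (fun k => om k ^+ 2 * (f k * (v k).1)) j = 0 by rewrite mulr0.
rewrite /bsum big_seq big1// => k kj.
have : om k ^+ 2 * f k ^+ 2 == 0.
  move/eqP: F0'; rewrite /sigF /bsum psumr_eq0 => [/allP/(_ _ kj)//|i _].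
  by rewrite mulr_ge0 ?sqr_ge0.
by rewrite -exprMn sqrf_eq0 mulf_eq0 => /orP[]/eqP ->; rewrite ?mul0r ?expr0n/= ?mul0r ?mulr0.
Qed.

Lemma chernoff_bool (Y : nat -> Omega -> T * T) (s : seq nat) (q : nat -> T * T -> R) (c : nat -> R) (t : R) :
  iid_pairs P Y -> uniq s -> all (fun k => 0 < k)%N s ->
  (forall k, measurable_fun setT (q k)) ->
  (forall k, k \in s -> \int[pair_law]_z (expR (q k z))%:E <= (expR (c k))%:E)%E ->
  (\int[P]_w (((t <= \sum_(k <- s) q k (Y k w))%R : bool)%:R)%:E <=
   (expR (\sum_(k <- s) c k - t))%:E)%E.
Proof.
move=> iY us s0 mq hq; have := chernoff_pairs t iY us s0 mq hq => ch; rewrite integral_bool; first exact: ch.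
have [mY _] := iY; apply: measurable_fun_ler => //.
rewrite (_ : (fun w => _) = fun w => \sum_(k <- s | (0 < k)%N) q k (Y k w)).
  by apply: measurable_bigsum => k k0; exact: measurableT_comp (mq k) (mY k k0).
apply/funext => w; rewrite [LHS]big_seq [RHS]big_seq_cond.
by apply: eq_bigl => k; case: (boolP (k \in s)) => //= ks; rewrite (allP s0 _ ks).
Qed.

(** Gaussian Chernoff bound for one sign of [L]. A block without signal is treated apart, as the
    optimal parameter would divide by zero; there [L] vanishes and the event is empty. *)
Lemma linear_tail j (sg : R) : (j < J)%N -> sg ^+ 2 = 1 ->
  (\int[P]_w (1 - ((sg * Lb (X^~ w) j <= ph j * Num.sqrt (sigF j * noise j))%R : bool)%:R)%:E <=
   (expR (- (5 * l)))%:E)%E.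
Proof.
move=> jJ sg1; have n0 := noise_gt0 jJ; have T0 := block_len_gt0 jJ.
have [F0'|F0'] := eqVneq (sigF j) 0.
  rewrite integral0_eq ?lee_fin ?expR_ge0// => w _.
  by rewrite Lb_eq0// mulr0 F0' mul0r sqrtr0 mulr0 lexx subrr.
have {}F0' : 0 < sigF j by rewrite lt_neqAle eq_sym F0' sigF_ge0.
set g := Num.sqrt _; set t := (kap j.+1 - kap j)%N%:R in T0.
have g0 : 0 < g by rewrite sqrtr_gt0 mulr_gt0.
have g2 : g ^+ 2 = sigF j * noise j by rewrite sqr_sqrtr// mulr_ge0// ltW.
have /andP[p0 _] := ph0 jJ.
(* Minimizes the exponent [6 m^2 g^2 / t - m ph g]; the minimum is [- ph^2 t / 24 = - 5 l]. *)
pose m := ph j * t / (12 * g).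
have m0 : 0 < m by rewrite divr_gt0 ?mulr_gt0.
pose c k := m * sg * (2 * e * (om k ^+ 2 * f k)).
have S w : \sum_(kap j <= k < kap j.+1) c k * (X k w).1 = m * (sg * Lb (X^~ w) j).
  rewrite /Lb /bsum !mulr_sumr; apply: eq_bigr => k _; rewrite /c; ring.
have mq k : measurable_fun setT (fun z : T * T => c k * z.1).
  by apply: measurable_funM => //; exact: measurable_fst.
have := @chernoff_bool X (index_iota (kap j) (kap j.+1)) (fun k z => c k * z.1)
  (fun k => c k ^+ 2 / 2) (m * (ph j * g)) iX (iota_uniq _ _) (block_iota_gt0 jJ) mq.
have hq k : k \in index_iota (kap j) (kap j.+1) ->
    (\int[pair_law]_z (expR (c k * z.1))%:E <= (expR (c k ^+ 2 / 2))%:E)%E.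
  by move=> _; rewrite g2_expR_lin.
move=> /(_ hq).
have H : \sum_(k <- index_iota (kap j) (kap j.+1)) c k ^+ 2 / 2 - m * (ph j * g) <= - (5 * l).
  have : \sum_(k <- index_iota (kap j) (kap j.+1)) c k ^+ 2 / 2 <= 2 * m ^+ 2 * (3 * noise j / t * sigF j).
    have -> : 2 * m ^+ 2 * (3 * noise j / t * sigF j) =
        bsm (fun k => 2 * m ^+ 2 * (3 * noise j / t * (om k ^+ 2 * f k ^+ 2))) j.
      by rewrite !bsumZ.
    apply: ler_bsum => k kj; have h := om_le jJ kj.
    have -> : c k ^+ 2 / 2 = 2 * m ^+ 2 * (e ^+ 2 * om k ^+ 2 * (om k ^+ 2 * f k ^+ 2)).
      have -> : c k ^+ 2 / 2 = sg ^+ 2 * (2 * m ^+ 2 * (e ^+ 2 * om k ^+ 2 * (om k ^+ 2 * f k ^+ 2))).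
        by rewrite /c; field.
      by rewrite sg1 mul1r.
    by apply: ler_wpM2l; [nneg|apply: ler_wpM2r => //; nneg].
  have -> : 2 * m ^+ 2 * (3 * noise j / t * sigF j) = ph j ^+ 2 * t / 24.
    have -> : 2 * m ^+ 2 * (3 * noise j / t * sigF j) = 6 * m ^+ 2 * (sigF j * noise j) / t.
      by field; rewrite gt_eqF.
    by rewrite -g2 /m; field; rewrite !gt_eqF.
  have -> : m * (ph j * g) = ph j ^+ 2 * t / 12 by rewrite /m; field; rewrite gt_eqF.
  by rewrite /t (phT jJ); lra.
move=> ch; apply: (@le_trans _ _ (expR (\sum_(k <- index_iota (kap j) (kap j.+1)) c k ^+ 2 / 2 -
  m * (ph j * g)))%:E); last by rewrite lee_fin ler_expR.
apply: le_trans ch; apply: nnint_le.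
- have c1 : coordinate_measurable N (fun v => 1 - (((sg * Lb v j <= ph j * g)%R : bool)%:R : R)).
    apply: cmB; first exact: cm_cst.
    by apply: cm_le; [apply: cmZ; exact: cm_Lb|exact: cm_cst].
  exact: (cm_measurable_iid iX c1).
- have c1 : coordinate_measurable N (fun v => (((m * (ph j * g) <= m * (sg * Lb v j))%R : bool)%:R : R)).
    apply: cm_le; first exact: cm_cst.
    by do 2 apply: cmZ; exact: cm_Lb.
  have := cm_measurable_iid iX c1; congr measurable_fun; apply/funext => w; by rewrite S.
- by move=> w; case: (sg * Lb _ _ <= _); rewrite ?subrr ?subr0.
- move=> w; rewrite S ler_pM2l//; case: (leP (sg * Lb _ _)) => h; first by rewrite subrr ler0n.
  by rewrite (ltW h) subr0.
Qed.

(** The four choices of signs give [Q], [- Q], [D] and [- D], so that one tail bound serves all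
    quadratic conditions. *)
Definition Sb (s1 s2 : R) v j :=
  e ^+ 2 * bsm (fun k => om k ^+ 2 * (s1 * ((v k).1 ^+ 2 - 1) + s2 * ((v k).2 ^+ 2 - 1))) j.

Lemma cm_Sb s1 s2 j : (j < J)%N -> coordinate_measurable N (fun v => Sb s1 s2 v j).
Proof.
move=> jJ; apply/cmZ/cm_bsum => // k kN; apply: cmZ; apply: cmD; apply: cmZ; apply: cmB;
  try exact: cm_cst; apply: cmX; [exact: cm_fst|exact: cm_snd].
Qed.

Lemma quadratic_tail j (s1 s2 : R) : (j < J)%N -> s1 ^+ 2 = 1 -> s2 ^+ 2 = 1 ->
  (\int[P]_w (((19 / 20 * (ph j * noise j) <= Sb s1 s2 (X^~ w) j)%R : bool)%:R)%:E <=
   (expR (- (3 * l)))%:E)%E.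
Proof.
move=> jJ sg1 sg2; have n0 := noise_gt0 jJ; have T0 := block_len_gt0 jJ.
set t := (kap j.+1 - kap j)%N%:R in T0.
have /andP[p0 p1] := ph0 jJ; have p2 := le_trans p1 phi1.
(* Minimizes [9 m^2 s^2 / t - (19/20) m ph s], with [s] the block noise. The minimum
   [- (19/20)^2 * 120 l / 36] is just below [- 3 l], which accounts for the fraction 19/20. *)
pose m := 19 / 20 * (ph j * t) / (18 * noise j).
have h19 : 0 < 19 / 20 :> R by lra.
have m0 : 0 < m.
  by apply: divr_gt0; [apply: mulr_gt0 => //; exact: mulr_gt0|exact: mulr_gt0].
pose c k := m * (e ^+ 2 * om k ^+ 2).
have S w : \sum_(kap j <= k < kap j.+1) (c k * s1 * ((X k w).1 ^+ 2 - 1) + c k * s2 * ((X k w).2 ^+ 2 - 1)) =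
    m * Sb s1 s2 (X^~ w) j.
  rewrite /Sb /bsum !mulr_sumr; apply: eq_bigr => k _; rewrite /c; ring.
have msq : measurable_fun [set: T] (fun x : T => x ^+ 2 - 1).
  by apply: measurable_funB => //; exact: measurable_funX.
have mq k : measurable_fun setT (fun z : T * T => c k * s1 * (z.1 ^+ 2 - 1) + c k * s2 * (z.2 ^+ 2 - 1)).
  apply: measurable_funD; apply: measurable_funM => //.
    exact: (measurableT_comp msq measurable_fst).
  exact: (measurableT_comp msq measurable_snd).
have c0 k : 0 <= c k by rewrite /c; nneg.
have sb (s : R) : s ^+ 2 = 1 -> -1 <= s <= 1.
  move=> s2'; have : `|s| ^+ 2 <= 1 ^+ 2 by rewrite real_normK ?num_real// s2' expr1n.
  by rewrite ler_sqr ?nnegrE// => /ler_normlP[a b]; apply/andP; split; lra.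
have cs (k : nat) (s : R) : s ^+ 2 = 1 -> c k <= 1 / 20 -> - (1 / 20) <= c k * s <= 1 / 20.
  by move=> /sb /andP[a b] ck; have := c0 k => ck0; apply/andP; split; nra.
have ck k : k \in index_iota (kap j) (kap j.+1) -> c k <= 1 / 20.
  rewrite mem_index_iota => kj; have := ler_wpM2l (ltW m0) (om_le jJ kj).
  rewrite -/t -/(c k) => /le_trans; apply.
  have -> : m * (3 * noise j / t) = 19 / 120 * ph j by rewrite /m; field; rewrite !gt_eqF.
  by lra.
have := @chernoff_bool X (index_iota (kap j) (kap j.+1))
  (fun k z => c k * s1 * (z.1 ^+ 2 - 1) + c k * s2 * (z.2 ^+ 2 - 1))
  (fun k => 3 / 2 * ((c k * s1) ^+ 2 + (c k * s2) ^+ 2)) (m * (19 / 20 * (ph j * noise j)))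
  iX (iota_uniq _ _) (block_iota_gt0 jJ) mq.
move=> /(_ (fun k kj => g2_expR_chisq (cs k s1 sg1 (ck k kj)) (cs k s2 sg2 (ck k kj)))).
under eq_integral do rewrite S ler_pM2l//.
move=> /le_trans; apply; rewrite lee_fin ler_expR.
have : \sum_(k <- index_iota (kap j) (kap j.+1)) 3 / 2 * ((c k * s1) ^+ 2 + (c k * s2) ^+ 2) <=
    3 * m ^+ 2 * (3 * noise j / t * noise j).
  have -> : 3 * m ^+ 2 * (3 * noise j / t * noise j) =
      bsm (fun k => 3 * m ^+ 2 * (3 * noise j / t * (e ^+ 2 * om k ^+ 2))) j.
    by rewrite !bsumZ.
  apply: ler_bsum => k kj; have h := om_le jJ kj.
  have -> : 3 / 2 * ((c k * s1) ^+ 2 + (c k * s2) ^+ 2) = 3 * m ^+ 2 * (e ^+ 2 * om k ^+ 2 * (e ^+ 2 * om k ^+ 2)).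
    by rewrite !(exprMn _ _ s1) !(exprMn _ _ s2) sg1 sg2 /c; field.
  by apply: ler_wpM2l; [nneg|apply: ler_wpM2r => //; nneg].
have -> : 3 * m ^+ 2 * (3 * noise j / t * noise j) = (19 / 20) ^+ 2 * (ph j ^+ 2 * t) / 36.
  by rewrite /m; field; rewrite !gt_eqF.
have -> : m * (19 / 20 * (ph j * noise j)) = (19 / 20) ^+ 2 * (ph j ^+ 2 * t) / 18.
  by rewrite /m; field; rewrite gt_eqF.
rewrite /t (phT jJ); have l0 := l1; rewrite expr2; lra.
Qed.

(* [bad] dominates the indicator of the complement of the good event; every summand is a Chernoff
   event. *)
Definition lin_bad (sg : R) v j : R :=
  1 - ((sg * Lb v j <= ph j * Num.sqrt (sigF j * noise j))%R : bool)%:R.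
Definition quad_bad (s1 s2 : R) v j : R :=
  ((19 / 20 * (ph j * noise j) <= Sb s1 s2 v j)%R : bool)%:R.
Definition bad_block v j := lin_bad 1 v j + lin_bad (-1) v j + quad_bad 1 1 v j +
  quad_bad (-1) (-1) v j + quad_bad 1 (-1) v j + quad_bad (-1) 1 v j.
Definition bad v := \sum_(j <- index_iota 0 J) bad_block v j.

Lemma lin_bad_ge0 sg v j : 0 <= lin_bad sg v j.
Proof. by rewrite /lin_bad; case: (sg * Lb _ _ <= _); rewrite ?subrr ?subr0. Qed.

Lemma quad_bad_ge0 s1 s2 v j : 0 <= quad_bad s1 s2 v j.
Proof. exact: ler0n. Qed.

Lemma cm_lin_bad sg j : (j < J)%N -> coordinate_measurable N (fun v => lin_bad sg v j).
Proof.
move=> jJ; apply: cmB; first exact: cm_cst.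
by apply: cm_le; [apply: cmZ; exact: cm_Lb|exact: cm_cst].
Qed.

Lemma cm_quad_bad s1 s2 j : (j < J)%N -> coordinate_measurable N (fun v => quad_bad s1 s2 v j).
Proof. by move=> jJ; apply: cm_le; [exact: cm_cst|exact: cm_Sb]. Qed.

Lemma bad_block_ge0 v j : 0 <= bad_block v j.
Proof. by do 4 (apply: addr_ge0; last exact: quad_bad_ge0); apply: addr_ge0; exact: lin_bad_ge0. Qed.

Lemma cm_bad_block j : j \in index_iota 0 J -> coordinate_measurable N (bad_block^~ j).
Proof.
rewrite mem_index_iota /= => jJ.
by do 5 (apply: cmD; last by apply: cm_quad_bad || apply: cm_lin_bad); exact: cm_lin_bad.
Qed.

Lemma bad_ge0 v : 0 <= bad v.
Proof. by apply: sumr_ge0 => j _; exact: bad_block_ge0. Qed.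

Lemma cm_bad : coordinate_measurable N bad.
Proof. by apply: cm_sum => j; exact: cm_bad_block. Qed.

(** A sum of indicators below 1 vanishes, so every one-sided bound holds; the two for [L] combine
    into the bound on its square. *)
Lemma bad_lt1 v : bad v < 1 -> good v.
Proof.
move=> hb j jJ.
have /andP[p0 _] := ph0 jJ; have n0 := noise_gt0 jJ.
have pn : 0 < ph j * noise j by rewrite mulr_gt0.
have {}hb : bad_block v j < 1.
  apply: le_lt_trans hb; rewrite /bad big_mkord (bigD1 (Ordinal jJ))//= lerDl sumr_ge0// => i _.
  exact: bad_block_ge0.
have q s1 s2 : quad_bad s1 s2 v j < 1 -> Sb s1 s2 v j < 19 / 20 * (ph j * noise j).
  by rewrite /quad_bad; case: (leP (19 / 20 * _) (Sb s1 s2 v j)) => // _; rewrite ltxx.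
have L sg : lin_bad sg v j < 1 -> sg * Lb v j <= ph j * Num.sqrt (sigF j * noise j).
  by rewrite /lin_bad; case: (leP (sg * Lb v j)) => //= _; rewrite subr0 ltxx.
have a1 := lin_bad_ge0 1 v j; have a2 := lin_bad_ge0 (-1) v j.
have a3 := quad_bad_ge0 1 1 v j; have a4 := quad_bad_ge0 (-1) (-1) v j.
have a5 := quad_bad_ge0 1 (-1) v j; have a6 := quad_bad_ge0 (-1) 1 v j.
rewrite /bad_block in hb.
have b1 : lin_bad 1 v j < 1 by lra.
have b2 : lin_bad (-1) v j < 1 by lra.
have b3 : quad_bad 1 1 v j < 1 by lra.
have b4 : quad_bad (-1) (-1) v j < 1 by lra.
have b5 : quad_bad 1 (-1) v j < 1 by lra.
have b6 : quad_bad (-1) 1 v j < 1 by lra.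
have {b1}b1 := L _ b1; have {b2}b2 := L _ b2.
have {b3}b3 := q _ _ b3; have {b4}b4 := q _ _ b4; have {b5}b5 := q _ _ b5; have {b6}b6 := q _ _ b6.
have E1 : Sb 1 1 v j = Qb v j.
  by congr (_ * _); apply: eq_bsum_fun => k; ring.
have E2 : Sb (-1) (-1) v j = - Qb v j.
  rewrite /Qb -mulrN; congr (_ * _); rewrite -[RHS]mulN1r -bsumZ.
  by apply: eq_bsum_fun => k; ring.
have E3 : Sb 1 (-1) v j = Db v j.
  by congr (_ * _); apply: eq_bsum_fun => k; ring.
have E4 : Sb (-1) 1 v j = - Db v j.
  rewrite /Db -mulrN; congr (_ * _); rewrite -[RHS]mulN1r -bsumZ.
  by apply: eq_bsum_fun => k; ring.
rewrite E1 in b3; rewrite E2 in b4; rewrite E3 in b5; rewrite E4 in b6.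
split; last 2 first.
- by apply/andP; split; lra.
- by apply/andP; split; lra.
have h1 : `|Lb v j| <= ph j * Num.sqrt (sigF j * noise j) by apply/ler_normlP; split; lra.
rewrite -(sqr_sqrtr (_ : 0 <= sigF j * noise j)); last by rewrite mulr_ge0 ?sigF_ge0// ltW.
rewrite -exprMn -[leLHS](real_normK (num_real _)) ler_sqr ?nnegrE//.
by rewrite mulr_ge0 ?sqrtr_ge0// ltW.
Qed.

Lemma cm_integralD_le (a b : (nat -> T * T) -> R) (x y : R) :
  coordinate_measurable N a -> coordinate_measurable N b ->
  (forall v, 0 <= a v) -> (forall v, 0 <= b v) ->
  (\int[P]_w (a (X^~ w))%:E <= x%:E)%E -> (\int[P]_w (b (X^~ w))%:E <= y%:E)%E ->
  (\int[P]_w (a (X^~ w) + b (X^~ w))%:E <= (x + y)%:E)%E.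
Proof.
move=> ca cb a0 b0 ax bx.
rewrite (@nnintD _ _ _ P (fun w => a (X^~ w)) (fun w => b (X^~ w)))//.
- by rewrite EFinD leeD.
- exact: (cm_measurable_iid iX ca).
- exact: (cm_measurable_iid iX cb).
Qed.

Lemma cm_integralZ_le (a : (nat -> T * T) -> R) (c x : R) : 0 <= c ->
  coordinate_measurable N a -> (forall v, 0 <= a v) ->
  (\int[P]_w (a (X^~ w))%:E <= x%:E)%E -> (\int[P]_w (c * a (X^~ w))%:E <= (c * x)%:E)%E.
Proof.
move=> c0 ca a0 ax; rewrite (@nnintZ _ _ _ P c (fun w => a (X^~ w)))//.
  by rewrite [leRHS]EFinM lee_wpmul2l ?lee_fin.
exact: (cm_measurable_iid iX ca).
Qed.

Lemma bad_small : (\int[P]_w (bad (X^~ w))%:E <= (6 * J%:R * expR (- (3 * l)))%:E)%E.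
Proof.
rewrite /bad (@cm_integral_sum _ (fun j v => bad_block v j));
  [|exact: cm_bad_block|by move=> j v; exact: bad_block_ge0].
apply: (@le_trans _ _ (\sum_(j <- index_iota 0 J) (6 * expR (- (3 * l)))%:E)%E); last first.
  by rewrite sumEFin lee_fin sumr_const_nat subn0 -mulr_natr; lra.
rewrite !big_seq; apply: lee_sum => j; rewrite mem_index_iota /= => jJ.
have one2 : 1 ^+ 2 = 1 :> R by rewrite expr1n.
have mone2 : (-1) ^+ 2 = 1 :> R by rewrite sqrrN expr1n.
have e53 : expR (- (5 * l)) <= expR (- (3 * l)) by rewrite ler_expR; have := l1; lra.
have lin sg : sg ^+ 2 = 1 -> (\int[P]_w (lin_bad sg (X^~ w) j)%:E <= (expR (- (3 * l)))%:E)%E.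
  by move=> sg1; apply: (le_trans (linear_tail jJ sg1)); rewrite lee_fin.
have quad s1 s2 : s1 ^+ 2 = 1 -> s2 ^+ 2 = 1 ->
    (\int[P]_w (quad_bad s1 s2 (X^~ w) j)%:E <= (expR (- (3 * l)))%:E)%E.
  by move=> h1 h2; exact: quadratic_tail.
have cL sg := cm_lin_bad sg jJ; have cQ s1 s2 := cm_quad_bad s1 s2 jJ.
have -> : 6 * expR (- (3 * l)) = expR (- (3 * l)) + expR (- (3 * l)) + expR (- (3 * l)) +
  expR (- (3 * l)) + expR (- (3 * l)) + expR (- (3 * l)) by ring.
rewrite /bad_block.
have p0 sg v := lin_bad_ge0 sg v j; have q0 s1 s2 v := quad_bad_ge0 s1 s2 v j.
have S1 := cm_integralD_le (cL 1) (cL (-1)) (p0 1) (p0 (-1)) (lin _ one2) (lin _ mone2).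
have c1 := cmD (cL 1) (cL (-1)); have z1 v := addr_ge0 (p0 1 v) (p0 (-1) v).
have S2 := cm_integralD_le c1 (cQ 1 1) z1 (q0 1 1) S1 (quad _ _ one2 one2).
have c2 := cmD c1 (cQ 1 1); have z2 v := addr_ge0 (z1 v) (q0 1 1 v).
have S3 := cm_integralD_le c2 (cQ (-1) (-1)) z2 (q0 (-1) (-1)) S2 (quad _ _ mone2 mone2).
have c3 := cmD c2 (cQ (-1) (-1)); have z3 v := addr_ge0 (z2 v) (q0 (-1) (-1) v).
have S4 := cm_integralD_le c3 (cQ 1 (-1)) z3 (q0 1 (-1)) S3 (quad _ _ one2 mone2).
have c4 := cmD c3 (cQ 1 (-1)); have z4 v := addr_ge0 (z3 v) (q0 1 (-1) v).
exact: (cm_integralD_le c4 (cQ (-1) 1) z4 (q0 (-1) 1) S4 (quad _ _ mone2 one2)).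
Qed.

(** Only the first pair appears because the preliminary estimate uses the first harmonic alone. *)
Definition far (ka : R) v : R :=
  ((ka <= (v 1%N).1)%R : bool)%:R + ((ka <= - (v 1%N).1)%R : bool)%:R +
  ((ka <= (v 1%N).2)%R : bool)%:R + ((ka <= - (v 1%N).2)%R : bool)%:R.

Lemma gaussian_tail (Y : nat -> Omega -> T * T) (sg ka : R) : iid_pairs P Y -> 0 < ka -> sg ^+ 2 = 1 ->
  (\int[P]_w (((ka <= sg * (Y 1%N w).1)%R : bool)%:R)%:E <= (expR (- (ka ^+ 2 / 2)))%:E)%E.
Proof.
move=> iY k0 sg1.
have mq (k : nat) : measurable_fun setT (fun z : T * T => ka * sg * z.1).
  by apply: measurable_funM => //; exact: measurable_fst.
have hq (k : nat) : k \in [:: 1%N] ->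
    (\int[pair_law]_z (expR (ka * sg * z.1))%:E <= (expR ((ka * sg) ^+ 2 / 2))%:E)%E.
  by move=> _; rewrite g2_expR_lin.
have := @chernoff_bool Y [:: 1%N] (fun _ z => ka * sg * z.1) (fun=> (ka * sg) ^+ 2 / 2) (ka * ka)
  iY isT isT (fun=> mq 1%N) hq.
rewrite big_seq1 exprMn sg1 mulr1.
have -> : ka ^+ 2 / 2 - ka * ka = - (ka ^+ 2 / 2) by field.
by under eq_integral do rewrite big_seq1 -mulrA ler_pM2l//.
Qed.

Lemma far_ge0 ka v : 0 <= far ka v.
Proof. by rewrite !addr_ge0// ler0n. Qed.

Lemma cm_far ka : (0 < N)%N -> coordinate_measurable N (far ka).
Proof.
move=> N0; have n1 : (0 < 1 <= N)%N by [].
by do 3 (apply: cmD; last by apply: cm_le; [exact: cm_cst|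
    exact: cm_snd || (apply: cmN; exact: cm_snd) || (apply: cmN; exact: cm_fst)]);
  apply: cm_le; [exact: cm_cst|exact: cm_fst].
Qed.

Lemma far_small ka : (0 < N)%N -> 0 < ka ->
  (\int[P]_w (far ka (X^~ w))%:E <= (4 * expR (- (ka ^+ 2 / 2)))%:E)%E.
Proof.
move=> N0 k0; have n1 : (0 < 1 <= N)%N by [].
have one2 : 1 ^+ 2 = 1 :> R by rewrite expr1n.
have mone2 : (-1) ^+ 2 = 1 :> R by rewrite sqrrN expr1n.
have rot1 : (0 : R) ^+ 2 + 1 ^+ 2 = 1 by rewrite expr0n expr1n add0r.
(* A quarter-turn brings the second component, up to sign, into first position, so the tail bound
   for first components serves all four events. *)
pose rot (k : nat) : T * T -> T * T := plane_rot 0 1.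
have pr k : g2_preserving (rot k) by exact: rot_preserving.
have iY : iid_pairs P (fun k w => rot k (X k w)).
  by apply: (iid_law_map (f := rot) iX); [move=> k; case: (pr k)|move=> k B mB; case: (pr k) => _; apply].
have E1 (z : T * T) : 1 * z.1 = z.1 by rewrite mul1r.
have E2 (z : T * T) : -1 * z.1 = - z.1 by rewrite mulN1r.
have E3 (z : T * T) : -1 * (rot 1%N z).1 = z.2 by rewrite /rot /plane_rot/=; ring.
have E4 (z : T * T) : 1 * (rot 1%N z).1 = - z.2 by rewrite /rot /plane_rot/=; ring.
have t1 : (\int[P]_w (((ka <= (X 1%N w).1)%R : bool)%:R)%:E <= (expR (- (ka ^+ 2 / 2)))%:E)%E.
  by have := gaussian_tail iX k0 one2; under eq_integral do rewrite E1.
have t2 : (\int[P]_w (((ka <= - (X 1%N w).1)%R : bool)%:R)%:E <= (expR (- (ka ^+ 2 / 2)))%:E)%E.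
  by have := gaussian_tail iX k0 mone2; under eq_integral do rewrite E2.
have t3 : (\int[P]_w (((ka <= (X 1%N w).2)%R : bool)%:R)%:E <= (expR (- (ka ^+ 2 / 2)))%:E)%E.
  by have := gaussian_tail iY k0 mone2; under eq_integral do rewrite E3.
have t4 : (\int[P]_w (((ka <= - (X 1%N w).2)%R : bool)%:R)%:E <= (expR (- (ka ^+ 2 / 2)))%:E)%E.
  by have := gaussian_tail iY k0 one2; under eq_integral do rewrite E4.
have -> : 4 * expR (- (ka ^+ 2 / 2)) = expR (- (ka ^+ 2 / 2)) + expR (- (ka ^+ 2 / 2)) +
  expR (- (ka ^+ 2 / 2)) + expR (- (ka ^+ 2 / 2)) by ring.
have c1 : coordinate_measurable N (fun v => ((ka <= (v 1%N).1)%R : bool)%:R).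
  by apply: cm_le; [exact: cm_cst|exact: cm_fst].
have c2 : coordinate_measurable N (fun v => ((ka <= - (v 1%N).1)%R : bool)%:R).
  by apply: cm_le; [exact: cm_cst|apply: cmN; exact: cm_fst].
have c3 : coordinate_measurable N (fun v => ((ka <= (v 1%N).2)%R : bool)%:R).
  by apply: cm_le; [exact: cm_cst|exact: cm_snd].
have c4 : coordinate_measurable N (fun v => ((ka <= - (v 1%N).2)%R : bool)%:R).
  by apply: cm_le; [exact: cm_cst|apply: cmN; exact: cm_snd].
have b0 (b : (nat -> T * T) -> bool) v : 0 <= (b v)%:R :> R by exact: ler0n.
have S1 := cm_integralD_le c1 c2 (b0 _) (b0 _) t1 t2.
have z1 v : 0 <= ((ka <= (v 1%N).1)%R : bool)%:R + ((ka <= - (v 1%N).1)%R : bool)%:R :> R by rewrite addr_ge0.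
have S2 := cm_integralD_le (cmD c1 c2) c3 z1 (b0 _) S1 t3.
have z2 v : 0 <= ((ka <= (v 1%N).1)%R : bool)%:R + ((ka <= - (v 1%N).1)%R : bool)%:R +
  ((ka <= (v 1%N).2)%R : bool)%:R :> R by rewrite !addr_ge0.
exact: (cm_integralD_le (cmD (cmD c1 c2) c3) c4 z2 (b0 _) S2 t4).
Qed.

Lemma far_lt1 ka v : far ka v < 1 -> `|(v 1%N).1| <= ka /\ `|(v 1%N).2| <= ka.
Proof.
rewrite /far.
case: (leP ka (v 1%N).1) => a1; case: (leP ka (- (v 1%N).1)) => a2;
case: (leP ka (v 1%N).2) => a3; case: (leP ka (- (v 1%N).2)) => a4; rewrite /=;
try (by move=> h; exfalso; move: h; lra).
by move=> _; split; apply/ler_normlP; split; lra.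
Qed.

(** The four parts of the pathwise bound are integrated separately. In the main one, the excess of
    [c0] over 1 multiplies [Ftot - orisk + 12 phi orisk], which is at most [Ftot] because
    [12 phi <= 1]. *)
Lemma expected_error (u : Omega -> R) (C1 C2 ka : R) : (0 < N)%N -> 0 < ka -> 0 <= C1 -> 0 <= C2 ->
  measurable_fun setT u ->
  (forall w, u w ^+ 2 <=
    (Mf (X^~ w) ^+ 2 / Ftot ^+ 2 * (1 + 2 * (orisk / Ftot) - 2 * (Wa (X^~ w) / Ftot) +
      C1 * ((phi + orisk) * orisk)) + C2 * (phi * orisk) * (Mf (X^~ w) ^+ 4 / e ^+ 2)) * goodI (X^~ w) +
    16 * e ^+ 2 * l ^+ 2 * bad (X^~ w) + 4 * far ka (X^~ w)) ->
  (\int[P]_w (u w ^+ 2)%:E <=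
   (e ^+ 2 / Ftot * (1 + orisk / Ftot + 20 * (phi * (orisk / Ftot)) + C1 * ((phi + orisk) * orisk)) +
    C2 * (phi * orisk) * (24 * (65 * 64) * e ^+ 2 * Ftot ^+ 2) +
    96 * (e ^+ 2 * l ^+ 2 * J%:R * expR (- (3 * l))) + 16 * expR (- (ka ^+ 2 / 2)))%:E)%E.
Proof.
move=> N0 k0 C10 C20 mu_ hu.
have pp := phi0; have rr := ltW r0; have FF := ltW F0; have ee := ltW e0.
have ro0 : 0 <= orisk / Ftot by rewrite divr_ge0.
pose c0 := 1 + 2 * (orisk / Ftot) + C1 * ((phi + orisk) * orisk).
have c01 : 1 <= c0 by rewrite /c0 -addrA lerDl; nneg.
pose t1 v := Mf v ^+ 2 * ((c0 - 2 * (Wa v / Ftot)) * goodI v).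
pose t2 v := Mf v ^+ 4 * goodI v.
have ct1 : coordinate_measurable N t1.
  apply: cmM; first by apply: cmX; exact: cm_Mf.
  apply: cmM; last exact: cm_goodI.
  apply: cmB; first exact: cm_cst.
  by apply: cmZ; apply: cmM; [exact: cm_Wa|exact: cm_cst].
have ct2 : coordinate_measurable N t2.
  by apply: cmM; [apply: cmX; exact: cm_Mf|exact: cm_goodI].
have t10 v : 0 <= t1 v.
  rewrite mulr_ge0 ?sqr_ge0//; have [gv|gv] := pselect (good v).
    by rewrite mulr_ge0 ?goodI_ge0//; have /ler_normlP[] := Wa_norm gv; lra.
  by rewrite /goodI; move/goodP/negbTE: gv => ->; rewrite mulr0.
have t20 v : 0 <= t2 v by rewrite mulr_ge0 ?goodI_ge0// pow4_ge0.
have i1 := second_moment c01; have i2 := fourth_moment.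
have i3 := bad_small; have i4 := far_small N0 k0.
pose bd v := (Ftot ^- 2 * t1 v + C2 * (phi * orisk) * e ^- 2 * t2 v) +
  16 * e ^+ 2 * l ^+ 2 * bad v + 4 * far ka v.
have a1 : 0 <= Ftot ^- 2 by rewrite invr_ge0 exprn_ge0.
have a2 : 0 <= C2 * (phi * orisk) * e ^- 2 by nneg.
have a3 : 0 <= 16 * e ^+ 2 * l ^+ 2 by nneg.
have ub w : u w ^+ 2 <= bd (X^~ w).
  apply: (le_trans (hu w)); rewrite /bd !lerD2r le_eqVlt; apply/orP; left; apply/eqP.
  by rewrite /t1 /t2 /c0; ring.
have cb := cm_bad; have cf := cm_far ka N0.
have I1 := cm_integralZ_le a1 ct1 t10 i1.
have I2 := cm_integralZ_le a2 ct2 t20 i2.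
have I3 := cm_integralZ_le a3 cb bad_ge0 i3.
have I4 := cm_integralZ_le (ler0n R 4) cf (far_ge0 ka) i4.
have z1 v : 0 <= Ftot ^- 2 * t1 v by rewrite mulr_ge0.
have z2 v : 0 <= C2 * (phi * orisk) * e ^- 2 * t2 v by rewrite mulr_ge0.
have z3 v : 0 <= 16 * e ^+ 2 * l ^+ 2 * bad v by rewrite mulr_ge0 ?bad_ge0.
have z4 v : 0 <= 4 * far ka v by rewrite mulr_ge0 ?far_ge0.
have I12 := cm_integralD_le (cmZ _ ct1) (cmZ _ ct2) z1 z2 I1 I2.
have z12 v := addr_ge0 (z1 v) (z2 v).
have I123 := cm_integralD_le (cmD (cmZ _ ct1) (cmZ _ ct2)) (cmZ _ cb) z12 z3 I12 I3.
have z123 v := addr_ge0 (z12 v) (z3 v).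
have I1234 := cm_integralD_le (cmD (cmD (cmZ _ ct1) (cmZ _ ct2)) (cmZ _ cb)) (cmZ _ cf) z123 z4 I123 I4.
apply: (@le_trans _ _ (\int[P]_w (bd (X^~ w))%:E)%E).
  apply: nnint_le => //.
  - exact: measurable_funX.
  - exact: (cm_measurable_iid iX (cmD (cmD (cmD (cmZ _ ct1) (cmZ _ ct2)) (cmZ _ cb)) (cmZ _ cf))).
  - by move=> w; exact: sqr_ge0.
apply: (le_trans I1234); rewrite lee_fin.
have -> : 16 * e ^+ 2 * l ^+ 2 * (6 * J%:R * expR (- (3 * l))) =
  96 * (e ^+ 2 * l ^+ 2 * J%:R * expR (- (3 * l))) by ring.
have -> : 4 * (4 * expR (- (ka ^+ 2 / 2))) = 16 * expR (- (ka ^+ 2 / 2)) by ring.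
rewrite !lerD2r.
have -> : C2 * (phi * orisk) * e ^- 2 * (24 * (65 * 64) * e ^+ 4 * Ftot ^+ 2) =
  C2 * (phi * orisk) * (24 * (65 * 64) * e ^+ 2 * Ftot ^+ 2) by field; rewrite gt_eqF.
rewrite lerD2r.
have -> : Ftot ^- 2 * (e ^+ 2 * (c0 * (Ftot - orisk + 12 * (phi * orisk)) + 8 * (phi * orisk))) =
  e ^+ 2 / Ftot * ((c0 * (Ftot - orisk + 12 * (phi * orisk)) + 8 * (phi * orisk)) / Ftot).
  by field; rewrite gt_eqF.
rewrite ler_wpM2l ?divr_ge0 ?sqr_ge0// ler_pdivrMr//.
have -> : (1 + orisk / Ftot + 20 * (phi * (orisk / Ftot)) + C1 * ((phi + orisk) * orisk)) * Ftot =
  Ftot + orisk + 20 * (phi * orisk) + C1 * ((phi + orisk) * orisk) * Ftot.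
  by field; rewrite gt_eqF.
set Y := C1 * ((phi + orisk) * orisk) in c0 c01 t1 i1 ct1 t10 bd ub I1 z1 I12 z12 I123 z123 I1234 *.
have Y0 : 0 <= Y by rewrite /Y; nneg.
have pr : 0 <= phi * orisk by rewrite mulr_ge0.
have pr1 : phi * orisk <= 1 / 100 * orisk by rewrite ler_wpM2r ?phi1.
have h1 : Y * (Ftot - orisk + 12 * (phi * orisk)) <= Y * Ftot.
  by rewrite ler_wpM2l//; have := r0; lra.
have h2 : 2 * (orisk / Ftot) * (Ftot - orisk + 12 * (phi * orisk)) <= 2 * (orisk / Ftot) * Ftot.
  by rewrite ler_wpM2l//; [rewrite mulr_ge0|have := r0; lra].
have h3 : 2 * (orisk / Ftot) * Ftot = 2 * orisk by field; rewrite gt_eqF.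
rewrite h3 in h2.
have -> : c0 * (Ftot - orisk + 12 * (phi * orisk)) = Ftot - orisk + 12 * (phi * orisk) +
  2 * (orisk / Ftot) * (Ftot - orisk + 12 * (phi * orisk)) + Y * (Ftot - orisk + 12 * (phi * orisk)).
  by rewrite /c0; ring.
move: h1 h2; set Z1 := Y * (_ + _); set Z2 := 2 * _ * _; lra.
Qed.

End moments.
End block_model.

(** * From observations to the block model *)

Section series.
Context {R : realType}.

(** The bound [M] makes the series finite, which is what allows [fine] to be distributed over head
    and tail. *)
Lemma nneseries_fine_split (u : nat -> R) N (M : R) : (forall k, 0 <= u k) ->
  (\sum_(1 <= k <oo) (u k)%:E <= M%:E)%E ->
  [/\ 0 <= fine (\sum_(N.+1 <= k <oo) (u k)%:E),
      fine (\sum_(1 <= k <oo) (u k)%:E) =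
        fine (\sum_(N.+1 <= k <oo) (u k)%:E) + \sum_(1 <= k < N.+1) u k,
      (\sum_(N.+1 <= k <oo) (u k)%:E <= M%:E)%E &
      fine (\sum_(1 <= k <oo) (u k)%:E) <= M].
Proof.
move=> u0 hM.
have ue0 k : (0 <= (u k)%:E)%E by rewrite lee_fin.
have sp := @nneseries_split R (fun k => (u k)%:E) 1 N (fun k _ => ue0 k).
rewrite add1n sumEFin in sp.
have t0 : (0 <= \sum_(N.+1 <= k <oo) (u k)%:E)%E by apply: nneseries_ge0.
have S0 : 0 <= \sum_(1 <= k < N.+1) u k by apply: sumr_ge0.
have tM : (\sum_(N.+1 <= k <oo) (u k)%:E <= M%:E)%E.
  apply: le_trans hM; rewrite sp addeC leeDl// lee_fin.
have tf : (\sum_(N.+1 <= k <oo) (u k)%:E)%E \is a fin_num.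
  by rewrite ge0_fin_numE// (le_lt_trans tM)// ltry.
have sf : (\sum_(1 <= k <oo) (u k)%:E)%E \is a fin_num.
  by rewrite sp fin_numD tf.
split => //.
- exact: fine_ge0.
- by rewrite sp fineD// addrC.
- by rewrite -lee_fin fineK.
Qed.

Lemma om_ge1 k : (0 < k)%N -> 1 <= om k :> R.
Proof.
move=> k0; rewrite /om; have := pi_ge2 R.
have : 1 <= k%:R :> R by rewrite ler1n.
by move=> a b; nra.
Qed.

Lemma om1 k : (0 < k)%N -> k%:R <= om k :> R.
Proof.
by move=> k0; rewrite /om ler_peMl//; have := pi_ge2 R; lra.
Qed.

Lemma om_sqr_le_powR (b : R) k : 1 < b -> (0 < k)%N -> om k ^+ 2 <= om k `^ (2 * b).
Proof.
move=> b1 k0; rewrite -powR_mulrn ?om_ge0// ler_powR ?om_ge1//; lra.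
Qed.

Variables (b L rho : R) (f : R -> R).
Hypothesis b1 : 1 < b.
Hypothesis fcl : Fclass b L rho f.
Notation fk := (fcoef f).

Let u k := om k ^+ 2 * fk k ^+ 2.

Let u0 k : 0 <= u k.
Proof. by rewrite /u; nneg. Qed.

Let w k := om k `^ (2 * b) * fk k ^+ 2.

Let w0 k : 0 <= w k.
Proof. by rewrite /w mulr_ge0 ?powR_ge0// sqr_ge0. Qed.

Let wL : (\sum_(1 <= k <oo) (w k)%:E <= (L ^+ 2)%:E)%E.
Proof. by case: fcl. Qed.

Let uw k : (0 < k)%N -> u k <= w k.
Proof. by move=> k0; rewrite ler_wpM2r ?sqr_ge0// om_sqr_le_powR. Qed.

Let uL : (\sum_(1 <= k <oo) (u k)%:E <= (L ^+ 2)%:E)%E.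
Proof.
apply: le_trans wL; apply: lee_nneseries => [k _ _|[|k] _]; rewrite lee_fin//.
  by rewrite /u /w /om mulr0 expr0n mul0r mulr_ge0 ?powR_ge0// sqr_ge0.
exact: uw.
Qed.

Definition ftail N : R := fine (\sum_(N.+1 <= k <oo) (om k ^+ 2 * fk k ^+ 2)%:E)%E.

Lemma ftail_ge0 N : 0 <= ftail N.
Proof. by have [] := nneseries_fine_split N u0 uL. Qed.

Lemma nfp_sqE N : nfp_sq f = ftail N + \sum_(1 <= k < N.+1) om k ^+ 2 * fk k ^+ 2.
Proof. by have [] := nneseries_fine_split N u0 uL. Qed.

Lemma nfp_sq_le : nfp_sq f <= L ^+ 2.
Proof. by have [] := nneseries_fine_split 0 u0 uL. Qed.

(** Beyond [N], the factor [om k ^ (2 - 2 b)] is at most [(N + 1) ^ (2 - 2 b)], because the exponent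
    is negative and [om k >= k]; the smoothness bound controls what remains. *)
Lemma ftail_le N : ftail N <= N.+1%:R `^ (2 - 2 * b) * L ^+ 2.
Proof.
have [_ _ hw _] := nneseries_fine_split N w0 wL.
have [_ _ hu _] := nneseries_fine_split N u0 uL.
have p0 : 0 <= N.+1%:R `^ (2 - 2 * b) :> R by exact: powR_ge0.
have t0 : (0 <= \sum_(N.+1 <= k <oo) (u k)%:E)%E by apply: nneseries_ge0 => *; rewrite lee_fin.
have tf : (\sum_(N.+1 <= k <oo) (u k)%:E)%E \is a fin_num.
  by rewrite ge0_fin_numE// (le_lt_trans hu)// ltry.
rewrite -lee_fin fineK//.
(* Setting the terms up to [N] to 0 makes the termwise comparison true at every index. *)
pose u' k := if (N < k)%N then u k else 0.
have -> : (\sum_(N.+1 <= k <oo) (u k)%:E = \sum_(N.+1 <= k <oo) (u' k)%:E)%E.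
  rewrite eseries_cond [RHS]eseries_cond; apply: eq_eseriesr => k /= Nk.
  by rewrite /u' Nk.
apply: (@le_trans _ _ (\sum_(N.+1 <= k <oo) ((N.+1%:R `^ (2 - 2 * b))%:E * (w k)%:E))%E).
  apply: lee_nneseries => [k _ _|k _]; rewrite /u' -?EFinM lee_fin; case: ltnP => // Nk.
    have k0 : (0 < k)%N by exact: leq_ltn_trans Nk.
    have k1 : 0 < om k :> R by rewrite (lt_le_trans ltr01)// om_ge1.
    rewrite /u /w [leRHS]mulrA ler_wpM2r ?sqr_ge0//.
    have -> : om k ^+ 2 = om k `^ (2 - 2 * b) * om k `^ (2 * b).
      rewrite -powRD; last by apply/implyP => _; rewrite gt_eqF.
      by rewrite subrK -powR_mulrn ?om_ge0.
    rewrite ler_wpM2r ?powR_ge0//.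
    have -> : 2 - 2 * b = - (2 * b - 2) by ring.
    rewrite !powRN lef_pV2 ?posrE ?powR_gt0//.
    have q0 : 0 <= 2 * b - 2 by have := b1; lra.
    apply: (ge0_ler_powR q0); rewrite ?nnegrE ?om_ge0//.
    by apply: le_trans (om1 k0); rewrite ler_nat.
  by rewrite mulr_ge0.
rewrite nneseriesZl; last by move=> k _; rewrite lee_fin.
by rewrite EFinM lee_wpmul2l ?lee_fin.
Qed.

Lemma riskE (e : R) h N : (forall k, (N < k)%N -> h k = 0) ->
  risk e f h = ftail N + \sum_(1 <= k < N.+1)
    om k ^+ 2 * ((1 - h k) ^+ 2 * fk k ^+ 2 + e ^+ 2 * h k ^+ 2).
Proof.
move=> h0; rewrite /risk.
pose g k := om k ^+ 2 * ((1 - h k) ^+ 2 * fk k ^+ 2 + e ^+ 2 * h k ^+ 2).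
have g0 k : 0 <= g k by rewrite /g; nneg.
have ge0 k : (0 <= (g k)%:E)%E by rewrite lee_fin.
have sp := @nneseries_split R (fun k => (g k)%:E) 1 N (fun k _ => ge0 k).
rewrite -/(g _) [X in fine X]sp add1n sumEFin.
have -> : (\sum_(N.+1 <= k <oo) (g k)%:E = \sum_(N.+1 <= k <oo) (u k)%:E)%E.
  rewrite eseries_cond [RHS]eseries_cond; apply: eq_eseriesr => k Nk.
  by rewrite /g h0// subr0 expr0n mulr0 addr0 expr1n mul1r.
have [_ _ hu _] := nneseries_fine_split N u0 uL.
have t0 : (0 <= \sum_(N.+1 <= k <oo) (u k)%:E)%E by apply: nneseries_ge0 => *; rewrite lee_fin.
have tf : (\sum_(N.+1 <= k <oo) (u k)%:E)%E \is a fin_num.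
  by rewrite ge0_fin_numE// (le_lt_trans hu)// ltry.
by rewrite fineD// addrC.
Qed.

Lemma fcoef1_ge : 0 < rho -> rho <= `|fk 1%N|.
Proof.
move=> rho0; have [[_ _ _ h] _] := fcl.
rewrite /fcoef normrM ger0_norm ?sqrtr_ge0//.
have -> : Rintegral (@lebesgue_measure R) `[(- (1/2)), (1/2)] (fun t => cos (2 * pi * 1%:R * t) * f t) =
    Rintegral (@lebesgue_measure R) `[(- (1/2)), (1/2)] (fun t => f t * cos (2 * pi * t)).
  by congr (Rintegral _ _ _); apply/funext => t; rewrite mulr1 mulrC.
apply: (le_trans h); rewrite ler_peMl//.
by rewrite -[leLHS]sqrtr1 ler_wsqrtr// ler1n.
Qed.

End series.

(** * Observations in rotated coordinates and accuracy of the preliminary estimate *)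

Section observations.
Context {R : realType}.
Notation T := (measurableTypeR R).

Lemma atan_lipschitz (y z : R) : `|atan y - atan z| <= `|y - z|.
Proof.
wlog yz : y z / z <= y.
  move=> H; have [zy|/ltW yz] := leP z y; first exact: H.
  by rewrite distrC [leRHS]distrC; exact: H.
have da x : x \in `]z, y[ -> is_derive x 1 (@atan R) (1 + x ^+ 2)^-1.
  by move=> _; exact: is_derive1_atan.
have [c _ ->] := MVT_segment yz da (continuous_subspaceT (@continuous_atan R)).
rewrite normrM ler_piMl//.
have c0 : 0 < 1 + c ^+ 2 by rewrite ltr_pwDl// sqr_ge0.
by rewrite ger0_norm ?invr_ge0 ?(ltW c0)// invf_le1// lerDl sqr_ge0.
Qed.

Lemma cos_ge_cos (x y : R) : `|x| <= y -> y <= pi -> cos y <= cos x.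
Proof.
move=> xy ypi.
have -> : cos x = cos `|x| by case: (ler0P x) => _; rewrite ?cosN.
move: xy; rewrite le_eqVlt => /predU1P[->//|xy].
by rewrite ltW// ltr_cos ?in_itv/= ?normr_ge0 ?(le_trans (ltW xy))// (le_trans (normr_ge0 x) (ltW xy)).
Qed.

Lemma theta_bar_le (x xs : nat -> R) : `|theta_bar x xs| <= 1 / 4.
Proof.
rewrite /theta_bar; case: ifP => _; last by rewrite ger0_norm.
have a1 := atan_ltpi2 (xs 1%N / x 1%N); have a2 := atan_gtNpi2 (xs 1%N / x 1%N).
have p0 := pi_gt0 R.
by apply/ler_normlP; rewrite -mulNr !ler_pdivrMr ?mulr_gt0//; split; lra.
Qed.

Variables (e theta : R) (f : R -> R) (z : nat -> T * T).
Hypothesis e0 : 0 < e.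
Notation fk := (fcoef f).

(* The rotation that turns the noise of [(x_k, xs_k)] into the noise of the amplitude [av] and of
   the quadrature component [bv] at the true shift. *)
Definition rotate (k : nat) : T * T -> T * T := plane_rot (cos (om k * theta)) (- sin (om k * theta)).
Let v k := rotate k (z k).
Let x := obs_x e theta f (fun k => (z k).1).
Let xs := obs_xs e theta f (fun k => (z k).2).

Lemma obs_xE k : x k = av e fk v k * cos (om k * theta) - bv e v k * sin (om k * theta).
Proof.
rewrite /x /obs_x /av /bv /v /rotate /plane_rot/=; have := cos2Dsin2 (om k * theta); rewrite -/(om k).
set c := cos _; set s := sin _ => cs.
rewrite -[X in e * X]mulr1 -cs; ring.
Qed.

Lemma obs_xsE k : xs k = av e fk v k * sin (om k * theta) + bv e v k * cos (om k * theta).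
Proof.
rewrite /xs /obs_xs /av /bv /v /rotate /plane_rot/=; have := cos2Dsin2 (om k * theta); rewrite -/(om k).
set c := cos _; set s := sin _ => cs.
rewrite -[X in e * X]mulr1 -cs; ring.
Qed.

Lemma obs_sqr k : x k ^+ 2 + xs k ^+ 2 = av e fk v k ^+ 2 + bv e v k ^+ 2.
Proof.
rewrite obs_xE obs_xsE; have := cos2Dsin2 (om k * theta); set c := cos _; set s := sin _ => cs.
rewrite -[RHS]mulr1 -cs; ring.
Qed.

Lemma obs_score k t : om k * ((x k * cos (om k * t) + xs k * sin (om k * t)) *
    (xs k * cos (om k * t) - x k * sin (om k * t))) =
  score (av e fk v k) (bv e v k) (om k) (t - theta).
Proof.
rewrite obs_xE obs_xsE /score [om k * (t - theta)]mulrBr cosB sinB; congr (_ * (_ * _)); ring.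
Qed.

Definition phj (kap : R -> nat -> nat) j := Num.sqrt (24 / (Tj kap e j)%:R * ln (e ^- 5)).

(** The Stein filter depends on the data only through [x_k^2 + xs_k^2], which the rotation
    preserves. *)
Lemma hJS_weight kap J k : hJS kap J e x xs k = weight e fk (kap e) (phj kap) (J e) v k.
Proof.
rewrite /hJS /weight /spread; apply: eq_bigr => j _; rewrite -/(in_block kap e j k).
case: ifP => // _; rewrite /stein /stein_weight /noise /sigma2 /bsum /energy /=.
set y1 := \sum_(_ <= i < _) _ * (x i ^+ 2 + _); set y2 := bsum _ _ _.
have -> : y1 = y2 by apply: eq_bigr => i _; rewrite obs_sqr.
by [].
Qed.

(** The true shift lies inside the search interval, hence so does the segment joining it to the
    maximizer; the one-sided derivative along this segment has a known sign. *)
Lemma JS_first_order beta kap J t : is_JS_estimate beta kap J e x xs t ->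
  `|theta_bar x xs - theta| < delta_eps e ->
  (0 < t - theta -> 0 <= \sum_(1 <= k < (Neps beta e).+1) weight e fk (kap e) (phj kap) (J e) v k *
    score (av e fk v k) (bv e v k) (om k) (t - theta)) /\
  (t - theta < 0 -> \sum_(1 <= k < (Neps beta e).+1) weight e fk (kap e) (phj kap) (J e) v k *
    score (av e fk v k) (bv e v k) (om k) (t - theta) <= 0).
Proof.
move=> [/andP[t1 t2] tmax] /ltr_normlP[d1 d2].
have D := is_derive_Phi (Neps beta e) x xs (hJS kap J e x xs) t.
have E : \sum_(1 <= k < (Neps beta e).+1) weight e fk (kap e) (phj kap) (J e) v k *
    score (av e fk v k) (bv e v k) (om k) (t - theta) =
  \sum_(1 <= k < (Neps beta e).+1) hJS kap J e x xs k * ((2 * pi * k%:R) *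
    ((x k * cos (2 * pi * k%:R * t) + xs k * sin (2 * pi * k%:R * t)) *
     (xs k * cos (2 * pi * k%:R * t) - x k * sin (2 * pi * k%:R * t)))).
  by apply: eq_bigr => k _; rewrite hJS_weight -obs_score.
rewrite E; split => u0.
- apply: (left_max_derive D (_ : theta < t)); first by lra.
  by move=> y /andP[y1 y2]; apply: tmax; apply/andP; split; lra.
- apply: (right_max_derive D (_ : t < theta)); first by lra.
  by move=> y /andP[y1 y2]; apply: tmax; apply/andP; split; lra.
Qed.

(** As [T < 1/4], the cosine of [2 pi theta] is at least [cT > 0]. The exact identity
    [xs_1 / x_1 - tan = b_1 / (x_1 cos)] and the Lipschitz property of [atan] reduce the claim to
    [|x_1| >= rho cT / 2], which the noise level [rho cT^2 l] permits since [4 e l <= 1]. Division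
    by [2 pi] makes the inequality strict. *)
Lemma theta_bar_close (TT rho l cT : R) : 0 < TT < 1 / 4 -> - TT < theta <= TT ->
  cT = cos (2 * pi * TT) -> 0 < rho -> rho <= `|fk 1%N| -> 0 < l -> 4 * e * l <= 1 ->
  `|(v 1%N).1| <= rho * cT ^+ 2 * l -> `|(v 1%N).2| <= rho * cT ^+ 2 * l ->
  `|theta_bar x xs - theta| < 2 * e * l.
Proof.
move=> /andP[T0 T1] /andP[th1 th2] cTE rho0 frho l0 el1 h1 h2.
have p0 := pi_gt0 R.
pose al := om 1 * theta.
have alE : al = 2 * pi * theta by rewrite /al /om mulr1.
have alT : `|al| <= 2 * pi * TT.
  rewrite alE normrM gtr0_norm ?mulr_gt0// ler_wpM2l ?mulr_ge0 ?(ltW p0)//.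
  by apply/ler_normlP; split; lra.
have T2 : 2 * pi * TT < pi / 2 by nra.
have cT0 : 0 < cT.
  rewrite cTE; apply: cos_gt0_pihalf; apply/andP; split => //.
  by rewrite (@lt_trans _ _ 0)// ?oppr_lt0 ?divr_gt0// !mulr_gt0.
have cT1 : cT <= 1 by rewrite cTE cos_le1.
have cal : cT <= cos al by rewrite cTE; apply: cos_ge_cos => //; lra.
have ca1 := cos_le1 al.
have sal : `|sin al| <= 1 by apply/ler_normlP; split; have := sin_le1 al; have := sin_geN1 al; lra.
set ka := rho * cT ^+ 2 * l in h1 h2.
set A := av e fk v 1; set B := bv e v 1.
have ek : 4 * (e * ka) <= rho * cT.
  rewrite /ka; have -> : 4 * (e * (rho * cT ^+ 2 * l)) = rho * cT * ((4 * e * l) * cT) by ring.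
  rewrite ler_piMr ?mulr_ge0 ?(ltW rho0) ?(ltW cT0)//.
  by rewrite mulr_ile1// ?ltW// !mulr_gt0.
have hB : `|B| <= e * ka by rewrite /B /bv normrM gtr0_norm// ler_wpM2l// ltW.
have hA : rho - e * ka <= `|A|.
  have : `|e * (v 1%N).1| <= e * ka by rewrite normrM gtr0_norm// ler_wpM2l// ltW.
  rewrite /A /av; have := lerB_normD (fk 1%N) (e * (v 1%N).1); lra.
have ek0 : 0 <= e * ka by rewrite (le_trans _ hB).
have hx : rho * cT / 2 <= `|x 1%N|.
  rewrite obs_xE -/al -/A -/B.
  have : `|A| * `|cos al| - `|B| * `|sin al| <= `|A * cos al - B * sin al|.
    by rewrite -!normrM lerB_dist.
  rewrite (gtr0_norm (lt_le_trans cT0 cal)).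
  have : (rho - e * ka) * cT <= `|A| * cos al.
    apply: ler_pM => //; last exact: ltW.
    by have : rho * cT <= rho by [rewrite ger_pMr]; lra.
  have : `|B| * `|sin al| <= e * ka * 1 by apply: ler_pM.
  have : e * ka * cT <= e * ka by rewrite ler_piMr.
  lra.
have x0 : x 1%N != 0.
  by rewrite -normr_gt0 (lt_le_trans _ hx)// divr_gt0// mulr_gt0.
have ca0 : cos al != 0 by rewrite gt_eqF// (lt_le_trans cT0).
have tE : xs 1%N / x 1%N - tan al = B / (x 1%N * cos al).
  rewrite /tan -[in RHS](mulr1 B) -(cos2Dsin2 al).
  have -> : xs 1%N / x 1%N - sin al / cos al = (xs 1%N * cos al - x 1%N * sin al) / (x 1%N * cos al).
    by field; rewrite x0 ca0.
  by congr (_ / _); rewrite obs_xE obs_xsE -/al -/A -/B; ring.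
have ath : atan (tan al) = al.
  by apply: tanK; rewrite in_itv/=; move/ler_normlP: alT => [n1 n2]; apply/andP; split; lra.
rewrite /theta_bar x0.
have -> : atan (xs 1%N / x 1%N) / (2 * pi) - theta = (atan (xs 1%N / x 1%N) - atan (tan al)) / (2 * pi).
  by rewrite ath alE mulrBl; congr (_ - _); rewrite mulrC mulKf// gt_eqF// mulr_gt0.
rewrite normrM [`|(2 * pi)^-1|]ger0_norm ?invr_ge0 ?mulr_ge0 ?(ltW p0)// ltr_pdivrMr ?mulr_gt0//.
apply: (le_lt_trans (atan_lipschitz _ _)); rewrite tE [`|B / _|]normrM normfV [`|x 1%N * _|]normrM.
rewrite (gtr0_norm (lt_le_trans cT0 cal)).
have den : rho * cT / 2 * cT <= `|x 1%N| * cos al.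
  by apply: ler_pM => //; rewrite ?divr_ge0 ?mulr_ge0// ltW.
have d0 : 0 < rho * cT / 2 * cT by rewrite !mulr_gt0// ?divr_gt0 ?mulr_gt0.
apply: (@le_lt_trans _ _ (2 * e * l)).
  rewrite ler_pdivrMr; last exact: lt_le_trans den.
  apply: (le_trans hB); apply: (@le_trans _ _ (2 * e * l * (rho * cT / 2 * cT))).
    by rewrite /ka le_eqVlt; apply/orP; left; apply/eqP; field.
  by rewrite ler_wpM2l// !mulr_ge0// ltW.
rewrite ltr_pMr ?mulr_gt0//; have := pi_ge2 R; lra.
Qed.

End observations.

(** * Deterministic estimates for the blocks and two-sided bounds on the oracle risk *)

Section block_scheme.
Context {R : realType}.

(** Discrete form of the fact that the mean of [x^2] over an interval of positive numbers is at
    least a third of its largest value. *)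
Lemma sum_sqr_ge (a n : nat) :
  n%:R * (a%:R + n%:R - 1) ^+ 2 <= 3 * \sum_(a <= i < a + n) i%:R ^+ 2 :> R.
Proof.
elim: n => [|n ih]; first by rewrite mul0r addn0 big_geq// mulr0.
rewrite addnS big_nat_recr/= ?leq_addr// mulrDr natrD -[n.+1]addn1 natrD.
have a0 : 0 <= a%:R :> R by exact: ler0n.
have n0 : 0 <= n%:R :> R by exact: ler0n.
move: ih; set S := \sum_(_ <= _ < _) _; move: S a%:R n%:R a0 n0 => S x y x0 y0 ih.
by nra.
Qed.

Variables (kap : nat -> nat) (J N : nat).
Hypothesis kap0 : kap 0%N = 1%N.
Hypothesis kapS : forall j, (j < J)%N -> (kap j < kap j.+1)%N.
Hypothesis kapJ : kap J = N.+1.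

Lemma om_len_le (e : R) j k : (j < J)%N -> (kap j <= k < kap j.+1)%N ->
  e ^+ 2 * om k ^+ 2 * (kap j.+1 - kap j)%N%:R <= 3 * noise e kap j.
Proof.
move=> jJ /andP[k1 k2]; rewrite /noise (mulrCA 3) -mulrA; apply: ler_wpM2l; first exact: sqr_ge0.
rewrite /bsum /om; under eq_bigr do rewrite exprMn; rewrite exprMn -mulr_sumr (mulrCA 3) -mulrA.
apply: ler_wpM2l; first exact: sqr_ge0.
have kk := ltnW (kapS jJ); have := sum_sqr_ge (kap j) (kap j.+1 - kap j).
rewrite -natrD subnKC// => /(le_trans _); apply; rewrite mulrC ler_wpM2l ?ler0n//.
have h : k%:R <= (kap j.+1)%:R - 1 :> R by rewrite lerBrDr natr1 ler_nat.
by rewrite ler_sqr ?nnegrE ?ler0n// (le_trans _ h).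
Qed.

Lemma kap_gt j : (j <= J)%N -> (j < kap j)%N.
Proof.
elim: j => [|j ih] jJ; first by rewrite kap0.
by rewrite (leq_ltn_trans (ih (ltnW jJ)))// kapS.
Qed.

Lemma blocks_le : (J <= N)%N.
Proof. by have := kap_gt (leqnn J); rewrite kapJ ltnS. Qed.

Lemma sum_noise_le (e : R) : \sum_(j < J) noise e kap j <= 64 * (e ^+ 2 * N%:R ^+ 3).
Proof.
rewrite /noise -mulr_sumr -(sum_blocks kap0 kapS kapJ) mulrCA; apply: ler_wpM2l; first exact: sqr_ge0.
apply: (@le_trans _ _ (\sum_(1 <= k < N.+1) 64 * N%:R ^+ 2)).
  apply: ler_sum_nat => k /andP[k0 kN]; rewrite /om exprMn.
  have p1 := pi_ge0 R; have /andP[_ p2'] := pihalf_02 R.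
  have p2 : pi <= 4 :> R by lra.
  apply: ler_pM; rewrite ?sqr_ge0//.
    by rewrite expr2; nra.
  by rewrite ler_sqr ?nnegrE ?ler0n// ler_nat.
rewrite sumr_const_nat subn1/= -mulr_natr le_eqVlt; apply/orP; left; apply/eqP; ring.
Qed.

Lemma noise_ge0 (e : R) j : 0 <= noise e kap j.
Proof. by rewrite mulr_ge0 ?sqr_ge0// bsum_ge0// => k; exact: sqr_ge0. Qed.

Lemma noise_le (e : R) j : (j < J)%N -> noise e kap j <= 64 * (e ^+ 2 * N%:R ^+ 3).
Proof.
move=> jJ; apply: le_trans (sum_noise_le e); rewrite (bigD1 (Ordinal jJ))//= lerDl.
by apply: sumr_ge0 => i _; exact: noise_ge0.
Qed.

Variables (e : R) (f : nat -> R) (tail : R).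
Hypothesis e01 : 0 < e <= 1.
Hypothesis J0 : (0 < J)%N.
Hypothesis tail0 : 0 <= tail.

Let e0 : 0 < e. Proof. by case/andP: e01. Qed.

Lemma orisk_le : orisk e f kap J tail <= tail + 64 * (e ^+ 2 * N%:R ^+ 3).
Proof.
rewrite /orisk lerD2l; apply: le_trans (sum_noise_le e); apply: ler_sum => j _.
rewrite ler_piMl ?noise_ge0//; exact: (oracle_le1 f e0 kap0 kapS).
Qed.

Lemma block0_ge (g : nat -> R) : (forall k, 0 <= g k) -> g 1%N <= bsum kap g 0.
Proof.
move=> g0; rewrite /bsum kap0 big_ltn; first by rewrite lerDl sumr_ge0.
by have := kapS J0; rewrite kap0.
Qed.

Variable rho : R.
Hypothesis rho0 : 0 < rho.
Hypothesis frho : rho <= `|f 1%N|.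

Let sigF0 : rho ^+ 2 <= sigF f kap 0.
Proof.
have h := @block0_ge (fun k => om k ^+ 2 * f k ^+ 2) (fun k => mulr_ge0 (sqr_ge0 _) (sqr_ge0 _)).
apply: le_trans h; have o1 := @om_ge1 R 1 isT.
have : rho ^+ 2 <= `|f 1%N| ^+ 2 by rewrite ler_sqr ?nnegrE ?(ltW rho0).
rewrite real_normK ?num_real// => /le_trans; apply.
by rewrite ler_peMl ?sqr_ge0// exprn_ege1.
Qed.

(** The first block contributes [F s / (F + s)], increasing in both arguments, with [F >= rho^2] and
    [s >= e^2]. This lower bound of order [e^2] is what allows rare-event terms to be charged to the
    risk. *)
Lemma orisk_ge : rho ^+ 2 / (rho ^+ 2 + 1) * e ^+ 2 <= orisk e f kap J tail.
Proof.
have h2 := @block0_ge (fun k => om k ^+ 2) (fun k => sqr_ge0 _).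
have o1 := @om_ge1 R 1 isT.
have s0 : e ^+ 2 <= noise e kap 0.
  by rewrite /noise ler_peMr ?sqr_ge0//; apply: le_trans h2; rewrite exprn_ege1.
apply: (@le_trans _ _ (oracle e f kap 0 * noise e kap 0)); last first.
  rewrite /orisk (bigD1 (Ordinal J0))//= addrCA lerDl addr_ge0// sumr_ge0// => j _.
  by rewrite mulr_ge0 ?noise_ge0//; exact: (oracle_ge0 f e0 kap0 kapS).
have F0 := sigF0; rewrite /oracle /oracle_weight.
have e2 : 0 < e ^+ 2 by rewrite exprn_gt0.
have e21 : e ^+ 2 <= 1 by rewrite exprn_ile1 ?(ltW e0)//; case/andP: e01.
have r2 : 0 < rho ^+ 2 by rewrite exprn_gt0.
move: (sigF f kap 0) (noise e kap 0) (e ^+ 2) (rho ^+ 2) F0 s0 e2 e21 r2 => F s q p pF qs q0 q1 p0.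
have F0 : 0 < F by exact: lt_le_trans pF.
have s0 : 0 < s by exact: lt_le_trans qs.
have -> : p / (p + 1) * q = p * q / (p + 1) by ring.
have -> : F / (F + s) * s = F * s / (F + s) by ring.
rewrite ler_pdivrMr ?addr_gt0// mulrAC ler_pdivlMr ?addr_gt0//.
have h3 : p * q * F <= p * s * F by rewrite ler_wpM2r ?(ltW F0)// ler_wpM2l// ltW.
have h4 : p * q * s <= F * 1 * s.
  by rewrite ler_wpM2r ?(ltW s0)//; apply: ler_pM => //; exact: ltW.
lra.
Qed.

Lemma Ftot_ge : rho ^+ 2 <= Ftot f kap J tail.
Proof.
apply: (le_trans sigF0); rewrite /Ftot (bigD1 (Ordinal J0))//= addrCA lerDl addr_ge0// sumr_ge0// => j _.
exact: sigF_ge0.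
Qed.

End block_scheme.

(** * The norm, the risk and the penalties of the statement in block form *)

Section link.
Context {R : realType}.
Variables (b L rho : R) (f : R -> R) (kap : R -> nat -> nat) (J : R -> nat) (e : R).
Hypothesis b1 : 1 < b.
Hypothesis fcl : Fclass b L rho f.
Hypothesis e01 : 0 < e < 1.
Hypothesis vb : valid_blocks b kap J.
Notation N := (Neps b e).
Notation fk := (fcoef f).

Let e0 : 0 < e. Proof. by case/andP: e01. Qed.
Let kap0 : kap e 0%N = 1%N. Proof. by have [] := vb e01. Qed.
Let kapS : forall j, (j < J e)%N -> (kap e j < kap e j.+1)%N. Proof. by have [] := vb e01. Qed.
Let kapJ : kap e (J e) = N.+1. Proof. by have [] := vb e01. Qed.

Lemma nfp_sq_Ftot : nfp_sq f = Ftot fk (kap e) (J e) (ftail f N).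
Proof. by rewrite (nfp_sqE b1 fcl N) (sum_blocks kap0 kapS kapJ). Qed.

(** On each block the oracle weight [h] satisfies [h (F + s) = F], which collapses
    [(1 - h)^2 F + h^2 s] to [h s]. *)
Lemma risk_orisk : risk e f (hstar kap J e f) = orisk e fk (kap e) (J e) (ftail f N).
Proof.
have hE k : hstar kap J e f k = spread (kap e) (J e) (oracle e fk (kap e)) k by [].
rewrite (riskE b1 fcl e (h := hstar kap J e f) (N := N)).
  congr (_ + _); rewrite (sum_blocks kap0 kapS kapJ); apply: eq_bigr => j _.
  have jJ := ltn_ord j; have E := oracleE fk e0 kap0 kapS jJ.
  set h := oracle e fk (kap e) j in E *.
  have -> : h * noise e (kap e) j = (1 - h) ^+ 2 * sigF fk (kap e) j + h ^+ 2 * noise e (kap e) j.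
    have -> : (1 - h) ^+ 2 * sigF fk (kap e) j + h ^+ 2 * noise e (kap e) j =
      (1 - h) * (sigF fk (kap e) j - h * (sigF fk (kap e) j + noise e (kap e) j)) + h * noise e (kap e) j.
      by ring.
    by rewrite E subrr mulr0 add0r.
  rewrite /sigF /noise mulrA -!bsumZ -bsumD; apply: eq_bsum => k kj.
  by rewrite hE (spreadE kapS _ jJ kj) -/h; ring.
move=> k Nk; rewrite hE /spread big1// => j _; case: ifP => // kj.
by have /andP[_] := block_range kap0 kapS kapJ (ltn_ord j) kj; rewrite leqNgt Nk.
Qed.

Lemma lnV5 : ln (e ^- 5) = 5 * ln (e^-1).
Proof. by rewrite -exprVn lnXn ?invr_gt0// mulr_natl. Qed.

Lemma delta_epsE : delta_eps e = 2 * e * ln (e^-1).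
Proof. by rewrite /delta_eps -exprVn lnXn ?invr_gt0// -mulr_natl; ring. Qed.

Lemma ln_inv_gt0 : 0 < ln (e^-1).
Proof. by rewrite ln_gt0// invf_gt1//; case/andP: e01. Qed.

Lemma Tj_gt0 j : (j < J e)%N -> (0 < Tj kap e j)%N.
Proof. by move=> jJ; rewrite subn_gt0 kapS. Qed.

Lemma big_minn_le (s : seq nat) (F : nat -> nat) x i : i \in s ->
  (\big[minn/x]_(j <- s) F j <= F i)%N.
Proof.
elim: s => // j s ih; rewrite inE big_cons => /predU1P[->|/ih h]; first exact: geq_minl.
exact: leq_trans (geq_minr _ _) h.
Qed.

Lemma Tmin_le j : (j < J e)%N -> (Tmin kap J e <= Tj kap e j)%N.
Proof. by move=> jJ; rewrite /Tmin -(big_mkord xpredT (Tj kap e)) big_minn_le// mem_index_iota. Qed.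

Lemma Tmin_gt0 : (0 < Tmin kap J e)%N.
Proof.
have [J0 _ _ _] := vb e01; rewrite /Tmin; elim/big_ind: _ => [|x y|j _].
- exact: Tj_gt0.
- by rewrite leq_min => -> ->.
- exact: Tj_gt0.
Qed.

(** Bounds every [phj]: it is the penalty of a block of minimal length, with [24 log (e^-5)]
    rewritten as [120 log (1/e)]. It tends to 0 exactly by the assumption on the shortest block. *)
Definition phimax := Num.sqrt (120 * (ln (e^-1) / (Tmin kap J e)%:R)).

Lemma phj_sqr j : (j < J e)%N -> phj e kap j ^+ 2 * (kap e j.+1 - kap e j)%N%:R = 120 * ln (e^-1).
Proof.
move=> jJ; have T0 : 0 < (Tj kap e j)%:R :> R by rewrite ltr0n Tj_gt0.
have l0 := ln_inv_gt0.
rewrite /phj sqr_sqrtr ?lnV5; last by rewrite !mulr_ge0 ?invr_ge0 ?ler0n// ltW.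
by rewrite -/(Tj kap e j); field; rewrite gt_eqF.
Qed.

Lemma phj_le j : (j < J e)%N -> 0 < phj e kap j <= phimax.
Proof.
move=> jJ; have T0 : 0 < (Tj kap e j)%:R :> R by rewrite ltr0n Tj_gt0.
have m0 : 0 < (Tmin kap J e)%:R :> R by rewrite ltr0n Tmin_gt0.
have l0 := ln_inv_gt0.
rewrite sqrtr_gt0 {1}lnV5 !mulr_gt0 ?invr_gt0//= ler_wsqrtr// lnV5.
have -> : 24 / (Tj kap e j)%:R * (5 * ln e^-1) = 120 * (ln e^-1 / (Tj kap e j)%:R) by ring.
rewrite ler_wpM2l// ler_wpM2l ?(ltW l0)// lef_pV2 ?posrE// ler_nat.
exact: Tmin_le.
Qed.

End link.

(** * The inequality at a fixed noise level *)

Section core.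
Context {R : realType}.
Variables (b L rho TT : R) (kap : R -> nat -> nat) (J : R -> nat).

Definition cmin : R := Num.min 1 (rho ^+ 2).
Definition Kc : R := 6 * L ^+ 2 + 14.
Definition C1 : R := (100 + 64 * Kc) / cmin ^+ 2.
Definition C2 : R := (64 * Kc + 1024 * Kc ^+ 2) / cmin ^+ 6.
Definition c2 : R := rho ^+ 2 / (rho ^+ 2 + 1).
Definition ell (e : R) : R := ln (e^-1).
Definition kappa (e : R) : R := rho * cos (2 * pi * TT) ^+ 2 * ell e.
(** Bound on the oracle risk uniform over the class: squared bias beyond [N] plus the total noise of
    all blocks. *)
Definition rbound (e : R) : R :=
  (Neps b e).+1%:R `^ (2 - 2 * b) * L ^+ 2 + 64 * (e ^+ 2 * (Neps b e)%:R ^+ 3).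
(** Everything that multiplies [r / F] besides 1. The last group consists of the contributions of
    the rare events, divided by the lower bound [c2 e^2] of the risk. *)
Definition Err (e : R) : R :=
  20 * phimax kap J e + L ^+ 2 * C1 * (phimax kap J e + rbound e) +
  C2 * (24 * (65 * 64)) * L ^+ 8 * phimax kap J e +
  L ^+ 4 / c2 * (96 * (ell e ^+ 2 * (Neps b e)%:R * e) + 16 * (expR (- (kappa e ^+ 2 / 2)) / e ^+ 4)).

(** Depends on the noise level, the class and the block scheme only, never on [f] or [theta], so it
    may decide the value of [alpha]. *)
Record small_noise (e : R) : Prop := SmallNoise {
  sn_ell : 1 <= ell e ;
  sn_phi : phimax kap J e <= 1 / 100 ;
  sn_r1 : rbound e <= 1 ;
  sn_rc : rbound e <= cmin / 32 ;
  sn_lr : 16 * Kc * (ell e * (phimax kap J e * rbound e)) <= cmin ;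
  sn_el : 4 * e * ell e <= 1 }.

Hypothesis b1 : 1 < b.
Hypothesis L0 : 0 < L.
Hypothesis rho0 : 0 < rho.
Hypothesis T01 : 0 < TT < 1 / 4.
Hypothesis vb : valid_blocks b kap J.

Lemma cmin_gt0 : 0 < cmin.
Proof. by rewrite /cmin lt_min ltr01 exprn_gt0. Qed.

Lemma cmin_le : cmin <= 1 /\ cmin <= rho ^+ 2.
Proof. by rewrite /cmin; split; rewrite ge_min lexx ?orbT. Qed.

Lemma Kc_ge0 : 0 <= Kc.
Proof. by rewrite /Kc; nneg. Qed.

Lemma c2_gt0 : 0 < c2.
Proof. by rewrite divr_gt0 ?exprn_gt0// addr_gt0 ?exprn_gt0. Qed.

Lemma phimax_ge0 e : 0 <= phimax kap J e.
Proof. exact: sqrtr_ge0. Qed.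

Lemma Neps_gt0 e : (0 < Neps b e)%N.
Proof. by rewrite /Neps leq_max. Qed.

Lemma rbound_ge0 e : 0 <= rbound e.
Proof.
rewrite /rbound addr_ge0// mulr_ge0 ?powR_ge0 ?sqr_ge0// mulr_ge0 ?sqr_ge0//.
Qed.

Variables (d : measure_display) (Omega : measurableType d) (P : probability Omega R).
Variable Z : nat * bool -> Omega -> R.
Hypothesis gZ : std_gauss_iid P Z.
Variables (e theta : R) (f : R -> R) (est : Omega -> R).
Hypothesis e01 : 0 < e < 1.
Hypothesis th : - TT < theta <= TT.
Hypothesis fcl : Fclass b L rho f.
Hypothesis mest : measurable_fun setT est.
Hypothesis JS : forall w, is_JS_estimate b kap J e
  (obs_x e theta f (fun k => Z (k, false) w)) (obs_xs e theta f (fun k => Z (k, true) w)) (est w).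

Notation T := (measurableTypeR R).
Notation fk := (fcoef f).
Notation N := (Neps b e).
Notation l := (ell e).
Notation phi := (phimax kap J e).
Notation ph := (phj e kap).
Let tail := ftail f N.
Let F := Ftot fk (kap e) (J e) tail.
Let r := orisk e fk (kap e) (J e) tail.
Let X k w : T * T := rotate theta k (Z (k, false) w, Z (k, true) w).

Let e0 : 0 < e. Proof. by case/andP: e01. Qed.
Let e1 : 0 < e <= 1. Proof. by case/andP: e01 => -> /ltW ->. Qed.
Let kap0 : kap e 0%N = 1%N. Proof. by have [] := vb e01. Qed.
Let kapS : forall j, (j < J e)%N -> (kap e j < kap e j.+1)%N. Proof. by have [] := vb e01. Qed.
Let kapJ : kap e (J e) = N.+1. Proof. by have [] := vb e01. Qed.
Let J0 : (0 < J e)%N. Proof. by have [] := vb e01. Qed.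
Let frho : rho <= `|fk 1%N|. Proof. exact: fcoef1_ge fcl rho0. Qed.
Let tail0 : 0 <= tail. Proof. exact: ftail_ge0 b1 fcl N. Qed.

Lemma noise_pairs : iid_pairs P X.
Proof.
have iZ := std_gauss_iid_pairs gZ.
have pr k : g2_preserving (rotate theta k).
  by apply: rot_preserving; rewrite sqrrN cos2Dsin2.
by apply: (iid_law_map (f := rotate theta) iZ); [move=> k; case: (pr k)|move=> k B mB; case: (pr k) => _; apply].
Qed.

Let FL : F <= L ^+ 2.
Proof. by rewrite /F -(nfp_sq_Ftot b1 fcl e01 vb); exact: nfp_sq_le b1 fcl. Qed.

Let Frho : rho ^+ 2 <= F.
Proof. exact: (Ftot_ge kap0 kapS J0 tail0 rho0 frho). Qed.

Let F0 : 0 < F.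
Proof. by apply: lt_le_trans Frho; rewrite exprn_gt0. Qed.

Let rge : c2 * e ^+ 2 <= r.
Proof. exact: (orisk_ge kap0 kapS e1 J0 tail0 rho0 frho). Qed.

Let r0 : 0 < r.
Proof. by apply: lt_le_trans rge; rewrite mulr_gt0 ?c2_gt0// exprn_gt0. Qed.

Let rle : r <= rbound e.
Proof.
apply: (le_trans (orisk_le kap0 kapS kapJ fk tail e1)).
by rewrite /rbound lerD2r; exact: ftail_le b1 fcl N.
Qed.

Let est_theta_bar w : `|est w - theta_bar (obs_x e theta f (fun k => Z (k, false) w))
  (obs_xs e theta f (fun k => Z (k, true) w))| <= delta_eps e.
Proof. by have [/andP[h1 h2] _] := JS w; apply/ler_normlP; split; lra. Qed.

Let theta4 : `|theta| <= 1 / 4.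
Proof. by case/andP: th; case/andP: T01 => *; apply/ler_normlP; split; lra. Qed.

Lemma est_error_le w : `|est w - theta| <= 1 / 2 + delta_eps e.
Proof.
have h1 := est_theta_bar w; set tb := theta_bar _ _ in h1.
have h2 : `|tb| <= 1 / 4 by exact: theta_bar_le.
have h3 := theta4.
have -> : est w - theta = (est w - tb) + (tb - theta) by ring.
apply: (le_trans (ler_normD _ _)); have := ler_normB tb theta; lra.
Qed.

(** The error is bounded deterministically and [r / F] is at least [c2 e^2 / L^2], so at each noise
    level some finite coefficient is large enough. *)
Lemma crude_bound : (((e ^- 2 * nfp_sq f)%:E * \int[P]_w ((est w - theta) ^+ 2)%:E <=
  (1 + (1 + e ^- 2 * L ^+ 2 * (1 / 2 + delta_eps e) ^+ 2 * L ^+ 2 / (c2 * e ^+ 2)) *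
    risk e f (hstar kap J e f) / nfp_sq f)%:E)%E).
Proof.
rewrite (risk_orisk b1 fcl e01 vb) (nfp_sq_Ftot b1 fcl e01 vb) -/tail -/F -/r.
set D := 1 / 2 + delta_eps e.
have e20 : 0 < e ^- 2 by rewrite invr_gt0 exprn_gt0.
have D0 : 0 <= D ^+ 2 by exact: sqr_ge0.
have hI : (\int[P]_w ((est w - theta) ^+ 2)%:E <= (D ^+ 2)%:E)%E.
  apply: (@le_trans _ _ (\int[P]_w (D ^+ 2)%:E)%E).
    apply: nnint_le => //.
    - by apply: measurable_funX; exact: measurable_funB.
    - by move=> w; exact: sqr_ge0.
    - move=> w; rewrite -[leLHS](real_normK (num_real _)) ler_sqr ?nnegrE//.
        exact: est_error_le.
      exact: le_trans (normr_ge0 _) (est_error_le w).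
  by rewrite (integral_cst P measurableT (D ^+ 2)%:E) [X in (_ * X)%E](@probability_setT _ _ _ P) mule1.
apply: (@le_trans _ _ ((e ^- 2 * F)%:E * (D ^+ 2)%:E)%E).
  by rewrite lee_wpmul2l// lee_fin mulr_ge0 ?(ltW e20)// ltW.
rewrite -EFinM lee_fin.
have e2 : 0 < e ^+ 2 by rewrite exprn_gt0.
have c20 := c2_gt0.
have L20 : 0 < L ^+ 2 by rewrite exprn_gt0.
have q : c2 * e ^+ 2 / L ^+ 2 <= r / F.
  apply: ler_pM => //; last by rewrite lef_pV2 ?posrE.
  - by rewrite mulr_ge0// ltW.
  - by rewrite invr_ge0 ltW.
set M := e ^- 2 * L ^+ 2 * D ^+ 2.
have M0 : 0 <= M by rewrite /M; nneg.
have h1 : e ^- 2 * F * D ^+ 2 <= M by rewrite ler_wpM2r// ler_wpM2l// ltW.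
have G0 : 0 <= M * L ^+ 2 / (c2 * e ^+ 2) by nneg.
have h2 := ler_wpM2l G0 q.
have E : M * L ^+ 2 / (c2 * e ^+ 2) * (c2 * e ^+ 2 / L ^+ 2) = M.
  by field; rewrite !gt_eqF.
rewrite E in h2.
have q0 : 0 <= r / F by rewrite divr_ge0// ltW.
rewrite -mulrA mulrDl mul1r.
apply: (le_trans h1); apply: (le_trans h2).
by rewrite addrA lerDr addr_ge0.
Qed.

Section small.
Hypothesis sn : small_noise e.
Let l1 := sn_ell sn.
Let p1 := sn_phi sn.
Let el := sn_el sn.
Let p0 := phimax_ge0 e.

Let noise1 j : (j < J e)%N -> noise e (kap e) j <= 1.
Proof.
move=> jJ; apply: (le_trans (noise_le kap0 kapS kapJ _ jJ)); apply: le_trans (sn_r1 sn).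
by rewrite /rbound lerDr mulr_ge0 ?powR_ge0 ?sqr_ge0.
Qed.

Let phP := phj_le e01 vb.
Let phT := phj_sqr e01 vb.
Let omT := om_len_le kapS e.

Let cF : cmin <= F.
Proof. by apply: le_trans Frho; case: cmin_le. Qed.

Let r1 : r <= 1. Proof. exact: le_trans rle (sn_r1 sn). Qed.
Let rF : r <= F / 32.
Proof. by apply: (le_trans rle); apply: (le_trans (sn_rc sn)); rewrite ler_wpM2r. Qed.

Let lr : 16 * (6 * L ^+ 2 + 14) * (l * (phi * r)) <= F.
Proof.
apply: le_trans cF; apply: le_trans (sn_lr sn).
have l0 : 0 <= l by have := l1; lra.
rewrite -/Kc; apply: ler_wpM2l; first by rewrite mulr_ge0 ?Kc_ge0.
by apply: ler_wpM2l => //; apply: ler_wpM2l; [exact: p0|exact: rle].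
Qed.

Let C10 : 0 <= C1.
Proof. by have ? := Kc_ge0; have ? := cmin_gt0; rewrite /C1; nneg. Qed.

Let C20 : 0 <= C2.
Proof. by have ? := Kc_ge0; have ? := cmin_gt0; rewrite /C2; nneg. Qed.

Let pathbound v := Mf e fk (kap e) ph (J e) N v ^+ 2 / F ^+ 2 *
    (1 + 2 * (r / F) - 2 * (Wa e fk (kap e) (J e) v / F) + C1 * ((phi + r) * r)) +
  C2 * (phi * r) * (Mf e fk (kap e) ph (J e) N v ^+ 4 / e ^+ 2).

Let pathbound_ge0 v : good e fk (kap e) ph (J e) v -> 0 <= pathbound v.
Proof.
move=> gv; have := Wa_norm e0 kap0 kapS p0 p1 phP tail0 r0 rF gv.
rewrite -/F => /ler_normlP[_ w2].
have ? := C10; have ? := C20; have ? := p0; have ? := r0; have ? := F0.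
have ? : 0 <= Mf e fk (kap e) ph (J e) N v ^+ 4 by exact: pow4_ge0.
have X0 : 0 <= C1 * ((phi + r) * r) by nneg.
have q0 : 0 <= r / F by nneg.
have ? : 0 <= 1 + 2 * (r / F) - 2 * (Wa e fk (kap e) (J e) v / F) + C1 * ((phi + r) * r) by lra.
by rewrite /pathbound; nneg.
Qed.

Let kap_gt0 : 0 < kappa e.
Proof.
have /andP[T0 T1] := T01; have pp := pi_gt0 R.
have c0 : 0 < cos (2 * pi * TT).
  apply: cos_gt0_pihalf; apply/andP; split; last by nra.
  by rewrite (@lt_trans _ _ 0)// ?oppr_lt0 ?divr_gt0// !mulr_gt0.
by rewrite /kappa !mulr_gt0 ?exprn_gt0// (lt_le_trans ltr01)// l1.
Qed.

(** Three regimes. If the first noise pair is large, the error is still at most 1, paid by [far].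
    Otherwise the preliminary estimate is within [2 e l], so the error is at most [4 e l]; if a
    block statistic misbehaves, this is paid by [bad]. In the remaining case the first-order
    analysis applies. *)
Lemma error_pathwise w : (est w - theta) ^+ 2 <=
  pathbound (X^~ w) * goodI e fk (kap e) ph (J e) (X^~ w) +
  16 * e ^+ 2 * l ^+ 2 * bad e fk (kap e) ph (J e) (X^~ w) + 4 * far (kappa e) (X^~ w).
Proof.
have l0 : 0 < l by rewrite (lt_le_trans ltr01)// l1.
set v := X^~ w; set u := est w - theta.
have hb := bad_ge0 e fk (kap e) ph (J e) v.
have hf := far_ge0 (kappa e) v.
have b0 : 0 <= 16 * e ^+ 2 * l ^+ 2 * bad e fk (kap e) ph (J e) v by nneg.
have pg0 : 0 <= pathbound v * goodI e fk (kap e) ph (J e) v.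
  have [gv|gv] := pselect (good e fk (kap e) ph (J e) v).
    by rewrite mulr_ge0 ?pathbound_ge0// goodI_ge0.
  by move/goodP/negbTE: gv => gv; rewrite /goodI gv mulr0.
have dE : delta_eps e = 2 * e * l by exact: delta_epsE e01.
have [f1|f1] := ltP (far (kappa e) v) 1; last first.
  have u1 : `|u| <= 1 by apply: (le_trans (est_error_le w)); rewrite dE; have := el; lra.
  have : `|u| ^+ 2 <= 1 by rewrite exprn_ile1.
  rewrite real_normK ?num_real//; lra.
have [h1 h2] := far_lt1 f1.
have close := theta_bar_close (z := fun k => (Z (k, false) w, Z (k, true) w))
  e0 T01 th (erefl _) rho0 frho l0 el h1 h2.
have close' := close; rewrite -dE in close'.
have [fo1 fo2] := JS_first_order (z := fun k => (Z (k, false) w, Z (k, true) w)) (JS w) close'.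
have u4 : `|u| <= 4 * e * l.
  have h3 := est_theta_bar w; move: h3 close.
  set tb := theta_bar _ _ => h3 h4.
  have -> : u = (est w - tb) + (tb - theta) by rewrite /u; ring.
  apply: (le_trans (ler_normD _ _)); rewrite dE in h3.
  have := ltW h4; rewrite -/tb; lra.
have [gv|gv] := pselect (good e fk (kap e) ph (J e) v).
  have pb := pathwise_bound e0 kap0 kapS kapJ l1 p0 p1 phP noise1 phT omT tail0 FL gv cmin_gt0
    (proj1 cmin_le) cF u4 r0 r1 rF lr fo1 fo2.
  have -> : goodI e fk (kap e) ph (J e) v = 1 by rewrite /goodI; move/goodP: gv => ->.
  apply: (le_trans pb); rewrite -/(pathbound v); lra.
have b1' : 1 <= bad e fk (kap e) ph (J e) v.
  by rewrite leNgt; apply/negP => h; apply: gv; exact: (bad_lt1 e0 kap0 kapS phP h).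
have u16 : u ^+ 2 <= 16 * e ^+ 2 * l ^+ 2.
  rewrite -[leLHS](real_normK (num_real _)).
  have -> : 16 * e ^+ 2 * l ^+ 2 = (4 * e * l) ^+ 2 by ring.
  by rewrite ler_sqr ?nnegrE// !mulr_ge0// ltW.
have : 16 * e ^+ 2 * l ^+ 2 <= 16 * e ^+ 2 * l ^+ 2 * bad e fk (kap e) ph (J e) v.
  by rewrite ler_peMr//; nneg.
lra.
Qed.

(** Each remainder is rewritten as a coefficient times [r / F]. For the blocks, [exp (- 3 l) = e^3]
    and [J <= N] leave [l^2 N e] after division by the risk, a quantity that tends to 0. *)
Lemma refined_bound : (((e ^- 2 * nfp_sq f)%:E * \int[P]_w ((est w - theta) ^+ 2)%:E <=
  (1 + (1 + Err e) * risk e f (hstar kap J e f) / nfp_sq f)%:E)%E).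
Proof.
rewrite (risk_orisk b1 fcl e01 vb) (nfp_sq_Ftot b1 fcl e01 vb) -/tail -/F -/r.
have l0 : 0 < l by rewrite (lt_le_trans ltr01)// l1.
have mu_ : measurable_fun setT (fun w => est w - theta) by exact: measurable_funB.
have := expected_error e0 kap0 kapS kapJ l1 p0 p1 phP phT omT tail0 noise_pairs r0 rF
  (Neps_gt0 e) kap_gt0 C10 C20 mu_ error_pathwise.
rewrite -/F -/r.
have -> : expR (- (3 * l)) = e ^+ 3.
  by rewrite -mulrN expRM_natl /ell lnV ?posrE// opprK lnK ?posrE.
set E := expR (- (kappa e ^+ 2 / 2)) => ee.
have e20 : 0 < e ^- 2 by rewrite invr_gt0 exprn_gt0.
have eF0 : (0 <= (e ^- 2 * F)%:E)%E by rewrite lee_fin mulr_ge0 ?(ltW e20)// ltW.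
apply: (le_trans (lee_wpmul2l eF0 ee)); rewrite -EFinM lee_fin.
have c20 := c2_gt0; have L20 : 0 < L ^+ 2 by rewrite exprn_gt0.
have E0 : 0 <= E by exact: expR_ge0.
have JN : (J e)%:R <= N%:R :> R by rewrite ler_nat; exact: (blocks_le kap0 kapS kapJ).
have N0 : 0 <= N%:R :> R by [].
have q0 : 0 < r / F by rewrite divr_gt0.
have -> : e ^- 2 * F * (e ^+ 2 / F * (1 + r / F + 20 * (phi * (r / F)) + C1 * ((phi + r) * r)) +
   C2 * (phi * r) * (24 * (65 * 64) * e ^+ 2 * F ^+ 2) +
   96 * (e ^+ 2 * l ^+ 2 * (J e)%:R * e ^+ 3) + 16 * E) =
  1 + r / F + (20 * phi) * (r / F) + (F * C1 * (phi + r)) * (r / F) +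
  (C2 * (24 * (65 * 64)) * F ^+ 4 * phi) * (r / F) +
  (F ^+ 2 * (96 * (l ^+ 2 * (J e)%:R * e ^+ 3) + 16 * (E / e ^+ 2)) / r) * (r / F).
  by field; rewrite !gt_eqF.
have t1 : F * C1 * (phi + r) <= L ^+ 2 * C1 * (phi + rbound e).
  have ? := F0; have ? := r0; have ? := C10; have ? := p0.
  by apply: ler_pM; [nneg|nneg|rewrite ler_wpM2r|rewrite lerD2l].
have t2 : C2 * (24 * (65 * 64)) * F ^+ 4 * phi <= C2 * (24 * (65 * 64)) * L ^+ 8 * phi.
  apply: ler_wpM2r; first exact: p0.
  apply: ler_wpM2l; first by have ? := C20; nneg.
  rewrite (_ : L ^+ 8 = (L ^+ 2) ^+ 4); last by rewrite -exprM.
  by apply: lerXn2r; rewrite ?nnegrE ?(ltW F0)// ltW.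
have t3 : F ^+ 2 * (96 * (l ^+ 2 * (J e)%:R * e ^+ 3) + 16 * (E / e ^+ 2)) / r <=
    L ^+ 4 / c2 * (96 * (l ^+ 2 * N%:R * e) + 16 * (E / e ^+ 4)).
  have -> : L ^+ 4 / c2 * (96 * (l ^+ 2 * N%:R * e) + 16 * (E / e ^+ 4)) =
    L ^+ 4 * (96 * (l ^+ 2 * N%:R * e ^+ 3) + 16 * (E / e ^+ 2)) / (c2 * e ^+ 2).
    by field; rewrite !gt_eqF.
  apply: ler_pM.
  - by have ? := F0; nneg.
  - by rewrite invr_ge0 ltW.
  - apply: ler_pM.
    + by have ? := F0; nneg.
    + by nneg.
    + rewrite (_ : L ^+ 4 = (L ^+ 2) ^+ 2); last by rewrite -exprM.
      by rewrite ler_sqr ?nnegrE// ltW.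
    + rewrite lerD2r ler_wpM2l// ler_wpM2r ?exprn_ge0 ?(ltW e0)//.
      by rewrite ler_wpM2l// sqr_ge0.
  - by rewrite lef_pV2 ?posrE// mulr_gt0// exprn_gt0.
have gen (a A B C D B' C' D' : R) : B <= B' -> C <= C' -> D <= D' ->
    a + A + B + C + D <= a + (A + B' + C' + D').
  by move=> h1 h2 h3; rewrite !addrA !lerD.
have -> : 1 + (1 + Err e) * r / F = 1 + r / F + Err e * (r / F) by ring.
rewrite [Err e * _](mulrDl _ _ (r / F)) [X in _ <= _ + (X + _)](mulrDl _ _ (r / F)).
rewrite [X in _ <= _ + (X + _ + _)](mulrDl _ _ (r / F)).
have := ler_wpM2r (ltW q0) t1; have := ler_wpM2r (ltW q0) t2; have := ler_wpM2r (ltW q0) t3.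
by move=> g3 g2 g1; apply: gen.
Qed.

End small.
End core.

(** * Small noise asymptotics *)

Section asymptotics.
Context {R : realType}.
Implicit Types g : R -> R.

Local Notation "g ->0" := (g e @[e --> 0^'+] --> (0 : R)) (at level 60).

Lemma cvg0D g1 g2 : g1 ->0 -> g2 ->0 -> (fun e => g1 e + g2 e) ->0.
Proof. by move=> h1 h2; rewrite -[X in _ --> X](addr0 0); exact: cvgD. Qed.

Lemma cvg0Z c g : g ->0 -> (fun e => c * g e) ->0.
Proof. by move=> h; rewrite -[X in _ --> X](mulr0 c); apply: cvgM => //; exact: cvg_cst. Qed.

Lemma near_le_eps g eps : g ->0 -> 0 < eps -> \forall e \near 0^'+, g e <= eps.
Proof.
move=> h eps0; near=> e; apply: (le_trans (ler_norm _)); apply: ltW; near: e.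
exact: cvgr0_norm_lt.
Unshelve. all: by end_near. Qed.

Lemma cvg0_le g1 g2 : (\forall e \near 0^'+, 0 <= g1 e <= g2 e) -> g2 ->0 -> g1 ->0.
Proof. by move=> h; apply: (squeeze_cvgr h); exact: cvg_cst. Qed.

Lemma near01 : \forall e \near (0 : R)^'+, 0 < e < 1.
Proof.
near=> e; apply/andP; split; near: e; first exact: nbhs_right_gt.
exact: nbhs_right_lt.
Unshelve. all: by end_near. Qed.

Lemma ell_expR (e : R) : 0 < e -> expR (- ell e) = e.
Proof. by move=> e0; rewrite /ell lnV ?posrE// opprK lnK ?posrE. Qed.

Lemma near_ell (M : R) : \forall e \near (0 : R)^'+, M <= ell e.
Proof.
near=> e.
have e0 : 0 < e by near: e; exact: nbhs_right_gt.
have eM : e < expR (- M) by near: e; apply: nbhs_right_lt; exact: expR_gt0.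
by move: eM; rewrite -{1}(ell_expR e0) ltr_expR ltrN2 => /ltW.
Unshelve. all: by end_near. Qed.

Lemma expR_ell_cvg (a : R) : 0 < a -> (fun e => expR (- (a * ell e))) ->0.
Proof.
move=> a0; apply: cvg0_le (powR_cvg0 a0).
apply: filterS near01 => e /andP[e0 e1]; rewrite expR_ge0/=.
by rewrite /powR gt_eqF// /ell lnV ?posrE// mulrN opprK.
Qed.

(** The square is absorbed by half of the exponential, since [(a l / 4)^2 <= exp (a l / 2)]. *)
Lemma ell_sqr_expR (a : R) : 0 < a -> (fun e => ell e ^+ 2 * expR (- (a * ell e))) ->0.
Proof.
move=> a0; have a20 : 0 < a / 2 by rewrite divr_gt0.
apply: (cvg0_le _ (cvg0Z (16 / a ^+ 2) (expR_ell_cvg a20))).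
apply: filterS (near_ell 0) => e l0; set l := ell e in l0 *.
apply/andP; split; first by rewrite mulr_ge0 ?sqr_ge0 ?expR_ge0.
have h : (a / 4 * l) ^+ 2 <= expR (a / 4 * l) ^+ 2.
  have x0 : 0 <= a / 4 * l by rewrite !mulr_ge0 ?invr_ge0// ltW.
  by rewrite ler_sqr ?nnegrE ?expR_ge0//; have := expR_ge1Dx (a / 4 * l); lra.
rewrite -expRM_natl in h.
have -> : expR (- (a / 2 * l)) = expR (2 * (a / 4 * l)) * expR (- (a * l)).
  by rewrite -expRD; congr expR; field.
rewrite mulrA ler_wpM2r ?expR_ge0// mulrAC ler_pdivlMr ?exprn_gt0//.
have -> : l ^+ 2 * a ^+ 2 = 16 * (a / 4 * l) ^+ 2 by field.
by rewrite ler_wpM2l.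
Qed.

Variables (b L rho TT : R) (kap : R -> nat -> nat) (J : R -> nat).
Hypothesis b1 : 1 < b.
Hypothesis rho0 : 0 < rho.
Hypothesis T01 : 0 < TT < 1 / 4.
Hypothesis lo : log_little_o kap J.

Lemma phimax_cvg : phimax kap J ->0.
Proof.
have h : (fun e => 120 * (ln (e^-1) / (Tmin kap J e)%:R)) ->0 by exact: cvg0Z.
rewrite -[X in _ --> X](@sqrtr0 R).
by apply: (cvg_comp _ _ h); exact: sqrt_continuous.
Qed.

(** Up to rounding and the floor 5, [N] is [base ^ (- p)]. The condition [b > 1] is [p < 1/3], which
    makes [e^2 N^3], the order of the total noise, tend to 0. *)
Let p := 1 / (2 * b + 1).
Let p0 : 0 < p. Proof. by rewrite divr_gt0//; have := b1; lra. Qed.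
Let p3 : p < 1 / 3. Proof. by have B := b1; rewrite ltr_pdivrMr; lra. Qed.

Let base (e : R) := e ^+ 2 * ln (e ^- 5).

Let baseE e : 0 < e < 1 -> base e = 5 * ell e * expR (- (2 * ell e)).
Proof.
move=> e01; have /andP[e0 _] := e01.
by rewrite /base lnV5// -mulrN expRM_natl ell_expR// mulrC.
Qed.

Lemma Neps_le : \forall e \near 0^'+, (Neps b e)%:R <= 6 * expR (2 * p * ell e).
Proof.
near=> e.
have e01 : 0 < e < 1 by near: e; exact: near01.
have l1 : 1 <= ell e by near: e; exact: near_ell.
have E1 : 1 <= expR (2 * p * ell e).
  rewrite -[leLHS]expR0 ler_expR; have l0 := le_trans ler01 l1; have ? := p0.
  by nneg.
have B0 : 0 <= base e `^ (- p) by exact: powR_ge0.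
have B1 : base e `^ (- p) <= expR (2 * p * ell e).
  have -> : expR (2 * p * ell e) = expR (- (2 * ell e)) `^ (- p).
    by rewrite /powR gt_eqF ?expR_gt0// expRK; congr expR; ring.
  rewrite !powRN lef_pV2 ?posrE ?powR_gt0 ?expR_gt0//; last first.
    by rewrite baseE// !mulr_gt0 ?expR_gt0//; lra.
  apply: (ge0_ler_powR (ltW p0)); rewrite ?nnegrE ?expR_ge0//.
    by rewrite baseE// !mulr_ge0 ?expR_ge0//; lra.
  by rewrite baseE// ler_peMl ?expR_ge0//; lra.
have /andP[tr _] := truncn_itv B0.
rewrite /Neps natr_max ge_max; apply/andP; split; first by lra.
apply: (le_trans tr); apply: (le_trans B1); lra.
Unshelve. all: by end_near. Qed.

Let q := p * (2 * b - 2).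
Let q0 : 0 < q. Proof. by rewrite mulr_gt0 ?p0//; have := b1; lra. Qed.

(** As [N + 1] is at least [base ^ (- p)], the left side is at most [base ^ q]; then
    [ell * exp (- ell) <= 1] bounds [base] by [5 exp (- ell)]. *)
Lemma Neps_tail : \forall e \near 0^'+,
  (Neps b e).+1%:R `^ (2 - 2 * b) <= 5 `^ q * expR (- (q * ell e)).
Proof.
near=> e.
have e01 : 0 < e < 1 by near: e; exact: near01.
have l1 : 1 <= ell e by near: e; exact: near_ell.
have b0 : 0 < base e by rewrite baseE// !mulr_gt0 ?expR_gt0//; lra.
have B0 : 0 <= base e `^ (- p) by exact: powR_ge0.
have /andP[_ tr] := truncn_itv B0.
have N1 : base e `^ (- p) <= (Neps b e).+1%:R.
  by apply: (le_trans (ltW tr)); rewrite ler_nat ltnS /Neps leq_maxr.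
have b2 : 0 <= 2 * b - 2 by rewrite subr_ge0 ler_peMr// ltW.
apply: (@le_trans _ _ (base e `^ q)).
  have -> : 2 - 2 * b = - (2 * b - 2) by ring.
  have -> : base e `^ q = ((base e `^ (- p)) `^ (2 * b - 2))^-1.
    by rewrite -powRrM mulNr powRN invrK.
  rewrite powRN lef_pV2 ?posrE ?powR_gt0 ?ltr0n//.
  by apply: (ge0_ler_powR b2); rewrite ?nnegrE.
have -> : 5 `^ q * expR (- (q * ell e)) = (5 * expR (- ell e)) `^ q.
  rewrite powRM ?expR_ge0//; congr (_ * _).
  by rewrite /powR gt_eqF ?expR_gt0// expRK mulrN.
apply: (ge0_ler_powR (ltW q0)); rewrite ?nnegrE ?(ltW b0) ?mulr_ge0 ?expR_ge0//.
rewrite baseE// -mulrA ler_wpM2l//.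
have -> : expR (- (2 * ell e)) = expR (- ell e) * expR (- ell e) by rewrite -expRD; congr expR; ring.
rewrite mulrA ler_piMl ?expR_ge0// expRN ler_pdivrMr ?expR_gt0// mul1r.
by have := expR_ge1Dx (ell e); lra.
Unshelve. all: by end_near. Qed.

(** The extra factor [ell] is demanded by the absorption of the Taylor remainder. It is harmless
    because both parts of [rbound] decay like a power of [e], with exponents [q] and [2 - 6 p], up
    to constants. *)
Lemma ell_rbound_cvg : (fun e => ell e * rbound b L e) ->0.
Proof.
have g0 : 0 < 2 - 6 * p by have := p3; lra.
apply: (cvg0_le _ (cvg0D (cvg0Z (L ^+ 2 * 5 `^ q) (ell_sqr_expR q0))
  (cvg0Z (64 * 216) (ell_sqr_expR g0)))).
near=> e.
have e01 : 0 < e < 1 by near: e; exact: near01.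
have /andP[e0 _] := e01.
have l1 : 1 <= ell e by near: e; exact: near_ell.
have N1 : (Neps b e)%:R <= 6 * expR (2 * p * ell e) by near: e; exact: Neps_le.
have N2 : (Neps b e).+1%:R `^ (2 - 2 * b) <= 5 `^ q * expR (- (q * ell e)).
  by near: e; exact: Neps_tail.
set l := ell e in l1 N1 N2 *; set n := (Neps b e)%:R in N1 *.
have l0 : 0 <= l by lra.
have n0 : 0 <= n by exact: ler0n.
apply/andP; split; first by rewrite mulr_ge0 ?rbound_ge0.
have l2 : l <= l ^+ 2 by rewrite expr2 ler_peMl.
rewrite /rbound -/n mulrDr.
set A := _ `^ (2 - 2 * b) in N2 *.
have A0 : 0 <= A by exact: powR_ge0.
have X0 : 0 <= expR (- (q * l)) by exact: expR_ge0.
have Y0 : 0 <= expR (- ((2 - 6 * p) * l)) by exact: expR_ge0.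
have F0 : 0 <= 5 `^ q :> R by exact: powR_ge0.
apply: lerD.
  have -> : L ^+ 2 * 5 `^ q * (l ^+ 2 * expR (- (q * l))) = l ^+ 2 * (5 `^ q * expR (- (q * l)) * L ^+ 2) by ring.
  by apply: ler_pM => //; [nneg|apply: ler_wpM2r => //; exact: sqr_ge0].
have -> : 64 * 216 * (l ^+ 2 * expR (- ((2 - 6 * p) * l))) =
  l ^+ 2 * (64 * (216 * expR (- ((2 - 6 * p) * l)))) by ring.
apply: ler_pM => //; first by nneg.
apply: ler_wpM2l => //.
have n3 : n ^+ 3 <= (6 * expR (2 * p * l)) ^+ 3.
  by apply: lerXn2r; rewrite ?nnegrE// mulr_ge0// expR_ge0.
apply: (@le_trans _ _ (e ^+ 2 * (6 * expR (2 * p * l)) ^+ 3)); first by apply: ler_wpM2l => //; exact: sqr_ge0.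
rewrite -{1}(ell_expR e0) -/l exprMn -!expRM_natl mulrCA -expRD.
have -> : 2 * - l + 3 * (2 * p * l) = - ((2 - 6 * p) * l) by ring.
by rewrite ler_wpM2r// -natrX ler_nat.
Unshelve. all: by end_near. Qed.

Lemma rbound_cvg : rbound b L ->0.
Proof.
apply: cvg0_le ell_rbound_cvg; apply: filterS (near_ell 1) => e l1.
by rewrite rbound_ge0/= ler_peMl ?rbound_ge0.
Qed.

Lemma ell_Neps_cvg : (fun e => ell e ^+ 2 * (Neps b e)%:R * e) ->0.
Proof.
have g0 : 0 < 1 - 2 * p by have := p3; lra.
apply: (cvg0_le _ (cvg0Z 6 (ell_sqr_expR g0))).
near=> e.
have e01 : 0 < e < 1 by near: e; exact: near01.
have /andP[e0 _] := e01.
have N1 : (Neps b e)%:R <= 6 * expR (2 * p * ell e) by near: e; exact: Neps_le.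
apply/andP; split; first by have ? := ltW e0; nneg.
have -> : expR (- ((1 - 2 * p) * ell e)) = expR (2 * p * ell e) * e.
  by rewrite -[X in _ = _ * X](ell_expR e0) -expRD; congr expR; ring.
have -> : 6 * (ell e ^+ 2 * (expR (2 * p * ell e) * e)) = ell e ^+ 2 * (6 * expR (2 * p * ell e)) * e by ring.
by rewrite ler_wpM2r ?(ltW e0)// ler_wpM2l// sqr_ge0.
Unshelve. all: by end_near. Qed.

Let cT := cos (2 * pi * TT).
Let cT0 : 0 < cT.
Proof.
have /andP[T0 T1] := T01; have pp := pi_gt0 R.
apply: cos_gt0_pihalf; apply/andP; split; last by nra.
by rewrite (@lt_trans _ _ 0)// ?oppr_lt0 ?divr_gt0// !mulr_gt0.
Qed.

Lemma far_cvg : (fun e => expR (- (kappa rho TT e ^+ 2 / 2)) / e ^+ 4) ->0.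
Proof.
pose m := (rho * cT ^+ 2) ^+ 2 / 2.
have m0 : 0 < m by rewrite divr_gt0// exprn_gt0// mulr_gt0// exprn_gt0.
apply: (cvg0_le _ (expR_ell_cvg ltr01)).
near=> e.
have e0 : 0 < e by near: e; exact: nbhs_right_gt.
(* Then [m ell^2 >= 5 ell]: four powers of [e] pay for the division by [e^4] and the fifth gives
   convergence. *)
have l1 : 5 / m <= ell e by near: e; exact: near_ell.
have l0 : 0 <= ell e by rewrite (le_trans _ l1)// divr_ge0// ltW.
apply/andP; split; first by rewrite divr_ge0 ?expR_ge0// exprn_ge0// ltW.
rewrite ler_pdivrMr ?exprn_gt0// -{3}(ell_expR e0) -expRM_natl -expRD ler_expR.
have -> : kappa rho TT e ^+ 2 / 2 = m * ell e ^+ 2 by rewrite /kappa /m -/cT; ring.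
have : 5 <= m * ell e by rewrite mulrC -ler_pdivrMr.
by move=> h; have := ler_wpM2r l0 h; rewrite expr2; lra.
Unshelve. all: by end_near. Qed.

Lemma Err_cvg : Err b L rho TT kap J ->0.
Proof.
rewrite /Err; apply: cvg0D; last first.
  by apply: cvg0Z; apply: cvg0D; apply: cvg0Z; [exact: ell_Neps_cvg|exact: far_cvg].
apply: cvg0D; last by apply: cvg0Z; exact: phimax_cvg.
apply: cvg0D; first by apply: cvg0Z; exact: phimax_cvg.
by apply: cvg0Z; apply: cvg0D; [exact: phimax_cvg|exact: rbound_cvg].
Qed.

Lemma small_noise_near : \forall e \near 0^'+, small_noise b L rho kap J e.
Proof.
have c0 := cmin_gt0 rho0.
have Kc0 : 0 < Kc L by rewrite /Kc ltr_wpDl// mulr_ge0// sqr_ge0.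
have c32 : 0 < cmin rho / 32 by rewrite divr_gt0.
near=> e.
have e01 : 0 < e < 1 by near: e; exact: near01.
have /andP[e0 _] := e01.
have h1 : 1 <= ell e by near: e; exact: near_ell.
have h2 : phimax kap J e <= 1 / 100 by near: e; apply: near_le_eps; [exact: phimax_cvg|rewrite divr_gt0].
split => //.
- by near: e; apply: near_le_eps; [exact: rbound_cvg|].
- by near: e; apply: near_le_eps; [exact: rbound_cvg|].
- have h3 : 16 * Kc L * (ell e * rbound b L e) <= cmin rho.
    by near: e; apply: near_le_eps => //; apply: cvg0Z; exact: ell_rbound_cvg.
  apply: le_trans h3; apply: ler_wpM2l; first by have ? := ltW Kc0; nneg.
  have l0 : 0 <= ell e by exact: le_trans ler01 h1.
  apply: ler_wpM2l => //; apply: ler_piMl; first exact: rbound_ge0.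
  by apply: (le_trans h2); rewrite div1r invf_le1// ler1n.
- have h3 : 4 * (ell e ^+ 2 * expR (- (1 * ell e))) <= 1.
    by near: e; apply: near_le_eps => //; apply: cvg0Z; exact: ell_sqr_expR.
  apply: le_trans h3; rewrite mul1r ell_expR// -mulrA ler_wpM2l// mulrC.
  by apply: ler_wpM2r; [exact: ltW|rewrite expr2 ler_peMl// (le_trans ler01)].
Unshelve. all: by end_near. Qed.

End asymptotics.

Theorem theorem1 (R : realType) (beta L rho T : R) (Theta : set R)
    (kap : R -> nat -> nat) (J : R -> nat) :
  1 < beta -> 0 < L -> 0 < rho -> 0 < T < 1 / 4 ->
  Theta `<=` `]- T, T] ->
  valid_blocks beta kap J -> log_little_o kap J ->
  exists alpha : R -> R, alpha @ 0^'+ --> 0 /\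
    forall e : R, 0 < e < 1 ->
    forall (d : measure_display) (Omega : measurableType d)
           (P : probability Omega R) (Z : nat * bool -> Omega -> R),
    std_gauss_iid P Z ->
    forall (theta : R) (f : R -> R) (est : Omega -> R),
    Theta theta -> Fclass beta L rho f ->
    measurable_fun setT est ->
    (forall w, is_JS_estimate beta kap J e
                 (obs_x e theta f (fun k => Z (k, false) w))
                 (obs_xs e theta f (fun k => Z (k, true) w)) (est w)) ->
    ((e ^- 2 * nfp_sq f)%:E * \int[P]_w ((est w - theta) ^+ 2)%:E
      <= (1 + (1 + alpha e) * risk e f (hstar kap J e f) / nfp_sq f)%:E)%E.
Proof.
move=> b1 L0 rho0 T01 sT vb lo.
pose crude e := e ^- 2 * L ^+ 2 * (1 / 2 + delta_eps e) ^+ 2 * L ^+ 2 / (c2 rho * e ^+ 2).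
(* The second branch is taken only away from 0, because [small_noise] holds for all sufficiently
   small [e]; it does not affect the limit. *)
exists (fun e => if `[< small_noise beta L rho kap J e >] then Err beta L rho T kap J e else crude e).
split.
  have E0 := Err_cvg L b1 rho0 T01 lo.
  have sn := small_noise_near L b1 rho0 lo.
  by apply: (squeeze_cvgr _ E0 E0); apply: filterS sn => e sn; rewrite asboolT// lexx.
move=> e e01 d Omega P Z gZ theta f est /sT; rewrite /= in_itv/= => th fcl mest JS.
case: asboolP => sn.
  exact: (refined_bound b1 L0 rho0 T01 vb gZ e01 th fcl mest JS sn).
exact: (crude_bound b1 L0 rho0 T01 vb P e01 th fcl mest JS).
Qed.
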